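(* The assignment $$\mathrm{Sp}(1,1)\to\mathcal{M}(\mathbb{B}),\qquad A\mapsto\mathcal{F}_{A^{-1}},$$ yields a principal fiber bundle with total space $\mathrm{Sp}(1,1)$, base space $\mathcal{M}(\mathbb{B})$ and structure group $\mathrm{Sp}(1)$, where $\mathrm{Sp}(1)$ acts on $\mathrm{Sp}(1,1)$ by right translations, $A\cdot u=A(uI_2)$.
   Context: $\mathbb{H}$ denotes the quaternions and $\mathbb{B}=\{q\in\mathbb{H}: |q|<1\}$. $\mathrm{Sp}(1,1)=\{A\in M_2(\mathbb{H}): A^*I_{1,1}A=I_{1,1}\}$ with $I_{1,1}=\operatorname{diag}(1,-1)$, a Lie group. $\mathrm{Sp}(1)=\{q\in\mathbb{H}:|q|=1\}$, and $\mathrm{Sp}(1)I_2=\{uI_2:u\in\mathrm{Sp}(1)\}$, a closed subgroup of $\mathrm{Sp}(1,1)$. A function $f:\mathbb{B}\to\mathbb{H}$ is (left) slice regular if for every $I\in\mathbb{H}$ with $I^2=-1$ one has $\frac12\left(\frac{\partial}{\partial x}+I\frac{\partial}{\partial y}\right)f(x+Iy)=0$ whenever $x,y\in\mathbb{R}$, $x+yI\in\mathbb{B}$. Such functions have power series expansions $f(q)=\sum_n q^na_n$ on $\mathbb{B}$. For $f(q)=\sum q^na_n$ and $g(q)=\sum q^nb_n$, the $*$-product is $(f*g)(q)=\sum_n q^n\sum_{k=0}^n a_kb_{n-k}$; the regular conjugate is $f^c(q)=\sum q^n\overline{a_n}$; the symmetrization is $f^s=f*f^c$; the $*$-reciprocal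 is $f^{-*}(q)=f^s(q)^{-1}f^c(q)$ off the zero set of $f^s$. For $a,b\in\mathbb{H}$ let $l_{(a,b)}(q)=qa+b$. For $A=\begin{pmatrix}a&c\\ b&d\end{pmatrix}\in\mathrm{Sp}(1,1)$, the slice regular M\''obius transformation $\mathcal{F}_A:\mathbb{B}\to\mathbb{B}$ is $\mathcal{F}_A=l_{(c,d)}^{-*}*l_{(a,b)}$, written $\mathcal{F}_A(q)=(qc+d)^{-*}*(qa+b)$. Set $\mathcal{M}(\mathbb{B})=\{\mathcal{F}_A:A\in\mathrm{Sp}(1,1)\}$. (Each $\mathcal{F}_A$ is a well defined slice regular bijection of $\mathbb{B}$ onto itself.) Manifold structure: $\mathrm{Sp}(1,1)/\mathrm{Sp}(1)I_2$ carries the unique manifold structure for which the quotient map from $\mathrm{Sp}(1,1)$ is a submersion, and $\mathcal{M}(\mathbb{B})$ carries the manifold structure (of dimension $7$) for which the bijection $\mathrm{Sp}(1,1)/\mathrm{Sp}(1)I_2\to\mathcal{M}(\mathbb{B})$, $A\,\mathrm{Sp}(1)I_2\mapsto\mathcal{F}_{A^{-1}}$, is a diffeomorphism. A principal fiber bundle with structure Lie group $G$ consists of smooth manifolds $P$ (total space), $M$ (base space) and a map $\pi:P\to M$ such that: (1) $\pi$ is a submersion, i.e. a surjective smooth map with surjective differential at every point; (2) there is a free and proper smooth right $G$-action on $P$ whose orbits are precisely the fibers of $\pi$; (3) for every $p\in M$ there are an open $U\ni p$ in $M$ and a $G$-equivariant diffeomorphism $\varphi_U:U\times G\to\pi^{-1}(U)$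 (with $G$ acting on the factor $G$ of $U\times G$ by right translations) such that $\pi\circ\varphi_U$ is the projection onto $U$. *)

(* Defs.v *)
From HB Require Import structures.
From mathcomp Require Import all_boot all_order all_algebra.
From mathcomp Require Import all_classical all_reals all_analysis.
From mathcomp Require Import ring lra.

Set Implicit Arguments.
Unset Strict Implicit.
Unset Printing Implicit Defensive.

Import Order.TTheory GRing.Theory Num.Theory.
Import numFieldNormedType.Exports.

Local Open Scope classical_set_scope.
Local Open Scope ring_scope.


Record quat (R : realType) := Quat { qre : R; qi : R; qj : R; qk : R }.

Section Quaternions.
Context {R : realType}.
Implicit Types p q r : quat R.

(* The identification of H with R^4. *)
Definition qvec q : 'rV[R]_4 := \row_(i < 4) [:: qre q; qi q; qj q; qk q]`_i.
Definition vecq (v : 'rV[R]_4) : quat R :=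
  Quat (v ord0 (@Ordinal 4 0 isT)) (v ord0 (@Ordinal 4 1 isT))
       (v ord0 (@Ordinal 4 2 isT)) (v ord0 (@Ordinal 4 3 isT)).

Lemma qvecK : cancel qvec vecq.
Proof. by case=> a b c d; rewrite /vecq !mxE. Qed.

HB.instance Definition _ := Choice.copy (quat R) (can_type qvecK).

Definition qzero : quat R := Quat 0 0 0 0.
Definition qopp q := Quat (- qre q) (- qi q) (- qj q) (- qk q).
Definition qadd p q :=
  Quat (qre p + qre q) (qi p + qi q) (qj p + qj q) (qk p + qk q).

Fact qaddA : associative qadd.
Proof. by move=> p q r; rewrite /qadd /= !addrA. Qed.
Fact qaddC : commutative qadd.
Proof. by move=> [a b c d] [a' b' c' d']; congr Quat => /=; rewrite addrC. Qed.
Fact qadd0 : left_id qzero qadd.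
Proof. by case=> a b c d; rewrite /qadd /= !add0r. Qed.
Fact qaddN : left_inverse qzero qopp qadd.
Proof. by case=> a b c d; rewrite /qadd /= !addNr. Qed.

HB.instance Definition _ :=
  GRing.isZmodule.Build (quat R) qaddA qaddC qadd0 qaddN.

Definition qone : quat R := Quat 1 0 0 0.
Definition qmul p q :=
  Quat (qre p * qre q - qi p * qi q - qj p * qj q - qk p * qk q)
       (qre p * qi q + qi p * qre q + qj p * qk q - qk p * qj q)
       (qre p * qj q - qi p * qk q + qj p * qre q + qk p * qi q)
       (qre p * qk q + qi p * qj q - qj p * qi q + qk p * qre q).

Fact qmulA : associative qmul.
Proof. by move=> p q r; congr Quat => /=; ring. Qed.
Fact qmul1l : left_id qone qmul.
Proof. by case=> a b c d; congr Quat => /=; ring. Qed.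
Fact qmul1r : right_id qone qmul.
Proof. by case=> a b c d; congr Quat => /=; ring. Qed.
Fact qmulDl : left_distributive qmul +%R.
Proof. by move=> p q r; congr Quat => /=; ring. Qed.
Fact qmulDr : right_distributive qmul +%R.
Proof. by move=> p q r; congr Quat => /=; ring. Qed.
Fact qone_neq0 : qone != 0.
Proof. by apply/eqP => -[] /eqP; rewrite oner_eq0. Qed.

HB.instance Definition _ := GRing.Zmodule_isNzRing.Build (quat R)
  qmulA qmul1l qmul1r qmulDl qmulDr qone_neq0.

Definition qconj q := Quat (qre q) (- qi q) (- qj q) (- qk q).
Definition qnorm2 q := qre q ^+ 2 + qi q ^+ 2 + qj q ^+ 2 + qk q ^+ 2.
Definition qabs q : R := Num.sqrt (qnorm2 q).
Definition qinv q := Quat (qre q / qnorm2 q) (- qi q / qnorm2 q)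
                          (- qj q / qnorm2 q) (- qk q / qnorm2 q).

Lemma qnorm2_ge0 q : 0 <= qnorm2 q.
Proof. by rewrite /qnorm2 !addr_ge0 ?sqr_ge0. Qed.

Lemma qnorm2_eq0 q : (qnorm2 q == 0) = (q == 0).
Proof.
apply/idP/eqP => [|->]; last by rewrite /qnorm2 /= expr0n /= !addr0.
rewrite /qnorm2 !paddr_eq0 ?addr_ge0 ?sqr_ge0 // !sqrf_eq0.
by case: q => a b c d /= /andP[/andP[/andP[/eqP-> /eqP->] /eqP->] /eqP->].
Qed.

Lemma qnorm2M p q : qnorm2 (p * q) = qnorm2 p * qnorm2 q.
Proof. by rewrite /qnorm2 /=; ring. Qed.

Lemma qabs_eq1 q : (qabs q == 1) = (qnorm2 q == 1).
Proof.
apply/eqP/eqP; rewrite /qabs; last by move->; rewrite sqrtr1.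
by move=> h; rewrite -(sqr_sqrtr (qnorm2_ge0 q)) h expr1n.
Qed.

Lemma qconjM p q : qconj (p * q) = qconj q * qconj p.
Proof. by congr Quat => /=; ring. Qed.
Lemma qconjD p q : qconj (p + q) = qconj p + qconj q.
Proof. by congr Quat => /=; ring. Qed.
Lemma qconjN p : qconj (- p) = - qconj p.
Proof. by []. Qed.
Lemma qconjK : involutive qconj.
Proof. by case=> a b c d; congr Quat => /=; rewrite opprK. Qed.
Lemma qconj0 : qconj 0 = 0.
Proof. by congr Quat => /=; rewrite oppr0. Qed.
Lemma qconj1 : qconj 1 = 1.
Proof. by congr Quat => /=; rewrite oppr0. Qed.
Lemma qmul_conj q : q * qconj q = Quat (qnorm2 q) 0 0 0.
Proof. by congr Quat; rewrite /qnorm2 /=; ring. Qed.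
Lemma qconj_mul q : qconj q * q = Quat (qnorm2 q) 0 0 0.
Proof. by congr Quat; rewrite /qnorm2 /=; ring. Qed.

Fact qmulVr : {in [pred q | q != 0], left_inverse 1 qinv *%R}.
Proof.
move=> q; rewrite inE -qnorm2_eq0 /qnorm2 => q0.
by congr Quat; rewrite /= /qnorm2; field.
Qed.
Fact qmulrV : {in [pred q | q != 0], right_inverse 1 qinv *%R}.
Proof.
move=> q; rewrite inE -qnorm2_eq0 /qnorm2 => q0.
by congr Quat; rewrite /= /qnorm2; field.
Qed.
Fact qunitP p q : q * p = 1 /\ p * q = 1 -> p != 0.
Proof.
by case=> + _; apply: contra_eqN => /eqP ->; rewrite mulr0 eq_sym oner_eq0.
Qed.
Fact qinv0 : {in [predC [pred q | q != 0]], qinv =1 id}.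
Proof.
by move=> q; rewrite !inE negbK => /eqP ->; congr Quat => /=;
  rewrite ?oppr0 mul0r.
Qed.

HB.instance Definition _ :=
  GRing.NzRing_hasMulInverse.Build (quat R) qmulVr qmulrV qunitP qinv0.

End Quaternions.


Section Groups.
Variable R : realType.
Notation H := (quat R).

Record Sp1 := MkSp1 { sp1_val :> H; _ : qabs sp1_val == 1 }.
HB.instance Definition _ := [isSub for sp1_val].
HB.instance Definition _ := [Choice of Sp1 by <:].

Fact sp1_one_subproof : qabs (1 : H) == 1.
Proof. by rewrite qabs_eq1 /qnorm2 /= expr1n expr0n /= !addr0. Qed.
Fact sp1_mul_subproof (u v : Sp1) : qabs ((u : H) * v) == 1.
Proof.
case: u v => u /= + [v /=]; rewrite !qabs_eq1 qnorm2M.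
by move=> /eqP -> /eqP ->; rewrite mulr1.
Qed.
Fact sp1_inv_subproof (u : Sp1) : qabs (qconj u) == 1.
Proof. by case: u => u /=; rewrite !qabs_eq1 /qnorm2 /= !sqrrN. Qed.

Definition sp1_one := MkSp1 sp1_one_subproof.
Definition sp1_mul u v := MkSp1 (sp1_mul_subproof u v).
Definition sp1_inv u := MkSp1 (sp1_inv_subproof u).

Fact sp1_mulA : associative sp1_mul.
Proof. by move=> u v w; apply: val_inj; rewrite /= mulrA. Qed.
Fact sp1_mul1g : left_id sp1_one sp1_mul.
Proof. by move=> u; apply: val_inj; rewrite /= mul1r. Qed.
Fact sp1_mulg1 : right_id sp1_one sp1_mul.
Proof. by move=> u; apply: val_inj; rewrite /= mulr1. Qed.
Fact sp1_mulVg : left_inverse sp1_one sp1_inv sp1_mul.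
Proof.
case=> u u1; apply: val_inj; rewrite /= qconj_mul.
by move: u1; rewrite qabs_eq1 => /eqP ->.
Qed.
Fact sp1_mulgV : right_inverse sp1_one sp1_inv sp1_mul.
Proof.
case=> u u1; apply: val_inj; rewrite /= qmul_conj.
by move: u1; rewrite qabs_eq1 => /eqP ->.
Qed.

HB.instance Definition _ :=
  isGroup.Build Sp1 sp1_mulA sp1_mul1g sp1_mulg1 sp1_mulVg sp1_mulgV.

Definition qadj (A : 'M[H]_2) : 'M[H]_2 := (map_mx qconj A)^T.
Definition I11 : 'M[H]_2 := diag_mx (\row_(i < 2) (-1) ^+ i).

Record Sp11 :=
  MkSp11 { sp11_val :> 'M[H]_2; _ : qadj sp11_val *m I11 *m sp11_val == I11 }.
HB.instance Definition _ := [isSub for sp11_val].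
HB.instance Definition _ := [Choice of Sp11 by <:].

Lemma qadjM (A B : 'M[H]_2) : qadj (A *m B) = qadj B *m qadj A.
Proof.
apply/matrixP => i j; rewrite !mxE (big_morph _ qconjD qconj0).
by apply: eq_bigr => k _; rewrite !mxE qconjM.
Qed.

Lemma qadjK : involutive qadj.
Proof. by move=> A; apply/matrixP => i j; rewrite !mxE qconjK. Qed.

Lemma I11K : I11 *m I11 = 1%:M.
Proof.
rewrite mulmx_diag -diag_const_mx; congr diag_mx.
by apply/rowP => i; rewrite !mxE -exprD addnn -mul2n exprM sqrrN !expr1n.
Qed.

Lemma qmx2P (A B : 'M[H]_2) : A 0 0 = B 0 0 -> A 0 1 = B 0 1 ->
  A 1 0 = B 1 0 -> A 1 1 = B 1 1 -> A = B.
Proof.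
move=> h00 h01 h10 h11; apply/matrixP => i j.
have E (k : 'I_2) : k = 0 \/ k = 1.
  by case: k => -[|[|//]] ?; [left|right]; apply: val_inj.
by case: (E i) (E j) => -> [] ->.
Qed.

Lemma adjI11E (A : 'M[H]_2) (i j : 'I_2) : (qadj A *m I11 *m A) i j =
  qconj (A 0 i) * A 0 j - qconj (A 1 i) * A 1 j.
Proof.
rewrite /I11 mul_mx_diag mxE big_ord_recl big_ord1 !mxE /= expr0 expr1.
rewrite mulr1 mulrN1 mulNr.
by congr (_ * A _ j - qconj (A _ i) * A _ j); apply: val_inj.
Qed.

Lemma I11E :
  (I11 0 0 = 1) * (I11 0 1 = 0) * (I11 1 0 = 0) * (I11 1 1 = -1).
Proof. by rewrite /I11 !mxE /= expr0 expr1 !mulr1n !mulr0n. Qed.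

Lemma qadjE (A : 'M[H]_2) i j : qadj A i j = qconj (A j i).
Proof. by rewrite !mxE. Qed.

Lemma qadjI11 : qadj I11 = I11.
Proof. by apply: qmx2P; rewrite qadjE !I11E ?qconjN ?qconj1 ?qconj0. Qed.

(* A left I_{1,1}-isometry is a right one: over the division ring H this is
   what makes I A^* I a two-sided inverse of A. *)
Lemma sp11_adj (A : 'M[H]_2) :
  qadj A *m I11 *m A = I11 -> A *m I11 *m qadj A = I11.
Proof.
move=> hA; have hij i j : (qadj A *m I11 *m A) i j = I11 i j by rewrite hA.
rewrite -{1}[A]qadjK.
move: (hij 0 0) (hij 0 1) (hij 1 1); rewrite !adjI11E !I11E.
set a := A 0 0; set b := A 1 0; set c := A 0 1; set d := A 1 1.
rewrite !qconj_mul => /(congr1 (@qre _)) /= ab /subr0_eq acbd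
  /(congr1 (@qre _)) /= cd.
have bge := qnorm2_ge0 b.
have a0 : qnorm2 a != 0 by apply: lt0r_neq0; lra.
have nn : qnorm2 a * qnorm2 c = qnorm2 b * qnorm2 d.
  have := congr1 (@qnorm2 _) acbd; rewrite !qnorm2M.
  have cj (q : H) : qnorm2 (qconj q) = qnorm2 q by rewrite /qnorm2 /= !sqrrN.
  by rewrite !cj.
have bc : qnorm2 b = qnorm2 c by nra.
have da : qnorm2 d = qnorm2 a by lra.
have a0' : a != 0 by rewrite -qnorm2_eq0.
have ca0 : qconj a != 0.
  by apply: contra a0' => /eqP h; rewrite -[a]qconjK h qconj0.
have cdab : c * qconj d = a * qconj b.
  have ra : GRing.lreg (qconj a) by apply/mulrI.
  apply: ra; rewrite mulrA acbd -mulrA qmul_conj da mulrA qconj_mul.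
  by congr Quat => /=; ring.
apply: qmx2P; rewrite adjI11E !I11E !qadjE !qconjK -/a -/b -/c -/d.
- rewrite !qmul_conj; congr Quat => /=; lra.
- by rewrite cdab subrr.
- by have := congr1 qconj cdab; rewrite !qconjM !qconjK => ->; rewrite subrr.
- rewrite !qmul_conj; congr Quat => /=; lra.
Qed.

Fact sp11_one_subproof : qadj 1%:M *m I11 *m 1%:M == I11.
Proof.
rewrite mulmx1; suff -> : qadj 1%:M = 1%:M by rewrite mul1mx.
by apply: qmx2P; rewrite qadjE !mxE /= ?mulr0n ?mulr1n ?qconj0 ?qconj1.
Qed.
Fact sp11_mul_subproof (A B : Sp11) :
  qadj (A *m B) *m I11 *m ((A : 'M[H]_2) *m B) == I11.
Proof.
case: A B => A /= /eqP hA [B /= /eqP hB].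
by rewrite qadjM -!mulmxA (mulmxA I11) (mulmxA (qadj A)) (mulmxA (qadj A)) hA
  mulmxA hB.
Qed.
Fact sp11_inv_subproof (A : Sp11) :
  qadj (I11 *m qadj A *m I11) *m I11 *m (I11 *m qadj A *m I11) == I11.
Proof.
case: A => A /= /eqP /sp11_adj hA.
rewrite !qadjM qadjK qadjI11 -!mulmxA (mulmxA I11 I11 (_ *m _)) I11K mul1mx.
by rewrite (mulmxA A) (mulmxA (A *m _)) hA I11K mulmx1.
Qed.

Definition sp11_one := MkSp11 sp11_one_subproof.
Definition sp11_mul A B := MkSp11 (sp11_mul_subproof A B).
Definition sp11_inv A := MkSp11 (sp11_inv_subproof A).

Fact sp11_mulA : associative sp11_mul.
Proof. by move=> A B C; apply: val_inj; rewrite /= mulmxA. Qed.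
Fact sp11_mul1g : left_id sp11_one sp11_mul.
Proof. by move=> A; apply: val_inj; rewrite /= mul1mx. Qed.
Fact sp11_mulg1 : right_id sp11_one sp11_mul.
Proof. by move=> A; apply: val_inj; rewrite /= mulmx1. Qed.
Fact sp11_mulVg : left_inverse sp11_one sp11_inv sp11_mul.
Proof.
case=> A hA; apply: val_inj => /=; move/eqP: hA => hA.
by rewrite -!mulmxA (mulmxA (qadj A)) hA I11K.
Qed.
Fact sp11_mulgV : right_inverse sp11_one sp11_inv sp11_mul.
Proof.
case=> A hA; apply: val_inj => /=; move/eqP: hA => /sp11_adj hA.
by rewrite !mulmxA hA I11K.
Qed.

HB.instance Definition _ :=
  isGroup.Build Sp11 sp11_mulA sp11_mul1g sp11_mulg1 sp11_mulVg sp11_mulgV.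

Fact sp1_scalar_subproof (u : Sp1) :
  qadj (u : H)%:M *m I11 *m (u : H)%:M == I11.
Proof.
case: u => u /=; rewrite qabs_eq1 => /eqP u1; apply/eqP.
apply: qmx2P; rewrite adjI11E !I11E !mxE /= ?mulr0n ?mulr1n ?qconj0;
  by rewrite ?mulr0 ?mul0r ?subr0 ?sub0r ?oppr0 // qconj_mul u1.
Qed.

Definition sp1_scalar (u : Sp1) : Sp11 := MkSp11 (sp1_scalar_subproof u).

Definition sp11_act (A : Sp11) (u : Sp1) : Sp11 := (A * sp1_scalar u)%g.

Definition Sp1I2 : set Sp11 := range sp1_scalar.
Definition lcoset_Sp1I2 (A : Sp11) : set Sp11 :=
  [set (A * B)%g | B in Sp1I2].

(* The set Sp(1,1) / Sp(1)I_2 of left cosets. *)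
Definition Sp11_quot := set_type (range lcoset_Sp1I2).
Definition quot_map (A : Sp11) : Sp11_quot :=
  exist _ (lcoset_Sp1I2 A) (mem_set (imageT lcoset_Sp1I2 A)).


Definition Bq := {q : H | qabs q < 1}.

Definition qpartial_sum (a : nat -> H) (q : H) (n : nat) : H :=
  \sum_(k < n) q ^+ k * a k.

Definition has_expansion (f : Bq -> H) (a : nat -> H) : Prop :=
  forall q : Bq,
    (fun n => qvec (qpartial_sum a (val q) n)) @ \oo --> qvec (f q).

Definition qpower_series (a : nat -> H) (q : Bq) : H :=
  vecq (limn (fun n => qvec (qpartial_sum a (val q) n))).

(* The coefficient sequence of f, meaningful when f has an expansion on B. *)
Definition coefs (f : Bq -> H) : nat -> H :=
  xget (fun=> 0) [set a | has_expansion f a].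

Definition star (f g : Bq -> H) : Bq -> H :=
  qpower_series (fun n => \sum_(k < n.+1) coefs f k * coefs g (n - k)).

Definition regular_conj (f : Bq -> H) : Bq -> H :=
  qpower_series (fun n => qconj (coefs f n)).

Definition symmetrization (f : Bq -> H) : Bq -> H := star f (regular_conj f).

(* The value at the zeros of the symmetrization (where the *-reciprocal is
   undefined) is 0, since 0^-1 = 0. *)
Definition star_recip (f : Bq -> H) : Bq -> H :=
  fun q => (symmetrization f q)^-1 * regular_conj f q.

Definition lin (a b : H) : Bq -> H := fun q => val q * a + b.

(* A = (a c; b d) |-> (q c + d)^{-*} * (q a + b) *)
Definition moebius (A : Sp11) : Bq -> H :=
  star (star_recip (lin (sp11_val A 0 1) (sp11_val A 1 1)))
       (lin (sp11_val A 0 0) (sp11_val A 1 0)).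

Definition MB := set_type (range moebius).
Definition moebius_inv (A : Sp11) : MB :=
  exist _ (moebius A^-1%g) (mem_set (imageT moebius A^-1%g)).

End Groups.


Section SmoothEuclidean.
Context {R : realType} {m n : nat}.

(* Meant for open D. *)
Fixpoint Ck (k : nat) (D : set 'rV[R]_m) (f : 'rV[R]_m -> 'rV[R]_n) : Prop :=
  match k with
  | 0%N => forall x, D x -> {for x, continuous f}
  | k'.+1 => (forall x, D x -> differentiable f x) /\
             forall v : 'rV[R]_m, Ck k' D ('D_v f)
  end.

Definition Cinfty (D : set 'rV[R]_m) (f : 'rV[R]_m -> 'rV[R]_n) : Prop :=
  forall k, Ck k D f.

End SmoothEuclidean.

(* A chart with its inverse; only the restrictions to the domain [cdom] and to
   its image matter. *)
Record chart (R : realType) (n : nat) (T : Type) := Chart {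
  cdom : set T;
  cto : T -> 'rV[R]_n;
  cfrom : 'rV[R]_n -> T }.

Definition atlas (R : realType) n T := set (chart R n T).

Section Manifolds.
Context {R : realType}.

Definition is_chart n T (c : chart R n T) : Prop :=
  open (cto c @` cdom c) /\ forall x, cdom c x -> cfrom c (cto c x) = x.

Definition compatible n T (c d : chart R n T) : Prop :=
  open (cto c @` (cdom c `&` cdom d)) /\
  Cinfty (cto c @` (cdom c `&` cdom d)) (cto d \o cfrom c).

Definition smooth_atlas n T (A : atlas R n T) : Prop :=
  [/\ forall c, A c -> is_chart c,
      forall x, exists2 c, A c & cdom c x &
      forall c d, A c -> A d -> compatible c d].

(* The type T with the topology for which the charts of A are homeomorphisms
   onto open sets; it is generated by the sets (U, phi)^{-1}(W), W open. *)
Definition mfd n (T : Type) (A : atlas R n T) : Type := T.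
HB.instance Definition _ n (T : choiceType) (A : atlas R n T) :=
  Choice.copy (mfd A) T.
Definition chart_open n (T : Type) (A : atlas R n T) : set (set T) :=
  [set V | exists c W, [/\ A c, open W & V = cdom c `&` cto c @^-1` W]].
HB.instance Definition _ n (T : choiceType) (A : atlas R n T) :=
  isSubBaseTopological.Build (mfd A) (chart_open A) id.

Definition smooth_manifold n (T : choiceType) (A : atlas R n T) : Prop :=
  [/\ smooth_atlas A, hausdorff_space (mfd A) & @second_countable (mfd A)].

Definition prod_chart m n T U (c : chart R m T) (d : chart R n U) :
    chart R (m + n) (T * U) :=
  Chart (cdom c `*` cdom d)
        (fun z => row_mx (cto c z.1) (cto d z.2))
        (fun v => (cfrom c (lsubmx v), cfrom d (rsubmx v))).

Definition prod_atlas m n T U (A : atlas R m T) (B : atlas R n U) :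
    atlas R (m + n) (T * U) :=
  [set e | exists c d, [/\ A c, B d & e = prod_chart c d]].

(* Smoothness of f on the open set W. *)
Definition smooth_on m n (T U : choiceType) (A : atlas R m T) (B : atlas R n U)
    (W : set T) (f : T -> U) : Prop :=
  (forall x, W x -> {for x, continuous (f : mfd A -> mfd B)}) /\
  forall c d, A c -> B d ->
    Cinfty (cto c @` (cdom c `&` W `&` f @^-1` cdom d))
           (cto d \o f \o cfrom c).

Definition smooth_map m n (T U : choiceType) (A : atlas R m T)
    (B : atlas R n U) (f : T -> U) : Prop := smooth_on A B setT f.

(* f restricts to a diffeomorphism between the open sets V and W. *)
Definition diffeo_on m n (T U : choiceType) (A : atlas R m T) (B : atlas R n U)
    (V : set T) (W : set U) (f : T -> U) : Prop :=
  exists g : U -> T,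
    [/\ forall x, V x -> W (f x) /\ g (f x) = x,
        forall y, W y -> V (g y) /\ f (g y) = y,
        smooth_on A B V f & smooth_on B A W g].

Definition diffeo m n (T U : choiceType) (A : atlas R m T) (B : atlas R n U)
    (f : T -> U) : Prop := diffeo_on A B setT setT f.

Definition surj_differential m n T U (A : atlas R m T) (B : atlas R n U)
    (f : T -> U) (x : T) : Prop :=
  forall c d, A c -> B d -> cdom c x -> cdom d (f x) ->
    forall w : 'rV[R]_n, exists v : 'rV[R]_m,
      'd (cto d \o f \o cfrom c) (cto c x) v = w.

Definition submersion m n (T U : choiceType) (A : atlas R m T)
    (B : atlas R n U) (f : T -> U) : Prop :=
  [/\ smooth_map A B f, forall y, exists x, f x = y &
      forall x, surj_differential A B f x].

(* The smooth structure of T seen, through the injection e, as an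
   n-dimensional embedded submanifold of R^N: its charts are the
   diffeomorphisms between open subsets of e(T) and open subsets of R^n, where
   a function on a subset of R^N is smooth if it extends, locally around each
   point, to a smooth function on an open subset of R^N. *)
Definition submanifold_atlas N n T (e : T -> 'rV[R]_N) : atlas R n T :=
  [set c | [/\ is_chart c,
      exists2 O, open O & cdom c = e @^-1` O,
      Cinfty (cto c @` cdom c) (e \o cfrom c) &
      forall x, cdom c x -> exists O (F : 'rV[R]_N -> 'rV[R]_n),
        [/\ open O, O (e x), Cinfty O F &
            forall y, cdom c y -> O (e y) -> F (e y) = cto c y]]].

Definition lie_group n (G : groupType) (A : atlas R n G) : Prop :=
  [/\ smooth_manifold A,
      smooth_map (prod_atlas A A) A (fun z : G * G => (z.1 * z.2)%g) &
      smooth_map A A (fun g : G => g^-1%g)].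

Definition proper_map (X Y : topologicalType) (f : X -> Y) : Prop :=
  continuous f /\ forall K : set Y, compact K -> compact (f @^-1` K).

Record principal_bundle p m g (P M : choiceType) (G : groupType)
    (AP : atlas R p P) (AM : atlas R m M) (AG : atlas R g G)
    (act : P -> G -> P) (pi : P -> M) : Prop := {
  pb_total_manifold : smooth_manifold AP;
  pb_base_manifold : smooth_manifold AM;
  pb_structure_group : lie_group AG;
  pb_submersion : submersion AP AM pi;
  pb_act1 : forall x, act x 1%g = x;
  pb_actM : forall x h k, act x (h * k)%g = act (act x h) k;
  pb_act_smooth : smooth_map (prod_atlas AP AG) AP (fun z => act z.1 z.2);
  pb_act_free : forall x h, act x h = x -> h = 1%g;
  pb_act_proper :
    proper_map (X := mfd (prod_atlas AP AG)) (Y := mfd (prod_atlas AP AP))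
      (fun z : P * G => (z.1, act z.1 z.2));
  pb_orbits : forall x, [set act x h | h in [set: G]] = pi @^-1` [set pi x];
  pb_locally_trivial : forall y : M, exists (U : set M) (phi : M * G -> P),
    [/\ @open (mfd AM) U, U y,
        diffeo_on (prod_atlas AM AG) AP (U `*` setT) (pi @^-1` U) phi,
        forall z h k, U z -> phi (z, (h * k)%g) = act (phi (z, h)) k &
        forall z h, U z -> pi (phi (z, h)) = z] }.

End Manifolds.

Section Structures.
Variable R : realType.

Definition sp1_vec (u : Sp1 R) : 'rV[R]_4 := qvec (sp1_val u).
Definition sp11_vec (A : Sp11 R) : 'rV[R]_(4 + 4 + (4 + 4)) :=
  row_mx (row_mx (qvec (sp11_val A 0 0)) (qvec (sp11_val A 0 1)))
         (row_mx (qvec (sp11_val A 1 0)) (qvec (sp11_val A 1 1))).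

Definition sp1_atlas : atlas R 3 (Sp1 R) := submanifold_atlas sp1_vec.
Definition sp11_atlas : atlas R 10 (Sp11 R) := submanifold_atlas sp11_vec.

(* AQ is a manifold structure on Sp(1,1)/Sp(1)I_2 making the quotient map a
   submersion, and AM is the one on M(B) obtained from it by transport along
   A Sp(1)I_2 |-> F_{A^{-1}}. *)
Definition moebius_structure (AQ : atlas R 7 (Sp11_quot R))
    (AM : atlas R 7 (MB R)) : Prop :=
  [/\ smooth_manifold AQ,
      submersion sp11_atlas AQ (@quot_map R),
      smooth_manifold AM &
      exists Phi : Sp11_quot R -> MB R,
        (forall A, Phi (quot_map A) = moebius_inv A) /\ diffeo AQ AM Phi].

End Structures.

Arguments sp1_atlas : clear implicits.
Arguments sp11_atlas : clear implicits.

(* Main.v *)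
Require Import Defs.
From HB Require Import structures.
From mathcomp Require Import all_boot all_order all_algebra.
From mathcomp Require Import all_classical all_reals all_analysis.
From mathcomp Require Import ring lra.

(** Let A = (a c; b d) lie in Sp(1,1). The relations defining the group give
    |a|^2 = |d|^2 = 1 + |b|^2, so a never vanishes and the phase a / |a| is a
    smooth function of A with values in Sp(1); it satisfies
    phase (A u) = phase A * u. Hence every orbit of Sp(1) meets the slice
    {a > 0} in exactly one point, and this slice is parametrized by
    b in H and w in Sp(1) through the matrix (n, b^* w; b, n w) with
    n = sqrt (1 + |b|^2). This identifies Sp(1,1) with (H x Sp(1)) x Sp(1),
    equivariantly for right translations on the last factor
    ([slice_decomp], [frame_smooth], [coords_smooth], [phase_smooth]): the
    bundle is trivial over its whole base.

    The fibers of A |-> F_{A^-1} are the orbits ([moebius_inv_fiber]). The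
    *-reciprocal of q c + d is the geometric series with coefficients
    (- d^-1 c)^n d^-1, so the power series of F_A is explicit
    ([moebius_expansion]); its first three coefficients determine d^-1 a,
    d^-1 b and d^-1 c, so that F_A = F_A' if and only if A' = u A with
    |u| = 1. Power series are determined by their values at real points.

    What remains is to recognize the manifold structure of the base. If the
    quotient map is a submersion for some 7-dimensional structure on the set of
    cosets, then (b, w) |-> class of the slice point (b, w) is a smooth
    bijection onto it whose differential is surjective at every point, because
    the quotient map factors through it. Between manifolds of the same
    dimension, such a bijection is a diffeomorphism, by the inverse function
    theorem ([inverse_Cinfty], [smooth_map_inverse]). So the structure is the
    one of H x Sp(1) ([fibration_embedded]), and transport along the bijection
    with the set of Moebius transformations gives the same description there.

    All the manifolds involved are thus embedded in a Euclidean space: H x Sp(1)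
    in R^8, Sp(1) in R^4, Sp(1,1) in R^16, and their products. A map between
    embedded manifolds is smooth as soon as it extends to the ambient space
    ([ext_smooth_map]), and every map in the statement extends by a formula made
    of quaternion products, conjugations and sqrt (1 + |b|^2) ([pi_bundle]).
    The same coordinates produce a structure with the required properties, which
    gives existence. *)

Set Implicit Arguments.
Unset Strict Implicit.
Unset Printing Implicit Defensive.

Import Order.TTheory GRing.Theory Num.Theory.
Import numFieldNormedType.Exports.

Local Open Scope classical_set_scope.
Local Open Scope ring_scope.

(** * Calculus of C^k maps *)
Section NearEq.
Context {R : realType} {V W : normedModType R}.

Lemma near_eq_differentiable (f g : V -> W) (a : V) :
  {near a, f =1 g} -> differentiable f a -> differentiable g a.
Proof.
move=> fg /diff_locallyP[cf ef].
have h : g \o shift a = cst (g a) + 'd f a +o_ 0 id.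
  rewrite -(nbhs_singleton fg); apply/eqaddoP => e e0.
  have /eqaddoP/(_ e e0) H := ef.
  have K : \forall h \near (0 : V), f (h + a) = g (h + a).
    have : \forall x \near a, f x = g x by [].
    by rewrite (near_shift 0) subr0.
  apply: filterS2 H K => y + fgy.
  by rewrite !fctE /= fgy.
by apply/diff_locallyP; rewrite (diff_unique cf h).
Qed.

Lemma near_eq_diff (f g : V -> W) (a v : V) :
  {near a, f =1 g} -> differentiable f a -> 'd f a v = 'd g a v.
Proof.
move=> fg df; have dg := near_eq_differentiable fg df.
by rewrite -(deriveE v df) -(deriveE v dg); exact: near_eq_derive.
Qed.

End NearEq.

Section CkV.
Context {R : realType} {m : nat}.
Local Notation E := 'rV[R]_m.

Section Def.
Context {V : normedModType R}.

(** The recursion of [Ck] with values in an arbitrary normed module: scalar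
    products, inverses and square roots are differentiated before they become
    the coordinates of a vector-valued map. *)
Fixpoint CkV (k : nat) (D : set E) (f : E -> V) : Prop :=
  match k with
  | 0%N => forall x, D x -> {for x, continuous f}
  | k'.+1 => (forall x, D x -> differentiable f x) /\
             forall v : E, CkV k' D ('D_v f)
  end.

Lemma CkV_succ k D (f : E -> V) : CkV k.+1 D f <->
  (forall x, D x -> differentiable f x) /\ forall v : E, CkV k D ('D_v f).
Proof. by []. Qed.

End Def.

Lemma Ck_CkV n k D (f : E -> 'rV[R]_n) : Ck k D f <-> CkV k D f.
Proof.
elim: k f => [|k IH] f //=; split=> -[df cf]; split=> // v; exact/IH/cf.
Qed.

Section Generic.
Context {V : normedModType R}.
Implicit Types (f g : E -> V) (D O : set E).

Lemma CkV_pred k D f : CkV k.+1 D f -> CkV k D f.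
Proof.
elim: k f => [|k IH] f /= [df cf].
  by move=> x /df; exact: differentiable_continuous.
by split=> // v; apply: IH; exact: cf.
Qed.

Lemma CkV_sub k D O f : D `<=` O -> CkV k O f -> CkV k D f.
Proof.
move=> DO; elim: k f => [|k IH] f /=; first by move=> h x /DO; exact: h.
by case=> df cf; split=> [x /DO|v]; [exact: df|exact/IH/cf].
Qed.

Lemma open_eq_near D f g x : open D -> {in D, f =1 g} -> D x ->
  {near x, f =1 g}.
Proof.
move=> oD fg Dx; have nD : nbhs x D by exact: open_nbhs_nbhs.
have DS : D `<=` [set y | f y = g y] by move=> y Dy; rewrite /= fg// inE.
exact: filterS DS nD.
Qed.

Lemma CkV_eq k D f g : open D -> {in D, f =1 g} -> CkV k D f -> CkV k D g.
Proof.
move=> oD; elim: k f g => [|k IH] f g fg /=.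
  move=> cf x Dx; rewrite /prop_for /continuous_at -fg ?inE//.
  exact: cvg_trans (near_eq_cvg (open_eq_near oD fg Dx)) (cf x Dx).
case=> df cf; split=> [x Dx|v].
  exact: near_eq_differentiable (open_eq_near oD fg Dx) (df x Dx).
apply: IH (cf v) => x; rewrite inE => Dx.
exact: near_eq_derive (open_eq_near oD fg Dx).
Qed.

Lemma CkV_local k D f :
  (forall x, D x -> exists U, U x /\ CkV k U f) -> CkV k D f.
Proof.
elim: k f => [|k IH] f h /=.
  by move=> x Dx; have [U [Ux cf]] := h x Dx; exact: cf.
split=> [x Dx|v]; first by have [U [Ux []]] := h x Dx => + _; apply.
by apply: IH => x /h[U [Ux /CkV_succ[_ cf]]]; exists U; split=> //; exact: cf.
Qed.

Lemma CkV_cst k D (c : V) : CkV k D (fun=> c).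
Proof.
elim: k c => [|k IH] c /=; first by move=> x _; exact: cst_continuous.
split=> [x _|v]; first exact: differentiable_cst.
rewrite (_ : 'D_v _ = fun=> 0)//; apply/funext => x.
exact: (@derive_cst _ _ _ c).
Qed.

Lemma CkV_D k D f g : open D -> CkV k D f -> CkV k D g ->
  CkV k D (fun x => f x + g x).
Proof.
move=> oD; elim: k f g => [|k IH] f g /=.
  by move=> cf cg x Dx; apply: continuousD; [exact: cf|exact: cg].
move=> [df cf] [dg cg]; split=> [x Dx|v].
  by apply: differentiableD; [exact: df|exact: dg].
apply: (@CkV_eq _ _ (fun x => 'D_v f x + 'D_v g x)) => //; last exact: IH.
move=> x; rewrite inE => Dx; rewrite deriveD//.
  exact/diff_derivable/df.
exact/diff_derivable/dg.
Qed.

Lemma CkV_N k D f : open D -> CkV k D f -> CkV k D (fun x => - f x).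
Proof.
move=> oD; elim: k f => [|k IH] f /=.
  by move=> cf x Dx; apply: continuousN; exact: cf.
move=> [df cf]; split=> [x Dx|v]; first by apply: differentiableN; exact: df.
apply: (@CkV_eq _ _ (fun x => - 'D_v f x)) => //; last exact: IH.
move=> x; rewrite inE => Dx; rewrite deriveN//.
exact/diff_derivable/df.
Qed.

Lemma CkV_sum k D n (F : 'I_n -> E -> V) : open D ->
  (forall i, CkV k D (F i)) -> CkV k D (fun x => \sum_i F i x).
Proof.
move=> oD; elim: n F => [|n IH] F cF.
  apply: (@CkV_eq _ _ (fun=> 0)) => //; last exact: CkV_cst.
  by move=> x _; rewrite big_ord0.
apply: (@CkV_eq _ _ (fun x => \sum_(i < n) F (widen_ord (leqnSn n) i) x
  + F ord_max x)) => //.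
  by move=> x _; rewrite big_ord_recr.
by apply: CkV_D => //; exact: IH.
Qed.

End Generic.

Lemma CkV_lin (V W : normedModType R) k D (L : {linear V -> W}) (f : E -> V) :
  open D -> continuous L -> CkV k D f -> CkV k D (fun x => L (f x)).
Proof.
move=> oD cL; elim: k f => [|k IH] f /=.
  move=> cf x Dx; apply: (@continuous_comp _ _ _ f L); first exact: cf.
  exact: cL.
move=> [df cf].
have dL x : D x -> differentiable (L \o f) x.
  by move=> Dx; apply: differentiable_comp; [exact: df|exact: linear_differentiable].
split; first exact: dL.
move=> v; apply: (@CkV_eq _ _ _ (fun x => L ('D_v f x))) => //; last exact: IH.
move=> x; rewrite inE => Dx.
rewrite [RHS]deriveE; last exact: (dL x Dx).
rewrite diff_comp //=; [|exact: df|exact: linear_differentiable].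
by rewrite diff_lin// deriveE//; exact: df.
Qed.

Lemma CkV_linE (V : normedModType R) k D (L : {linear E -> V}) :
  continuous L -> CkV k D L.
Proof.
move=> cL; case: k => [|k] /=; first by move=> x _; exact: cL.
split=> [x _|v]; first exact: linear_differentiable.
rewrite (_ : 'D_v L = fun=> L v); first exact: CkV_cst.
by apply/funext => x; rewrite deriveE ?diff_lin//; exact: linear_differentiable.
Qed.

Lemma CkV_coordE k D i j : CkV k D (fun x : E => x i j).
Proof.
case: k => [|k] /=; first by move=> x _; exact: coord_continuous.
split=> [x _|v]; first exact: differentiable_coord.
rewrite (_ : 'D_v _ = fun=> v i j); first exact: CkV_cst.
apply/funext => x; have := @derive_mx R _ _ _ id x v.
move=> H; have /matrixP/(_ i j) := H (@derivable_id _ _ x v); rewrite mxE => <-.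
by rewrite derive_id.
Qed.

Section Scalar.
Implicit Types (f g : E -> R) (D O : set E).

Lemma CkV_M k D f g : open D -> CkV k D f -> CkV k D g ->
  CkV k D (fun x => f x * g x).
Proof.
move=> oD; elim: k f g => [|k IH] f g.
  by move=> /= cf cg x Dx; apply: continuousM; [exact: cf|exact: cg].
move=> Cf Cg; have /CkV_succ[df cf] := Cf; have /CkV_succ[dg cg] := Cg.
split=> [x Dx|v].
  by apply: differentiableM; [exact: df|exact: dg].
apply: (@CkV_eq _ _ _ (fun x => f x * 'D_v g x + g x * 'D_v f x)) => //.
  move=> x; rewrite inE => Dx; rewrite deriveM//.
    exact/diff_derivable/df.
  exact/diff_derivable/dg.
by apply: CkV_D => //; apply: IH => //; exact: CkV_pred.
Qed.

Lemma CkV_V k D f : open D -> (forall x, D x -> f x != 0) -> CkV k D f ->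
  CkV k D (fun x => (f x)^-1).
Proof.
move=> oD f0; elim: k => [|k IH].
  by move=> /= cf x Dx; apply: continuousV; [exact: f0|exact: cf].
move=> Cf; have /CkV_succ[df cf] := Cf; have CV := IH (CkV_pred Cf).
split=> [x Dx|v].
  by apply: differentiableV; [exact: df|exact: f0].
apply: (@CkV_eq _ _ _ (fun x => - ((f x)^-1 * (f x)^-1 * 'D_v f x))) => //.
  move=> x; rewrite inE => Dx; rewrite deriveV//; last exact/diff_derivable/df.
    by rewrite /GRing.scale /= expr2 mulNr invfM.
  exact: f0.
by apply: CkV_N => //; do 2?[apply: CkV_M => //].
Qed.

End Scalar.

End CkV.

Section Smooth.
Context {R : realType} {m : nat}.
Local Notation E := 'rV[R]_m.
Implicit Types (D O : set E).

Lemma CkV_sqrt k D (f : E -> R) : open D -> (forall x, D x -> 0 < f x) ->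
  CkV k D f -> CkV k D (fun x => Num.sqrt (f x)).
Proof.
move=> oD f0; elim: k => [|k IH].
  move=> /= cf x Dx; apply: (@continuous_comp _ _ _ f Num.sqrt).
    exact: cf.
  exact: sqrt_continuous.
move=> Cf; have /CkV_succ[df cf] := Cf; have CV := IH (CkV_pred Cf).
have ds x : D x -> differentiable (@Num.sqrt R) (f x).
  move=> Dx; apply/derivable1_diffP.
  by have [] := is_derive1_sqrt (f0 x Dx).
apply/CkV_succ; split=> [x Dx|v].
  by apply: differentiable_comp; [exact: df|exact: ds].
apply: (@CkV_eq _ _ _ _ _ (fun x => 2^-1 * ((Num.sqrt (f x))^-1 * 'D_v f x))) => //.
  move=> x; rewrite inE => Dx.
  rewrite [RHS]deriveE; last by apply: differentiable_comp; [exact: df|exact: ds].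
  rewrite diff_comp//=; [|exact: df|exact: ds].
  rewrite -!deriveE; [|exact: df|exact: ds].
  rewrite (_ : 'D_v f x = 'D_v f x *: 1); last by rewrite /GRing.scale /= mulr1.
  rewrite [in RHS]deriveE; last exact: ds.
  rewrite linearZ/= -deriveE; last exact: ds.
  have [_ ->] := is_derive1_sqrt (f0 x Dx).
  rewrite /GRing.scale /= mulr1 invfM; ring.
apply: CkV_M => //; first exact: CkV_cst.
apply: CkV_M => //; apply: CkV_V => // x /f0.
by rewrite -sqrtr_gt0 => /lt0r_neq0.
Qed.

Lemma CkV_coord n k D (f : E -> 'rV[R]_n) : open D ->
  CkV k D f <-> forall j, CkV k D (fun x => f x ord0 j).
Proof.
move=> oD; split=> [cf j|cf].
  have @L : {linear 'rV[R]_n -> R}.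
    by exists (fun N : 'rV[R]_n => N ord0 j); do 2![eexists]; do ?[constructor];
     rewrite ?mxE// => ? *; rewrite ?mxE//; move=> ?; rewrite !mxE.
  apply: (@CkV_lin _ _ _ _ _ _ L) => //; exact: coord_continuous.
apply: (@CkV_eq _ _ _ _ _ (fun x => \sum_j f x ord0 j *: delta_mx ord0 j)) => //.
  by move=> x _; rewrite -row_sum_delta.
apply: CkV_sum => // j.
have @L : {linear R -> 'rV[R]_n}.
  exists (fun a : R => a *: delta_mx ord0 j); do 2![eexists]; do ?[constructor].
  - by rewrite scale0r.
  - by move=> a b; rewrite scalerDl.
  - by move=> a b; rewrite scalerA.
apply: (@CkV_lin _ _ _ _ _ _ L) => //.
exact: scalel_continuous.
Qed.

Lemma derive_comp n (V : normedModType R) (f : E -> 'rV[R]_n) (g : 'rV[R]_n -> V)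
  x v : differentiable f x -> differentiable g (f x) ->
  'D_v (g \o f) x = \sum_j ('D_v f x) ord0 j *: 'D_(delta_mx ord0 j) g (f x).
Proof.
move=> df dg; rewrite deriveE; last exact: differentiable_comp.
rewrite diff_comp//= -(deriveE v df) {1}['D_v f x]row_sum_delta linear_sum.
by apply: eq_bigr => j _; rewrite linearZ/= (deriveE _ dg).
Qed.

(** For a scalar g the derivative of g o f is the sum of the products of
    the scalars D_v f_j with the partial derivatives of g composed with f, each
    of the same form with one derivative less, which feeds the induction. *)
Lemma CkV_comp_scalar n k D (O : set 'rV[R]_n) (f : E -> 'rV[R]_n)
  (g : 'rV[R]_n -> R) : open D -> (forall x, D x -> O (f x)) ->
  CkV k D f -> CkV k O g -> CkV k D (g \o f).
Proof.
move=> oD fO; elim: k f g fO => [|k IH] f g fO.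
  move=> /= cf cg x Dx; apply: continuous_comp; first exact: cf.
  exact/cg/fO.
move=> Cf /CkV_succ[dg cg]; have /CkV_succ[df cf] := Cf.
apply/CkV_succ; split=> [x Dx|v].
  by apply: differentiable_comp; [exact: df|exact/dg/fO].
apply: (@CkV_eq _ _ _ _ _ (fun x => \sum_j ('D_v f x) ord0 j *
    ('D_(delta_mx ord0 j) g \o f) x)) => //.
  move=> x; rewrite inE => Dx; by rewrite (derive_comp _ (df x Dx) (dg _ (fO x Dx))).
apply: CkV_sum => // j; apply: CkV_M => //; last exact/IH/cg/CkV_pred.
by move: j; apply/CkV_coord.
Qed.

End Smooth.

Lemma CkV_comp (R : realType) m n p k (D : set 'rV[R]_m) (O : set 'rV[R]_n) (f : 'rV[R]_m -> 'rV[R]_n)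
  (g : 'rV[R]_n -> 'rV[R]_p) : open D -> open O -> (forall x, D x -> O (f x)) ->
  CkV k D f -> CkV k O g -> CkV k D (g \o f).
Proof.
move=> oD oO fO cf /(CkV_coord _ _ oO) cg; apply/CkV_coord => // j.
exact: (@CkV_comp_scalar R m n k D O f (fun y => g y ord0 j)) (cg j).
Qed.

(** * The inverse function theorem for injective maps *)
Section Euclid.
Context {R : realType} {n : nat}.
Implicit Types y : 'rV[R]_n.

(** Row vectors carry the sup norm, which is not differentiable; the squared
    Euclidean norm is, so distances are minimized with it. *)
Definition sqnorm y : R := \sum_i y ord0 i ^+ 2.

Lemma sqnorm_ge0 (x : 'rV[R]_n) : 0 <= sqnorm x.
Proof. by apply: sumr_ge0 => i _; exact: sqr_ge0. Qed.

Lemma sqnorm_eq0 (x : 'rV[R]_n) : sqnorm x = 0 -> x = 0.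
Proof.
move=> /psumr_eq0P h; apply/rowP => i; rewrite mxE.
by apply/eqP; rewrite -sqrf_eq0 h// => j _; exact: sqr_ge0.
Qed.

Lemma sqnorm0 : sqnorm 0 = 0.
Proof. by rewrite /sqnorm big1// => i _; rewrite mxE expr0n. Qed.

Lemma sqnormD_le (x y : 'rV[R]_n) : sqnorm (x + y) <= 2 * (sqnorm x + sqnorm y).
Proof.
rewrite mulrDr !mulr_sumr -big_split /=; apply: ler_sum => i _; rewrite mxE.
have := sqr_ge0 (x ord0 i - y ord0 i); nra.
Qed.

Lemma sqnormN (x : 'rV[R]_n) : sqnorm (- x) = sqnorm x.
Proof. by apply: eq_bigr => i _; rewrite mxE sqrrN. Qed.

Lemma CkV_sqnorm (m : nat) k (D : set 'rV[R]_m) (f : 'rV[R]_m -> 'rV[R]_n) y :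
  open D -> CkV k D f -> CkV k D (fun x => sqnorm (f x - y)).
Proof.
move=> oD cf; apply: CkV_sum => // i.
have h : CkV k D (fun x => f x ord0 i - y ord0 i).
  by apply: CkV_D => //; [by move: i; apply/CkV_coord|exact: CkV_cst].
apply: (@CkV_eq _ _ _ _ _
  (fun x => (f x ord0 i - y ord0 i) * (f x ord0 i - y ord0 i))) => //.
  by move=> x _; rewrite !mxE expr2.
exact: CkV_M.
Qed.

Lemma CkV_id k (D : set 'rV[R]_n) : CkV k D (fun x => x).
Proof. by apply: (@CkV_linE R n _ k D idfun) => x; exact: cvg_id. Qed.

Lemma sqnorm_continuous y : continuous (fun x : 'rV[R]_n => sqnorm (x - y)).
Proof. by move=> x; apply: (CkV_sqnorm y openT (CkV_id 0 setT)). Qed.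

Lemma derive_sqnorm y z v :
  'D_v (fun x => sqnorm (x - y)) z =
  \sum_i 2 * ((z ord0 i - y ord0 i) * v ord0 i).
Proof.
have dc i (u : 'rV[R]_n) : is_derive u v (fun x : 'rV[R]_n => x ord0 i - y ord0 i) (v ord0 i).
  apply: DeriveDef.
    apply: derivableB; last exact: derivable_cst.
    exact/diff_derivable/differentiable_coord.
  rewrite deriveB; [|exact/diff_derivable/differentiable_coord|exact: derivable_cst].
  rewrite derive_cst subr0.
  have H := @derive_mx R _ _ _ id u v.
  have /matrixP/(_ ord0 i) := H (@derivable_id _ _ u v); rewrite mxE => <-.
  by rewrite derive_id.
pose h i := (fun x : 'rV[R]_n => x ord0 i - y ord0 i) ^+ 2.
have dh i : is_derive z v (h i) (2 * ((z ord0 i - y ord0 i) * v ord0 i)).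
  apply: (is_derive_eq (is_deriveX 2 (dc i z))).
  by rewrite expr1 /GRing.scale /= -mulrA mulr_natl.
have -> : (fun x => sqnorm (x - y)) = \sum_(i < n) h i.
  apply/funext => x; rewrite fct_sumE; apply: eq_bigr => i _.
  by rewrite !mxE /h expr2.
rewrite (@derive_sum _ _ _ n h z v) => [|i]; last by case: (dh i).
by apply: eq_bigr => i _; case: (dh i).
Qed.

End Euclid.

Section InteriorMin.
Context {R : realType} {m : nat}.

Lemma derive_interior_min (U : set 'rV[R]_m) (h : 'rV[R]_m -> R) c v :
  open U -> U c -> (forall x, U x -> differentiable h x) ->
  (forall x, U x -> h c <= h x) -> 'd h c v = 0.
Proof.
move=> oU Uc dh hmin.
pose l := fun t : R => t *: v + c.
have dl t : differentiable l t.
  by apply: differentiableD; [exact: differentiableZl|exact: differentiable_cst].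
have [e e0 eU] : exists2 e : R, 0 < e & forall t, `|t| < e -> U (l t).
  have cl : {for 0, continuous l} by exact: differentiable_continuous.
  have l0 : l 0 = c by rewrite /l scale0r add0r.
  have : nbhs (l 0) U by rewrite l0; exact: open_nbhs_nbhs.
  move=> /cl /nbhs_ballP[e /= e0 H]; exists e => // t te; apply: H.
  by rewrite /ball /= sub0r normrN.
have eI t : t \in `]- e, e[ -> U (l t).
  by rewrite in_itv /= -ltr_norml; exact: eU.
have dhl t : t \in `]- e, e[ -> differentiable (h \o l) t.
  by move=> te; apply: differentiable_comp; [exact: dl|exact/dh/eI].
have I0 : 0 \in `]- e, e[ by rewrite in_itv /= oppr_lt0 e0.
have [_ D0] : is_derive (0 : R) (1 : R) (h \o l) 0.
  apply: (@derive1_at_min _ _ (- e) e) => //; first by lra.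
    by move=> t te; apply/derivable1_diffP/dhl.
  move=> t te /=; rewrite {1}/l scale0r add0r; exact/hmin/eI.
rewrite -D0 deriveE; last exact: dhl.
rewrite (diff_comp (dl 0) (dh _ (eI 0 I0))).
rewrite /= -(deriveE _ (dl 0)).
have -> : 'D_1 l 0 = v.
  rewrite deriveD; [|exact/diff_derivable/differentiableZl|exact: derivable_cst].
  rewrite derive_cst addr0 deriveE; last exact: differentiableZl.
  by have -> := diff_val (is_diff_def := is_diff_scalel 0 v); rewrite scale1r.
by rewrite /l scale0r add0r.
Qed.

End InteriorMin.

Section Open.
Context {R : realType} {n : nat}.

(** A value y close to f x0 is attained by the point c of a small closed
    ball around x0 that minimizes |f c - y|^2. Injectivity keeps f x0 at a
    positive distance from the image of the sphere, so that c is an interior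
    point. The derivative of the squared distance vanishes there; as the
    differential at c is surjective, it can be taken in the direction
    f c - y, which must then be 0. *)
Lemma open_image (W : set 'rV[R]_n) (f : 'rV[R]_n -> 'rV[R]_n) : open W ->
  (forall x, W x -> differentiable f x) -> {in W &, injective f} ->
  (forall x, W x -> forall w, exists v, 'd f x v = w) ->
  open (f @` W).
Proof.
move=> oW df finj fsurj; rewrite openE => _ [x0 Wx0 <-].
have Cf : CkV 0 W f by move=> x /df; exact: differentiable_continuous.
have /nbhs_closedballP[r rW] : nbhs x0 W by exact: open_nbhs_nbhs.
have r0 : 0 < r%:num by [].
move: (r%:num) r0 rW => {}r r0; rewrite closed_ballE// => rW.
pose K := closed_ball_ (@Num.norm R _) x0 r.
have cK : compact (K).
  rewrite /K -closed_ballE//; apply: bounded_closed_compact.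
    rewrite closed_ballE//; exists (`|x0| + r); split=> [|M rM x /= Kx].
      exact: num_real.
    rewrite (le_trans _ (ltW rM))// -[x in leLHS](subKr x0).
    by rewrite (le_trans (ler_normB _ _))// lerD2l.
  exact: closed_ball_closed.
have cN y : {within K, continuous (fun x => sqnorm (f x - y))}.
  apply: (@continuous_in_subspaceT _ _ _ _) => x; rewrite inE => /rW Wx.
  exact: (CkV_sqnorm y oW Cf).
pose S := [set x | `|x0 - x| = r].
have SK : S `<=` K by move=> x xr; rewrite /K /closed_ball_ /= xr.
have cS : compact S.
  apply: (subclosed_compact _ cK) => //.
  rewrite (_ : S = (fun x => `|x0 - x|) @^-1` [set r])//.
  apply: closed_comp; last exact: closed_eq.
  move=> x _; apply: continuous_comp; last exact: norm_continuous.
  by apply: continuousB; [exact: cst_continuous|exact: cvg_id].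
(* f x0 is at positive squared distance d from the image of the sphere S. *)
have [d d0 dS] : exists2 d : R, 0 < d &
    forall x, S x -> d <= sqnorm (f x - f x0).
  have [S0|/set0P S0] := eqVneq S set0; first by exists 1 => // x; rewrite S0.
  have [c + cmin] := @EVT_min_rV R n _ S S0 cS
    (continuous_subspaceW SK (cN (f x0))).
  rewrite inE => Sc; exists (sqnorm (f c - f x0)) => [|x Sx]; last first.
    by apply: cmin; rewrite inE.
  rewrite lt_neqAle sqnorm_ge0 andbT eq_sym; apply/eqP => /sqnorm_eq0/subr0_eq.
  move=> /finj; rewrite !inE => /(_ (rW _ (SK _ Sc)) Wx0) cx0.
  by move: Sc; rewrite /S /= cx0 subrr normr0 => r00; rewrite -r00 ltxx in r0.
(* If |y - f x0|^2 < d / 4, a point s of S has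
   |f s - y|^2 >= d / 2 - |y - f x0|^2 > |f x0 - y|^2, so the minimum is not
   reached on S. *)
have nd : nbhs (f x0) [set y | sqnorm (y - f x0) < d / 4].
  have := @sqnorm_continuous R n (f x0) (f x0).
  have : nbhs (sqnorm (f x0 - f x0)) [set t : R | t < d / 4].
    rewrite subrr sqnorm0; apply: open_nbhs_nbhs; split; first exact: open_lt.
    by rewrite /= divr_gt0.
  by move=> h /(_ _ h).
apply: filterS nd => y /= yd.
have Kx0 : K x0.
  by rewrite /K /closed_ball_ /= subrr normr0 ltW.
have [c + cmin] := @EVT_min_rV R n _ _ (ex_intro _ x0 Kx0) cK (cN y).
rewrite inE /K /closed_ball_ /= => cK'.
have x0K : x0 \in K.
  by rewrite inE.
have clt : `|x0 - c| < r.
  rewrite lt_neqAle cK' andbT; apply/eqP => /dS.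
  have := cmin _ x0K; have -> : f c - f x0 = (f c - y) + (y - f x0).
    by rewrite addrA subrK.
  have := sqnormD_le (f c - y) (y - f x0).
  have -> : sqnorm (f x0 - y) = sqnorm (y - f x0) by rewrite -sqnormN opprB.
  lra.
exists c; first exact: rW.
apply/subr0_eq/sqnorm_eq0.
have Wc := rW c cK'.
have [v dv] := fsurj c Wc (f c - y).
have bW x : ball x0 r x -> W x by rewrite -ball_normE /= => /ltW /rW.
have dp z : differentiable (fun z : 'rV[R]_n => sqnorm (z - y)) z.
  have [+ _] := CkV_sqnorm y openT (@CkV_id R n 1 setT); exact.
have dh x : W x -> differentiable (fun x => sqnorm (f x - y)) x.
  by move=> Wx; apply: (@differentiable_comp _ _ _ _ f (fun z => sqnorm (z - y)));
    [exact: df|exact: dp].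
have : 'd (fun x => sqnorm (f x - y)) c v = 0.
  apply: (@derive_interior_min _ _ (ball x0 r)).
  - exact: ball_open.
  - by rewrite -ball_normE.
  - by move=> x /bW; exact: dh.
  - move=> x; rewrite -ball_normE /= => /ltW xr; apply: cmin; rewrite inE.
    exact: xr.
rewrite (@diff_comp _ _ _ _ f (fun z => sqnorm (z - y)))//; last exact: df.
rewrite /= dv -deriveE// derive_sqnorm.
move=> /eqP; rewrite -mulr_sumr mulf_eq0 pnatr_eq0 /= => /eqP <-.
by apply: eq_bigr => i _; rewrite !mxE expr2.
Qed.

End Open.

Section BigCk.
Context {R : realType} {m : nat}.

Lemma CkV_bigsum (I : Type) (r : seq I) (P : pred I) k (D : set 'rV[R]_m)
  (F : I -> 'rV[R]_m -> R) : open D -> (forall i, CkV k D (F i)) ->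
  CkV k D (fun x => \sum_(i <- r | P i) F i x).
Proof.
move=> oD cF; elim: r => [|i r IH].
  apply: (@CkV_eq _ _ _ _ _ (fun=> 0)) => //; last exact: CkV_cst.
  by move=> x _; rewrite big_nil.
case: (boolP (P i)) => Pi; last first.
  by apply: (CkV_eq oD _ IH) => x _; rewrite big_cons (negbTE Pi).
apply: (CkV_eq oD _ (CkV_D oD (cF i) IH)) => x _.
by rewrite big_cons Pi.
Qed.

Lemma CkV_bigprod (I : Type) (r : seq I) (P : pred I) k (D : set 'rV[R]_m)
  (F : I -> 'rV[R]_m -> R) : open D -> (forall i, CkV k D (F i)) ->
  CkV k D (fun x => \prod_(i <- r | P i) F i x).
Proof.
move=> oD cF; elim: r => [|i r IH].
  apply: (@CkV_eq _ _ _ _ _ (fun=> 1 : R)) => //; last exact: CkV_cst.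
  by move=> x _; rewrite big_nil.
case: (boolP (P i)) => Pi; last first.
  by apply: (CkV_eq oD _ IH) => x _; rewrite big_cons (negbTE Pi).
apply: (CkV_eq oD _ (CkV_M oD (cF i) IH)) => x _.
by rewrite big_cons Pi.
Qed.

Lemma CkV_det n k (D : set 'rV[R]_m) (M : 'rV[R]_m -> 'M[R]_n) : open D ->
  (forall i j, CkV k D (fun x => M x i j)) -> CkV k D (fun x => \det (M x)).
Proof.
move=> oD cM; apply: CkV_bigsum => // s; apply: CkV_M => //.
  exact: CkV_cst.
by apply: CkV_bigprod => // i; exact: cM.
Qed.

(** By Cramer's rule. *)
Lemma CkV_invmx n k (D : set 'rV[R]_m) (M : 'rV[R]_m -> 'M[R]_n) : open D ->
  (forall x, D x -> M x \in unitmx) ->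
  (forall i j, CkV k D (fun x => M x i j)) ->
  forall i j, CkV k D (fun x => invmx (M x) i j).
Proof.
move=> oD uM cM i j.
apply: (@CkV_eq _ _ _ _ _ (fun x => (\det (M x))^-1 * cofactor (M x) j i)) => //.
  move=> x; rewrite inE => Dx.
  by rewrite /invmx (uM x Dx) !mxE.
apply: CkV_M => //.
  apply: CkV_V => //; last exact: CkV_det.
  by move=> x /uM; rewrite unitmxE unitfE.
apply: CkV_M => //; first exact: CkV_cst.
apply: CkV_det => // a b.
by apply: (CkV_eq oD _ (cM (lift j a) (lift i b))) => x _; rewrite !mxE.
Qed.

End BigCk.

Section DiffEps.
Context {R : realType} {V V' : normedModType R}.

Lemma is_diff_eps (f : V -> V') (L : {linear V -> V'}) x : continuous L ->
  (forall e, 0 < e ->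
    \forall h \near 0, `|f (h + x) - f x - L h| <= e * `|h|) ->
  is_diff x f L.
Proof.
move=> cL H; have E : f \o shift x = cst (f x) + L +o_ 0 id.
  apply/eqaddoP => e /H; apply: filterS => h.
  by rewrite !fctE /= opprD addrA.
split; last exact: diff_unique.
by apply/diff_locallyP; rewrite (diff_unique cL E).
Qed.

Lemma diff_eps (f : V -> V') x : differentiable f x -> forall e, 0 < e ->
  \forall h \near 0, `|f (h + x) - f x - 'd f x h| <= e * `|h|.
Proof.
move=> /diff_locally/eqaddoP H e /H; apply: filterS => h.
by rewrite !fctE /= opprD addrA.
Qed.

End DiffEps.

Section Inverse.
Context {R : realType} {n : nat}.
Variables (W : set 'rV[R]_n) (f g : 'rV[R]_n -> 'rV[R]_n).
Hypotheses (oW : open W) (df : forall x, W x -> differentiable f x)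
  (fsurj : forall x, W x -> forall w, exists v, 'd f x v = w)
  (gf : forall x, W x -> g (f x) = x).

Let finj : {in W &, injective f}.
Proof. by move=> x y; rewrite !inE => /gf {2}<- /gf {2}<- ->. Qed.

Let oV : open (f @` W). Proof. exact: open_image. Qed.

(** The restriction of f to any smaller open set is an open map too. *)
Lemma inverse_continuous x : W x -> {for f x, continuous g}.
Proof.
move=> Wx; rewrite /prop_for /continuous_at gf// => U /nbhs_interior Ux.
have oWU : open (W `&` U°) by apply: openI => //; exact: open_interior.
have o1 : open (f @` (W `&` U°)).
  apply: open_image => //.
  - by move=> z [/df].
  - by apply: sub_in2 finj => z; rewrite !inE => -[].
  - by move=> z [/fsurj].
have n1 : nbhs (f x) (f @` (W `&` U°)).
  apply: open_nbhs_nbhs; split => //; exists x => //; split => //.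
  exact: nbhs_singleton.
apply: filterS n1 => _ [z [Wz Uz] <-]; rewrite /= gf//.
exact: interior_subset.
Qed.

Lemma jacobian_unit x : W x -> jacobian f x \in unitmx.
Proof.
move=> Wx; rewrite -row_full_unit; apply/row_fullP.
pose v i := sval (cid (fsurj Wx (row i 1%:M))).
exists (\matrix_i v i); apply/row_matrixP => i.
rewrite row_mul rowK -deriveEjacobian; last exact: df.
rewrite deriveE; last exact: df.
exact: (svalP (cid (fsurj Wx (row i 1%:M)))).
Qed.

Lemma mulmxr_continuous p (A : 'M[R]_(n, p)) :
  continuous (mulmxr A : 'rV[R]_n -> 'rV[R]_p).
Proof.
move=> x; apply: (iffRL (@CkV_coord _ _ p 0 setT _ openT)) => // j.
apply: (@CkV_eq _ _ _ _ _ (fun x : 'rV[R]_n => \sum_k x ord0 k * A k j)).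
- exact: openT.
- by move=> z _; rewrite /= mxE.
apply: CkV_bigsum; first exact: openT.
move=> k; apply: CkV_M; [exact: openT|exact: CkV_coordE|exact: CkV_cst].
Qed.

Lemma inverse_differentiable x : W x ->
  is_diff (f x) g (mulmxr (invmx (jacobian f x))).
Proof.
move=> Wx; set A := invmx _; pose L : {linear 'rV[R]_n -> 'rV[R]_n} := mulmxr A.
have cL : continuous L by exact: mulmxr_continuous.
apply: (@is_diff_eps _ _ _ g L) => // e e0.
have [C C0 LC] := linear_lipschitz cL.
(* With k = z - x and h = f z - f x, a remainder e1 |k| for f gives
   |L h - k| <= C e1 |k|. The bound e1 <= 1 / (2 C) yields |k| <= 2 C |h|, and
   then e1 <= e / (2 C^2) turns the error into e |h|. *)
pose e1 := Num.min (e / (2 * C ^+ 2)) ((2 * C)^-1).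
have e10 : 0 < e1 by rewrite lt_min !divr_gt0 ?invr_gt0 ?mulr_gt0 ?exprn_gt0.
have Hf := diff_eps (df Wx) e10.
have cg := inverse_continuous Wx.
have nV : nbhs (f x) (f @` W) by apply: open_nbhs_nbhs; split => //; exists x.
have nV0 : \forall h \near (0 : 'rV[R]_n), (f @` W) (h + f x).
  have : \forall y \near f x, (f @` W) y by [].
  by rewrite (near_shift 0) subr0.
have cg0 : (fun h => g (h + f x) - x) @ (0 : 'rV[R]_n) --> (0 : 'rV[R]_n).
  have : {for (0 : 'rV[R]_n), continuous (fun h : 'rV[R]_n => g (h + f x) - x)}.
    apply: continuousB; last exact: cst_continuous.
    apply: (@continuous_comp _ _ _ (fun h : 'rV[R]_n => h + f x) g).
      by apply: continuousD; [exact: cvg_id|exact: cst_continuous].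
    by rewrite /= add0r.
  by rewrite /prop_for /continuous_at add0r gf// subrr.
have Hf' := cg0 _ Hf.
apply: filterS2 nV0 Hf' => h [z Wz zh] /=.
rewrite -zh !gf// subrK zh addrK => H.
set k := z - x in H *.
have LJ : L ('d f x k) = k.
  rewrite -deriveE; last exact: df.
  rewrite deriveEjacobian; last exact: df.
  by rewrite /L /= -mulmxA mulmxV ?mulmx1//; exact: jacobian_unit.
have H1 : `|L h - k| <= C * (e1 * `|k|).
  rewrite -{1}LJ -linearB (le_trans (LC _))// ler_pM2l//.
have H2 : C * (e1 * `|k|) <= `|k| / 2.
  rewrite mulrA (_ : _ / 2 = 2^-1 * `|k|); last by rewrite mulrC.
  rewrite ler_wpM2r// -ler_pdivlMl// (_ : C^-1 / 2 = (2 * C)^-1).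
    by rewrite ge_min lexx orbT.
  by rewrite invfM mulrC.
have H3 : `|k| <= 2 * `|L h|.
  have := ler_normB (L h) (L h - k); rewrite subKr; lra.
have H4 : `|k| <= 2 * C * `|h|.
  by rewrite (le_trans H3)// -mulrA ler_pM2l.
rewrite distrC (le_trans H1)// .
have H5 : e1 <= e / (2 * C ^+ 2) by rewrite ge_min lexx.
apply: (@le_trans _ _ (C * (e / (2 * C ^+ 2) * (2 * C * `|h|)))).
  by rewrite ler_pM2l// ler_pM// ltW.
rewrite le_eqVlt; apply/orP; left; apply/eqP; field.
exact: lt0r_neq0.
Qed.

(** D_v g = v J^-1 o g, where J is the Jacobian matrix of f; the right-hand
    side is as regular as g, which gains one derivative at a time. *)
Lemma inverse_CkV : (forall k, CkV k W f) -> forall k, CkV k (f @` W) g.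
Proof.
move=> Cf; elim=> [|k IH]; first by move=> _ [x Wx <-]; exact: inverse_continuous.
apply/CkV_succ; split.
  by move=> _ [x Wx <-]; case: (inverse_differentiable Wx).
move=> v.
apply: (@CkV_eq _ _ _ _ _ (fun y => v *m invmx (jacobian f (g y)))) => //.
  move=> y; rewrite inE => -[x Wx <-]; have [dg Dg] := inverse_differentiable Wx.
  by rewrite deriveE// Dg gf.
apply/CkV_coord => // j.
apply: (@CkV_eq _ _ _ _ _
  (fun y => \sum_i v ord0 i * invmx (jacobian f (g y)) i j)) => //.
  by move=> y _; rewrite mxE.
apply: CkV_bigsum => // i; apply: CkV_M => //; first exact: CkV_cst.
move: i j; apply: CkV_invmx => //.
  by move=> _ [x Wx <-]; rewrite gf//; exact: jacobian_unit.
move=> i j.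
have fW y : (f @` W) y -> W (g y) by move=> [x Wx <-]; rewrite gf.
have /CkV_succ[_ /(_ 'e_i)] := Cf k.+1; move=> /CkV_coord => /(_ oW j) ci.
apply: (CkV_eq oV _ (CkV_comp_scalar oV fW IH ci)) => y.
rewrite inE => /fW Wy /=; rewrite deriveEjacobian; last exact: df.
by rewrite -rowE mxE.
Qed.

End Inverse.

Lemma inverse_Cinfty (R : realType) n (W : set 'rV[R]_n)
  (f g : 'rV[R]_n -> 'rV[R]_n) : open W -> Cinfty W f ->
  (forall x, W x -> forall w, exists v, 'd f x v = w) ->
  (forall x, W x -> g (f x) = x) -> open (f @` W) /\ Cinfty (f @` W) g.
Proof.
move=> oW Cf fsurj gf.
have CSf k : CkV k W f by exact/Ck_CkV/Cf.
have df x : W x -> differentiable f x by have [+ _] := CSf 1; exact.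
split; last by move=> k; apply/Ck_CkV; exact: inverse_CkV.
by apply: open_image => // x y; rewrite !inE => /gf {2}<- /gf {2}<- ->.
Qed.

(** * Embedded atlases *)
Section CinftyTheory.
Context {R : realType}.

Lemma open_preimage_on m (V : topologicalType) (D : set 'rV[R]_m)
  (f : 'rV[R]_m -> V) (Y : set V) : open D ->
  (forall x, D x -> {for x, continuous f}) -> open Y -> open (D `&` f @^-1` Y).
Proof.
move=> oD cf oY; rewrite openE => x [Dx Ox].
apply: filterI; first exact: open_nbhs_nbhs.
by apply: (cf x Dx); exact: open_nbhs_nbhs.
Qed.

Lemma Cinfty_continuous m n (D : set 'rV[R]_m) (f : 'rV[R]_m -> 'rV[R]_n) :
  Cinfty D f -> forall x, D x -> {for x, continuous f}.
Proof. by move=> /(_ 0). Qed.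

Lemma Cinfty_differentiable m n (D : set 'rV[R]_m) (f : 'rV[R]_m -> 'rV[R]_n) :
  Cinfty D f -> forall x, D x -> differentiable f x.
Proof. by move=> /(_ 1) []. Qed.

Lemma Cinfty_sub m n (D Y : set 'rV[R]_m) (f : 'rV[R]_m -> 'rV[R]_n) :
  D `<=` Y -> Cinfty Y f -> Cinfty D f.
Proof. by move=> DO Cf k; apply/Ck_CkV/(CkV_sub DO)/Ck_CkV/Cf. Qed.

Lemma Cinfty_eq m n (D : set 'rV[R]_m) (f g : 'rV[R]_m -> 'rV[R]_n) :
  open D -> {in D, f =1 g} -> Cinfty D f -> Cinfty D g.
Proof. by move=> oD fg Cf k; apply/Ck_CkV/(CkV_eq oD fg)/Ck_CkV/Cf. Qed.

Lemma Cinfty_local m n (D : set 'rV[R]_m) (f : 'rV[R]_m -> 'rV[R]_n) :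
  (forall x, D x -> exists U, U x /\ Cinfty U f) -> Cinfty D f.
Proof.
move=> H k; apply/Ck_CkV/CkV_local => x /H[U [Ux Cf]].
by exists U; split=> //; apply/Ck_CkV/Cf.
Qed.

Lemma Cinfty_comp m n p (D : set 'rV[R]_m) (Y : set 'rV[R]_n)
  (f : 'rV[R]_m -> 'rV[R]_n) (g : 'rV[R]_n -> 'rV[R]_p) :
  open D -> open Y -> (forall x, D x -> Y (f x)) ->
  Cinfty D f -> Cinfty Y g -> Cinfty D (g \o f).
Proof.
move=> oD oY fO Cf Cg k; apply/Ck_CkV.
by apply: (CkV_comp oD oY fO); apply/Ck_CkV; [exact: Cf|exact: Cg].
Qed.

Lemma Cinfty_id m (D : set 'rV[R]_m) : Cinfty D id.
Proof. by move=> k; apply/Ck_CkV/CkV_id. Qed.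

Lemma CkV_row_mx m n p k (D : set 'rV[R]_m) (f : 'rV[R]_m -> 'rV[R]_n)
  (g : 'rV[R]_m -> 'rV[R]_p) : open D -> CkV k D f -> CkV k D g ->
  CkV k D (fun x => row_mx (f x) (g x)).
Proof.
move=> oD /(CkV_coord _ _ oD) cf /(CkV_coord _ _ oD) cg; apply/CkV_coord => // j.
case: (split_ordP j) => i ->.
  by apply: (CkV_eq oD _ (cf i)) => x _; rewrite row_mxEl.
by apply: (CkV_eq oD _ (cg i)) => x _; rewrite row_mxEr.
Qed.

Lemma CkV_lsubmx m n k (D : set 'rV[R]_(m + n)) :
  CkV k D (lsubmx : 'rV[R]_(m + n) -> 'rV[R]_m).
Proof. apply: (@CkV_linE _ _ _ k D lsubmx); exact: continuous_lsubmx. Qed.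

Lemma CkV_rsubmx m n k (D : set 'rV[R]_(m + n)) :
  CkV k D (rsubmx : 'rV[R]_(m + n) -> 'rV[R]_n).
Proof. apply: (@CkV_linE _ _ _ k D rsubmx); exact: continuous_rsubmx. Qed.

Lemma Cinfty_row_mx m n p (D : set 'rV[R]_m) (f : 'rV[R]_m -> 'rV[R]_n)
  (g : 'rV[R]_m -> 'rV[R]_p) : open D -> Cinfty D f -> Cinfty D g ->
  Cinfty D (fun x => row_mx (f x) (g x)).
Proof.
by move=> oD Cf Cg k; apply/Ck_CkV/CkV_row_mx => //; apply/Ck_CkV; [exact: Cf|exact: Cg].
Qed.

Lemma Cinfty_lsubmx m n (D : set 'rV[R]_(m + n)) :
  Cinfty D (lsubmx : 'rV[R]_(m + n) -> 'rV[R]_m).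
Proof. by move=> k; apply/Ck_CkV/CkV_lsubmx. Qed.

Lemma Cinfty_rsubmx m n (D : set 'rV[R]_(m + n)) :
  Cinfty D (rsubmx : 'rV[R]_(m + n) -> 'rV[R]_n).
Proof. by move=> k; apply/Ck_CkV/CkV_rsubmx. Qed.

End CinftyTheory.

Lemma countable_image (S T : Type) (f : S -> T) (D : set S) :
  countable D -> countable (f @` D).
Proof. exact/card_le_trans/card_image_le. Qed.

Section RationalBalls.
Context {R : realType} (n : nat).

Definition rational_ball (p : 'rV[rat]_n * nat) : set 'rV[R]_n :=
  ball (map_mx ratr p.1 : 'rV[R]_n) (p.2.+1%:R^-1).

Lemma rV_second_countable : @second_countable 'rV[R]_n.
Proof.
exists (range rational_ball).
  exact: countable_image (countableP _).
split=> [_ [p _ <-]|x U]; first exact: ball_open.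
move=> /nbhs_ballP[e /= e0 xU].
have [k _ ke] := near_infty_natSinv_lt (PosNum (divr_gt0 e0 (@ltr0n R 2 : 0 < 2))).
have k0 : 0 < k.+1%:R^-1 :> R by rewrite invr_gt0.
have qx i : exists q : rat, ratr q \in `](x ord0 i - k.+1%:R^-1), (x ord0 i + k.+1%:R^-1)[.
  by apply: rat_in_itvoo; rewrite ltrD2l gtrN.
pose q := \row_i sval (cid (qx i)).
have bq : ball (map_mx ratr q : 'rV[R]_n) (k.+1%:R^-1) x.
  split=> // i j; have -> : i = ord0 by exact: ord1.
  rewrite !mxE.
  have := svalP (cid (qx j)); rewrite in_itv /= => /andP[h1 h2].
  by rewrite -ball_normE /= ltr_distl h1 h2.
exists (rational_ball (q, k)); first by split; [exists (q, k)|].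
move=> y qy; apply: xU.
have : ball x (k.+1%:R^-1 + k.+1%:R^-1) y by apply: ball_triangle qy; exact: ball_sym.
by apply: le_ball; rewrite [leRHS]splitr lerD// ltW//; exact: ke (leqnn k).
Qed.

End RationalBalls.

Section MfdTopology.
Context {R : realType} {n : nat} {T : choiceType} (A : atlas R n T).

Lemma chart_open_open V : chart_open A V -> @open (mfd A) V.
Proof.
move=> AV; exists [set V]; last first.
  by rewrite predeqE => x; split=> [[_ -> //]|Vx]; exists V.
move=> _ ->; exists (finmap.fset1 V).
  by move=> W /finmap.fset1P ->; rewrite inE.
by rewrite predeqE => x; split=> [|Vx W /finmap.fset1P ->//]; apply; exact/finmap.fset1P.
Qed.

(** The sets of [chart_open] only form a subbase, but a filter contains the
    finite intersections of its members. *)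
Lemma mfd_cvg (F : set_system T) (t : T) : Filter F ->
  (forall V, chart_open A V -> V t -> F V) -> F --> (t : mfd A).
Proof.
move=> FF H U /=; rewrite (@nbhsE (mfd A)).
move=> [_ [[B sB <-] [C BC Ct] sUBA]].
rewrite nbhs_filterE; apply: filterS sUBA _; apply: (@filterS _ _ _ C).
  by move=> ? ?; exists C.
have /sB [D sD IDeC] := BC; rewrite -IDeC; apply: filter_bigI => E DE.
have /sD/set_mem AE := DE; apply: (H _ AE).
by move: Ct; rewrite -IDeC => /(_ _ DE).
Qed.

End MfdTopology.

Section ExtSmooth.
Context {R : realType} {N : nat}.

(** For an injective e, smoothness of h o e^-1 on the subset e(S) of R^N by
    local extension to open sets of R^N. *)
Definition ext_smooth p (T : Type) (e : T -> 'rV[R]_N) (S : set T)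
    (h : T -> 'rV[R]_p) : Prop :=
  forall x, S x -> exists Y (F : 'rV[R]_N -> 'rV[R]_p),
    [/\ open Y, Y (e x), Cinfty Y F & forall y, S y -> Y (e y) -> F (e y) = h y].

Definition ext_open (T : Type) (e : T -> 'rV[R]_N) (S : set T) : Prop :=
  exists2 Y, open Y & S = e @^-1` Y.

Lemma ext_open_local (T : Type) (e : T -> 'rV[R]_N) (S : set T) :
  (forall x, S x -> exists Y, [/\ open Y, Y (e x) & e @^-1` Y `<=` S]) ->
  ext_open e S.
Proof.
move=> H.
exists (\bigcup_(Y in [set Y | open Y /\ e @^-1` Y `<=` S]) Y).
  by apply: bigcup_open => Y [].
apply/seteqP; split=> [x /H[Y [oY Ox OS]]|x [Y [_ OS] Ox]]; last exact: OS.
by exists Y.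
Qed.

Lemma ext_openI (T : Type) (e : T -> 'rV[R]_N) (S S' : set T) :
  ext_open e S -> ext_open e S' -> ext_open e (S `&` S').
Proof.
by move=> [Y oY ->] [Y' oY' ->]; exists (Y `&` Y'); [exact: openI|].
Qed.

Lemma ext_openT (T : Type) (e : T -> 'rV[R]_N) : ext_open e setT.
Proof. by exists setT; [exact: openT|]. Qed.

Lemma ext_smooth_open p (T : Type) (e : T -> 'rV[R]_N) (S : set T)
    (h : T -> 'rV[R]_p) (Y : set 'rV[R]_p) :
  ext_smooth e S h -> ext_open e S -> open Y -> ext_open e (S `&` h @^-1` Y).
Proof.
move=> sh [Q oQ SE] oY; apply: ext_open_local => x [Sx Ox].
have [P [F [oP Px CF FE]]] := sh x Sx.
exists (Q `&` (P `&` F @^-1` Y)); split.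
- exact: (openI oQ (open_preimage_on oP (Cinfty_continuous CF) oY)).
- by split; [move: Sx; rewrite SE|split=> //=; rewrite FE].
- move=> y [Qy [Py Fy]]; have Sy : S y by rewrite SE.
  by split=> //; move: Fy; rewrite /= (FE y Sy Py).
Qed.

Lemma ext_smooth_eq p (T : Type) (e : T -> 'rV[R]_N) (S : set T)
    (h h' : T -> 'rV[R]_p) : {in S, h =1 h'} ->
    ext_smooth e S h -> ext_smooth e S h'.
Proof.
move=> hh sh x /sh[Y [F [oY Ox CF FE]]]; exists Y, F; split=> // y Sy Oy.
by rewrite FE// hh// inE.
Qed.

Lemma ext_smooth_id (T : Type) (e : T -> 'rV[R]_N) (S : set T) : ext_smooth e S e.
Proof.
by move=> x Sx; exists setT, id; split=> //; [exact: openT|exact: Cinfty_id].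
Qed.

Lemma ext_smooth_row p q (T : Type) (e : T -> 'rV[R]_N) (S : set T)
  (f : T -> 'rV[R]_p) (g : T -> 'rV[R]_q) :
  ext_smooth e S f -> ext_smooth e S g ->
  ext_smooth e S (fun x => row_mx (f x) (g x)).
Proof.
move=> sf sg x Sx; have [P [F [oP Px CF FE]]] := sf x Sx.
have [Q [G [oQ Qx CG GE]]] := sg x Sx.
exists (P `&` Q), (fun v => row_mx (F v) (G v)); split.
- exact: openI.
- by [].
- apply: Cinfty_row_mx; [exact: openI| |].
    by apply: Cinfty_sub CF => v [].
  by apply: Cinfty_sub CG => v [].
- by move=> y Sy [Py Qy]; rewrite FE// GE.
Qed.

End ExtSmooth.

Section ExtSmoothMap.
Context {R : realType} {N N' : nat} (T U : Type).
Variables (e : T -> 'rV[R]_N) (e' : U -> 'rV[R]_N') (f : T -> U).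
Hypothesis sf : ext_smooth e setT (e' \o f).

Lemma ext_smooth_preimage (S : set U) : ext_open e' S -> ext_open e (f @^-1` S).
Proof.
move=> [Y oY ->]; have := ext_smooth_open sf (ext_openT e) oY.
by rewrite setTI.
Qed.

Lemma ext_smooth_pullback p (S : set U) (h : U -> 'rV[R]_p) :
  ext_smooth e' S h -> ext_smooth e (f @^-1` S) (h \o f).
Proof.
move=> sh x Sx; have [P [F [oP Px CF FE]]] := sf (I : setT x).
have [Y [G [oY Ox CG GE]]] := sh (f x) Sx.
have oPF : open (P `&` F @^-1` Y).
  exact: (open_preimage_on oP (Cinfty_continuous CF) oY).
exists (P `&` F @^-1` Y), (G \o F); split => //.
- by split=> //=; rewrite FE.
- apply: (Cinfty_comp oPF oY) CG; first by move=> y [].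
  by apply: Cinfty_sub CF => y [].
- by move=> y Sy [Py Fy]; move: Fy; rewrite /= FE// => Oy; rewrite GE.
Qed.

End ExtSmoothMap.

Section Embedded.
Context {R : realType} {N n : nat} {T : choiceType}.
Variables (A : atlas R n T) (e : T -> 'rV[R]_N).

(** The product of two submanifold atlases is not a whole submanifold atlas,
    so A is only required to be contained in one. Covering T, it still defines
    the same topology and the same smooth maps. *)
Definition embedded : Prop :=
  [/\ injective e, A `<=` submanifold_atlas e
    & forall x, exists2 c, A c & cdom c x].

(** In a submanifold chart c, the map h is its local extension composed with
    the smooth parametrization e o c^-1. *)
Lemma chart_ext_smooth (c : chart R n T) p (S : set T) (h : T -> 'rV[R]_p) :
  submanifold_atlas e c -> ext_open e S -> ext_smooth e S h ->
  open (cto c @` (cdom c `&` S)) /\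
  Cinfty (cto c @` (cdom c `&` S)) (h \o cfrom c).
Proof.
move=> [[oc cK] _ Cc _] [Q oQ SE] sh.
have E (P : set 'rV[R]_N) : cto c @` (cdom c `&` e @^-1` P) =
    (cto c @` cdom c) `&` (e \o cfrom c) @^-1` P.
  apply/seteqP; split=> [_ [x [dx Px] <-]|_ [[x dx <-]]] /=.
    by split; [exists x|rewrite /= cK].
  by rewrite /= cK// => Px; exists x.
have oP (P : set 'rV[R]_N) : open P -> open (cto c @` (cdom c `&` e @^-1` P)).
  move=> oP; rewrite E; exact: (open_preimage_on oc (Cinfty_continuous Cc) oP).
split; first by rewrite SE; exact: oP.
apply: Cinfty_local => _ [x [dx Sx] <-].
have [Y [F [oY Ox CF FE]]] := sh x Sx.
have oQO : open (Q `&` Y) by exact: openI.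
exists (cto c @` (cdom c `&` e @^-1` (Q `&` Y))); split.
  by exists x => //; split=> //; split=> //; move: Sx; rewrite SE.
apply: (@Cinfty_eq _ _ _ _ (F \o (e \o cfrom c))).
- exact: oP.
- move=> _ /[1!inE] -[y [dy [Qy Oy]] <-] /=; rewrite cK// FE//.
  by rewrite SE.
- apply: (Cinfty_comp (oP _ oQO) oY) CF.
    by move=> _ [y [dy [Qy Oy]] <-] /=; rewrite cK.
  by apply: Cinfty_sub Cc => _ [y [dy _] <-]; exists y.
Qed.

Hypothesis eA : embedded.

(** The manifold topology is the one induced by e: charts extend locally to
    continuous maps of the ambient space, and conversely e is continuous in
    every chart. *)
Lemma embedded_open V : @open (mfd A) V <-> ext_open e V.
Proof.
have [einj As Ac] := eA; split.
  suff ci : continuous (id : initial_topology e -> mfd A).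
    move=> oV; have /continuousP/(_ V oV) := ci.
    by move=> [Y oY OE]; exists Y; rewrite // -OE.
  move=> x; apply: (@mfd_cvg _ _ _ A (@nbhs _ (initial_topology e) x)) => _ [c [W [Ac' oW ->]]] [dx Wx].
  have [[_ cK] [Y oY dE] _ cs] := As _ Ac'.
  have [Q oQ QE] : ext_open e (cdom c `&` cto c @^-1` W).
    by apply: (@ext_smooth_open _ _ _ _ _ _ _ _ cs _ oW); exists Y.
  have : @open_nbhs (initial_topology e) x (cdom c `&` cto c @^-1` W).
    by split=> //; exists Q.
  by move=> /open_nbhs_nbhs.
move=> [Y oY VE]; rewrite openE => x Vx.
have [c Ac' dx] := Ac x; have cs := As _ Ac'.
have [oW _] := chart_ext_smooth cs (ex_intro2 _ _ Y oY VE)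
  (@ext_smooth_id _ _ _ e V).
have [[_ cK] _ _ _] := cs.
pose B := cdom c `&` cto c @^-1` (cto c @` (cdom c `&` V)).
have oB : @open (mfd A) B by apply: chart_open_open; exists c, (cto c @` (cdom c `&` V)).
have : @nbhs _ (mfd A) x B by apply: open_nbhs_nbhs; split=> //; split=> //; exists x.
apply: filterS => y [dy [z [dz Vz] zy]].
by rewrite -(cK y dy) -zy cK.
Qed.

Lemma embedded_hausdorff : hausdorff_space (mfd A).
Proof.
have [einj _ _] := eA.
rewrite open_hausdorff => x y xy.
have exy : e x != e y by apply: contra xy => /eqP /einj ->.
have := @norm_hausdorff R 'rV[R]_N; rewrite open_hausdorff => /(_ _ _ exy).
move=> [[P Q] /= [Px Qy] [oP oQ PQ]]; exists (e @^-1` P, e @^-1` Q) => /=.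
  by rewrite !inE in Px Qy *.
split; [by apply/embedded_open; exists P|by apply/embedded_open; exists Q|].
by rewrite -preimage_setI (eqP PQ) preimage_set0.
Qed.

Lemma embedded_second_countable : @second_countable (mfd A).
Proof.
have [B cB [Bo Bb]] := @rV_second_countable R N.
exists [set e @^-1` V | V in B]; first exact: countable_image cB.
split=> [_ [V /Bo oV <-]|x U]; first by apply/embedded_open; exists V.
rewrite nbhsE => -[V [/embedded_open[Y oY ->] Ox] VU].
have /Bb[W [BW Wx] WO] : nbhs (e x) Y by exact: open_nbhs_nbhs.
exists (e @^-1` W); first by split=> //; exists W.
by move=> y Wy; apply/VU/WO.
Qed.

Lemma embedded_manifold : smooth_manifold A.
Proof.
have [_ As Ac] := eA.
split; [|exact: embedded_hausdorff|exact: embedded_second_countable].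
split=> // [c /As[]//|c d /As cc /As[_ dd _ sd]].
exact: chart_ext_smooth.
Qed.

End Embedded.

Section SmoothMaps.
Context {R : realType} {N n N' n' : nat} {T U : choiceType}.
Variables (A : atlas R n T) (e : T -> 'rV[R]_N).
Variables (B : atlas R n' U) (e' : U -> 'rV[R]_N').

Lemma ext_smooth_continuous (f : T -> U) : embedded A e -> embedded B e' ->
  ext_smooth e setT (e' \o f) -> continuous (f : mfd A -> mfd B).
Proof.
move=> eA eB sf; apply/continuousP => V /(embedded_open eB) oV.
exact/(embedded_open eA)/(ext_smooth_preimage sf).
Qed.

(** The working criterion for smoothness: f is smooth once it extends
    locally to the ambient spaces. *)
Lemma ext_smooth_map (f : T -> U) : embedded A e -> embedded B e' ->
  ext_smooth e setT (e' \o f) -> smooth_map A B f.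
Proof.
move=> eA eB sf; split=> [x _|c d Ac Bd].
  exact: ext_smooth_continuous.
have [_ As _] := eA; have [_ Bs _] := eB.
have [_ dd _ sd] := Bs _ Bd; rewrite setIT.
exact: (proj2 (chart_ext_smooth (As _ Ac) (ext_smooth_preimage sf dd)
  (ext_smooth_pullback sf sd))).
Qed.

Lemma smooth_atlas_open c V : smooth_atlas B -> B c -> @open (mfd B) V ->
  open (cto c @` (cdom c `&` V)).
Proof.
move=> [Bc _ BC] Ac oV; have [oc cK] := Bc c Ac.
rewrite (_ : _ @` _ = (cto c @` cdom c) `&` (cfrom c : _ -> mfd B) @^-1` V).
  apply: open_preimage_on => // _ [x dx <-].
  rewrite /prop_for /continuous_at cK//.
  apply: mfd_cvg => [|_ [d [W [Ad oW ->]]] [dx' Wx]].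
    exact: (fmap_filter (cfrom c) (nbhs_filter (cto c x))).
  have [oD CD] := BC c d Ac Ad.
  have : open_nbhs (cto c x) ((cto c @` (cdom c `&` cdom d)) `&`
      (cto d \o cfrom c) @^-1` W).
    split.
      exact: (open_preimage_on oD (Cinfty_continuous CD) oW).
    by split; [exists x|rewrite /= cK].
  move=> /open_nbhs_nbhs; apply: filterS => _ [[y [dy dy'] <-]] /=.
  by rewrite cK.
apply/seteqP; split=> [_ [x [dx Vx] <-]|_ [[x dx <-]]] /=.
  by split; [exists x|rewrite /= cK].
by rewrite cK// => Vx; exists x.
Qed.

Lemma smooth_map_open (f : T -> U) d : embedded A e -> smooth_atlas B ->
  smooth_map A B f -> B d -> ext_open e (f @^-1` cdom d).
Proof.
move=> eA sB [cf _] Bd; apply/(embedded_open eA).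
have /continuousP cF : continuous (f : mfd A -> mfd B) by move=> x; exact: cf.
apply: cF; apply: chart_open_open; exists d, setT; split=> //; first exact: openT.
by rewrite preimage_setT setIT.
Qed.

(** Converse of [ext_smooth_map], in a chart d of the target: around e x the
    extension is the expression of f in the charts c and d after a local
    extension of c. *)
Lemma smooth_map_ext (f : T -> U) d : embedded A e -> smooth_atlas B ->
  smooth_map A B f -> B d -> ext_smooth e (f @^-1` cdom d) (cto d \o f).
Proof.
move=> eA sB sf Bd x dx; have [_ As Ac] := eA; have [c Ac' cx] := Ac x.
have cs := As _ Ac'; have [[oc cK] [P oP PE] Cc sc] := cs.
have od := smooth_map_open eA sB sf Bd.
have [oV _] := chart_ext_smooth cs od (@ext_smooth_id _ _ _ e _).
have [_ /(_ c d Ac' Bd)] := sf; rewrite setIT => Cf.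
have [Q [F [oQ Qx CF FE]]] := sc x cx.
set V := cto c @` _ in oV Cf.
have oPF : open ((P `&` Q) `&` F @^-1` V).
  apply: (open_preimage_on (openI oP oQ) _ oV) => y [_ Qy].
  exact: (Cinfty_continuous CF).
exists ((P `&` Q) `&` F @^-1` V), ((cto d \o f \o cfrom c) \o F); split => //.
- have Px : P (e x) by move: cx; rewrite PE.
  by split=> //=; rewrite FE//; exists x.
- apply: (Cinfty_comp oPF oV) Cf; first by move=> y [].
  by apply: Cinfty_sub CF => y [[]].
- move=> y dy [[Py Qy] _]; have cy : cdom c y by rewrite PE.
  by rewrite /= FE// cK.
Qed.

Lemma smooth_map_into (g : U -> T) d : embedded A e -> smooth_atlas B ->
  smooth_map B A g -> B d -> Cinfty (cto d @` cdom d) (e \o g \o cfrom d).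
Proof.
move=> eA sB [cg Cg] Bd; have [_ As Ac] := eA; apply: Cinfty_local => _ [y dy <-].
have [c Ac' cy] := Ac (g y); have [[oc cK] _ Cc _] := As _ Ac'.
have [Bc _ _] := sB; have [_ dK] := Bc d Bd.
have og : @open (mfd B) (g @^-1` cdom c).
  have /continuousP cG : continuous (g : mfd B -> mfd A) by move=> x; exact: cg.
  apply: cG; apply: chart_open_open; exists c, setT; split=> //; first exact: openT.
  by rewrite preimage_setT setIT.
have oV := smooth_atlas_open sB Bd og.
have := Cg d c Bd Ac'; rewrite setIT => Cgd.
exists (cto d @` (cdom d `&` g @^-1` cdom c)); split; first by exists y.
apply: (@Cinfty_eq _ _ _ _ ((e \o cfrom c) \o (cto c \o g \o cfrom d))) => //.
  by move=> z; rewrite inE => -[w [dw gw] <-] /=; rewrite dK// cK.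
apply: (Cinfty_comp oV oc) Cc => // _ [w [dw gw] <-] /=; rewrite dK//.
by exists (g w).
Qed.

End SmoothMaps.

Section Transport.
Context {R : realType} {N n n' : nat} {T U : choiceType}.
Variables (A : atlas R n T) (e : T -> 'rV[R]_N) (B : atlas R n' U).

(** A manifold diffeomorphic to an embedded one is embedded by the
    same coordinates. *)
Lemma embedded_transport (f : T -> U) (g : U -> T) :
  embedded A e -> smooth_atlas B -> smooth_map A B f -> smooth_map B A g ->
  cancel f g -> cancel g f -> embedded B (e \o g).
Proof.
move=> eA sB sf sg fK gK; have [einj As Ac] := eA; have [Bc Bcov BC] := sB.
split=> // [|d Bd]; first exact: inj_comp (can_inj gK).
split.
- exact: Bc.
- have [P oP PE] := smooth_map_open eA sB sf Bd; exists P => //.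
  by rewrite comp_preimage -PE -comp_preimage /= (_ : f \o g = id)//; apply/funext.
- by have := smooth_map_into eA sB sg Bd; rewrite compA.
- move=> y dy; have := smooth_map_ext eA sB sf Bd.
  have dy' : (f @^-1` cdom d) (g y) by rewrite /= gK.
  move=> /(_ _ dy')[P [F [oP Py CF FE]]]; exists P, F; split=> // z dz Pz.
  by rewrite FE//= gK.
Qed.

End Transport.

Section Products.
Context {R : realType} {N n N' n' : nat} {T U : choiceType}.
Variables (A : atlas R n T) (e : T -> 'rV[R]_N).
Variables (B : atlas R n' U) (e' : U -> 'rV[R]_N').

Definition prod_emb (z : T * U) : 'rV[R]_(N + N') := row_mx (e z.1) (e' z.2).

Lemma open_prod_sub m p (O1 : set 'rV[R]_m) (O2 : set 'rV[R]_p) :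
  open O1 -> open O2 ->
  open ((lsubmx : 'rV[R]_(m + p) -> 'rV[R]_m) @^-1` O1 `&` rsubmx @^-1` O2).
Proof.
move=> o1 o2; apply: openI.
  by have /continuousP := @continuous_lsubmx R 1 m p; apply.
by have /continuousP := @continuous_rsubmx R 1 m p; apply.
Qed.

Lemma embedded_prod : embedded A e -> embedded B e' ->
  embedded (prod_atlas A B) prod_emb.
Proof.
move=> [einj As Ac] [einj' Bs Bc]; split.
- by move=> [x y] [x' y'] /eq_row_mx [/= /einj -> /einj' ->].
- move=> _ [c [d [/As[[oc cK] [P oP PE] Cc sc] /Bs[[od dK] [Q oQ QE] Cd sd] ->]]].
  have imE : cto (prod_chart c d) @` cdom (prod_chart c d) =
      lsubmx @^-1` (cto c @` cdom c) `&` rsubmx @^-1` (cto d @` cdom d).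
    apply/seteqP; split=> [_ [[x y] [/= dx dy] <-] /=|v [[x dx xv] [y dy yv]]].
      by rewrite row_mxKl row_mxKr; split; [exists x|exists y].
    exists (x, y); first by split.
    by rewrite /= xv yv hsubmxK.
  have oI := open_prod_sub oc od.
  split.
  + split; first by rewrite imE.
    by move=> [x y] [/= dx dy]; rewrite row_mxKl row_mxKr cK// dK.
  + exists (lsubmx @^-1` P `&` rsubmx @^-1` Q); first exact: open_prod_sub.
    apply/seteqP; rewrite /prod_emb; split=> -[x y] /=;
      by rewrite row_mxKl row_mxKr PE QE.
  + rewrite imE; apply: Cinfty_row_mx => //=.
      apply: (Cinfty_comp oI oc _ _ Cc) => [v []//|].
      exact: Cinfty_lsubmx.
    apply: (Cinfty_comp oI od _ _ Cd) => [v []//|].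
    exact: Cinfty_rsubmx.
  + move=> [x y] [/= /sc[P' [F [oP' Px CF FE]]] /sd[Q' [G [oQ' Qy CG GE]]]].
    exists (lsubmx @^-1` P' `&` rsubmx @^-1` Q'),
      (fun v => row_mx (F (lsubmx v)) (G (rsubmx v))).
    have oI' := open_prod_sub oP' oQ'.
    split=> //.
    * by rewrite /prod_emb /= row_mxKl row_mxKr.
    * apply: Cinfty_row_mx => //.
        apply: (Cinfty_comp oI' oP' _ _ CF) => [v []//|].
        exact: Cinfty_lsubmx.
      apply: (Cinfty_comp oI' oQ' _ _ CG) => [v []//|].
      exact: Cinfty_rsubmx.
    * move=> [x' y'] [/= dx dy]; rewrite /prod_emb /= row_mxKl row_mxKr => -[Px' Qy'].
      by rewrite FE// GE.
- move=> [x y]; have [c Ac' cx] := Ac x; have [d Bd dy] := Bc y.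
  by exists (prod_chart c d); [exists c, d|].
Qed.

End Products.

Section SectionDifferential.
Context {R : realType} {N n N' n' : nat} {T U : choiceType}.
Variables (A : atlas R n T) (e : T -> 'rV[R]_N).
Variables (B : atlas R n' U) (e' : U -> 'rV[R]_N').

(** By the chain rule applied to f o g = id, the differential of the section
    g is a right inverse of the one of f. *)
Lemma section_surj_differential (f : T -> U) (g : U -> T) x :
  embedded A e -> embedded B e' -> smooth_map A B f -> smooth_map B A g ->
  cancel g f -> g (f x) = x -> surj_differential A B f x.
Proof.
move=> eA eB [_ sf] sg gK gfx c d Ac Bd cx dfx w.
have sA : smooth_atlas A by have [] := embedded_manifold eA.
have [_ As _] := eA; have [_ Bs _] := eB.
have [[_ cK] _ _ _] := As _ Ac; have ds := Bs _ Bd; have [[_ dK] _ _ _] := ds.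
have og := smooth_map_open eB sA sg Ac.
have [oV _] := chart_ext_smooth ds og (@ext_smooth_id _ _ _ e' _).
have [_ /(_ d c Bd Ac)] := sg; rewrite setIT => Cg.
have := sf c d Ac Bd; rewrite setIT => Cf.
set V := cto d @` _ in oV Cg.
set F := _ \o cfrom c; set G : 'rV[R]_n' -> 'rV[R]_n := cto c \o g \o cfrom d.
have Vy : V (cto d (f x)) by exists (f x) => //; split=> //=; rewrite gfx.
have Gy : G (cto d (f x)) = cto c x by rewrite /G /= dK// gfx.
have dG := Cinfty_differentiable Cg Vy.
have dF : differentiable F (G (cto d (f x))).
  by rewrite Gy; apply: (Cinfty_differentiable Cf); exists x.
exists ('d G (cto d (f x)) w); rewrite -Gy.
have := diff_comp dG dF => /(congr1 (fun h => h w)) /= <-.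
have E : {in V, id =1 F \o G}.
  by move=> z; rewrite inE => -[y [dy gy] <-]; rewrite /F /G /= dK// cK//= gK.
have id_diff := near_eq_differentiable (open_eq_near oV E Vy).
have dI : differentiable (id : 'rV[R]_n' -> 'rV[R]_n') (cto d (f x)) by [].
rewrite -deriveE; last exact: id_diff.
rewrite -(near_eq_derive w (open_eq_near oV E Vy)).
exact: derive_id.
Qed.

End SectionDifferential.

(** The preimage of a compact set K is the image by g of the closed part of K
    where f o g is the identity. *)
Lemma proper_left_inverse (X Y : topologicalType) (f : X -> Y) (g : Y -> X) :
  hausdorff_space Y -> continuous f -> continuous g -> cancel f g ->
  proper_map f.
Proof.
move=> hY cf cg fK; split=> // K cK.
have cZ : closed [set y | f (g y) = y].
  move=> y yZ /=; apply: contrapT => /eqP ne.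
  move: hY; rewrite open_hausdorff => /(_ _ _ ne)[[P Q] /= [/set_mem Pfy /set_mem Qy]].
  move=> [oP oQ PQ0].
  have nP : nbhs y ((f \o g) @^-1` P).
    have /continuousP cfg : continuous (f \o g).
      by move=> z; apply: continuous_comp; [exact: cg|exact: cf].
    by apply: open_nbhs_nbhs; split; first exact: cfg.
  have nQ : nbhs y Q by exact: open_nbhs_nbhs.
  have [z [/= zE [Pz Qz]]] := yZ _ (filterI nP nQ).
  by have : (P `&` Q) z; [split=> //; rewrite -zE|rewrite (eqP PQ0)].
have -> : f @^-1` K = g @` (K `&` [set y | f (g y) = y]).
  apply/seteqP; split=> [x Kx|_ [y [Ky yE] <-]]; last by rewrite /= yE.
  by exists (f x); rewrite ?fK//; split=> //=; rewrite fK.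
apply: continuous_compact; first by apply: continuous_subspaceT.
apply: (subclosed_compact _ cK); last by move=> y [].
by apply: closedI => //; exact: compact_closed.
Qed.

(** * Smooth quaternionic expressions *)
Section QuatSmooth.
Context {R : realType} {m : nat}.
Local Notation E := 'rV[R]_m.
Local Notation H := (quat R).
Implicit Types (k : nat) (D : set E).

Definition qreal (a : R) : H := Quat a 0 0 0.

Definition CkQ k D (f : E -> H) : Prop :=
  [/\ CkV k D (fun x => qre (f x)), CkV k D (fun x => qi (f x)),
      CkV k D (fun x => qj (f x)) & CkV k D (fun x => qk (f x))].

Lemma CkQ_cst k D (q : H) : CkQ k D (fun=> q).
Proof. by split; exact: CkV_cst. Qed.

Lemma CkV_B k D (f g : E -> R) : open D -> CkV k D f -> CkV k D g ->
  CkV k D (fun x => f x - g x).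
Proof. by move=> oD cf cg; apply: CkV_D => //; exact: CkV_N. Qed.

Lemma CkQ_M k D (f g : E -> H) : open D -> CkQ k D f -> CkQ k D g ->
  CkQ k D (fun x => f x * g x).
Proof.
move=> oD [f0 f1 f2 f3] [g0 g1 g2 g3]; split;
  by do ?[apply: CkV_B => // | apply: CkV_D => // | exact: CkV_M].
Qed.

Lemma CkQ_conj k D (f : E -> H) : open D -> CkQ k D f ->
  CkQ k D (fun x => qconj (f x)).
Proof. by move=> oD [f0 f1 f2 f3]; split => //; exact: CkV_N. Qed.

Lemma CkQ_real k D (a : E -> R) : CkV k D a -> CkQ k D (fun x => qreal (a x)).
Proof. by move=> ca; split => //; exact: CkV_cst. Qed.

Lemma CkV_qnorm2 k D (f : E -> H) : open D -> CkQ k D f ->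
  CkV k D (fun x => qnorm2 (f x)).
Proof.
by move=> oD [f0 f1 f2 f3]; do ![apply: CkV_D => // | exact: CkV_M].
Qed.

Lemma CkV_qvec k D (f : E -> H) : open D -> CkQ k D f ->
  CkV k D (fun x => qvec (f x)).
Proof.
move=> oD [f0 f1 f2 f3]; apply/CkV_coord => // -[j lj].
have E1 (h : E -> R) : CkV k D h -> (forall x, h x = qvec (f x) ord0 (Ordinal lj)) ->
    CkV k D (fun x => qvec (f x) ord0 (Ordinal lj)).
  by move=> ch he; apply: (CkV_eq oD _ ch) => x _; rewrite he.
case: j lj E1 => [|[|[|[|//]]]] lj E1.
- by apply: E1 f0 _ => x; rewrite mxE.
- by apply: E1 f1 _ => x; rewrite mxE.
- by apply: E1 f2 _ => x; rewrite mxE.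
- by apply: E1 f3 _ => x; rewrite mxE.
Qed.

Lemma CkQ_vecq k D (f : E -> 'rV[R]_4) : open D -> CkV k D f ->
  CkQ k D (fun x => vecq (f x)).
Proof. by move=> oD /(CkV_coord _ _ oD) cf; split; exact: cf. Qed.

Definition nrm (b : H) : R := Num.sqrt (1 + qnorm2 b).

Lemma nrm_gt0 b : 0 < nrm b.
Proof. by rewrite sqrtr_gt0 ltr_wpDr ?qnorm2_ge0. Qed.

Lemma sqr_nrm b : nrm b ^+ 2 = 1 + qnorm2 b.
Proof. by rewrite sqr_sqrtr// addr_ge0 ?qnorm2_ge0. Qed.

Lemma CkV_nrm k D (f : E -> H) : open D -> CkQ k D f ->
  CkV k D (fun x => nrm (f x)).
Proof.
move=> oD cf; apply: CkV_sqrt => // [x _|]; first by rewrite ltr_wpDr ?qnorm2_ge0.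
by apply: CkV_D => //; [exact: CkV_cst|exact: CkV_qnorm2].
Qed.

Lemma CkV_nrmV k D (f : E -> H) : open D -> CkQ k D f ->
  CkV k D (fun x => (nrm (f x))^-1).
Proof.
move=> oD cf; apply: CkV_V => // [x _|]; last exact: CkV_nrm.
exact/lt0r_neq0/nrm_gt0.
Qed.

End QuatSmooth.

Lemma CkV_lsubmx_comp (R : realType) m n p k (D : set 'rV[R]_m)
  (f : 'rV[R]_m -> 'rV[R]_(n + p)) : open D -> CkV k D f ->
  CkV k D (fun x => lsubmx (f x)).
Proof. by move=> oD; apply: (CkV_lin oD (L := lsubmx)); exact: continuous_lsubmx. Qed.

Lemma CkV_rsubmx_comp (R : realType) m n p k (D : set 'rV[R]_m)
  (f : 'rV[R]_m -> 'rV[R]_(n + p)) : open D -> CkV k D f ->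
  CkV k D (fun x => rsubmx (f x)).
Proof. by move=> oD; apply: (CkV_lin oD (L := rsubmx)); exact: continuous_rsubmx. Qed.

(** Descends through an expression built from row blocks, the identification
    of H with R^4, quaternion products and conjugations, and [nrm]. *)
Ltac smooth := repeat first
  [ exact: openT
  | exact: CkV_id
  | apply: CkV_row_mx
  | apply: CkV_qvec
  | apply: CkV_lsubmx_comp
  | apply: CkV_rsubmx_comp
  | apply: CkQ_cst
  | apply: CkQ_real
  | apply: CkQ_conj
  | apply: CkQ_vecq
  | apply: CkQ_M
  | apply: CkV_nrmV
  | apply: CkV_nrm ].

Lemma ext_smooth_global (R : realType) (V : Type) M p (i : V -> 'rV[R]_M)
  (h : V -> 'rV[R]_p) (F : 'rV[R]_M -> 'rV[R]_p) :
  (forall k, CkV k setT F) -> (forall x, F (i x) = h x) -> ext_smooth i setT h.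
Proof.
move=> CF FE x _; exists setT, F.
by split; [exact: openT| |move=> k; exact/Ck_CkV|].
Qed.

Section ExtTransport.
Context {R : realType} {N n N' : nat} {T U : choiceType}.
Variables (A : atlas R n T) (e : T -> 'rV[R]_N) (e' : U -> 'rV[R]_N').

(** If a bijection f from an embedded manifold to U is smooth in both
    directions for the ambient coordinates, then the submanifold atlas of U
    covers U, by the images of the charts of T. *)
Lemma ext_transport (f : T -> U) (g : U -> T) : embedded A e -> injective e' ->
  ext_smooth e setT (e' \o f) -> ext_smooth e' setT (e \o g) ->
  cancel f g -> cancel g f ->
  embedded (submanifold_atlas e' : atlas R n U) e'.
Proof.
move=> eA einj' sf sg fK gK; have [_ As Ac] := eA; split=> // y.
have [c Ac' cy] := Ac (g y); have cs := As _ Ac'.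
have [[oc cK] [P oP PE] Cc sc] := cs.
exists (Chart (g @^-1` cdom c) (cto c \o g) (f \o cfrom c)) => //.
have imE : (cto c \o g) @` (g @^-1` cdom c) = cto c @` cdom c.
  apply/seteqP; split=> [_ [z gz <-]|_ [z gz <-]]; first by exists (g z).
  by exists (f z); rewrite /= fK.
split; rewrite /= ?imE.
- by split=> [|z gz] /=; rewrite ?imE// cK.
- have [Q oQ QE] : ext_open e' (g @^-1` cdom c).
    by apply: (ext_smooth_preimage sg); exists P.
  by exists Q.
- have := chart_ext_smooth cs (ext_openT e) sf.
  by rewrite setIT => -[_].
- exact: (ext_smooth_pullback sg sc).
Qed.

End ExtTransport.

(** * The Lie group Sp(1) *)
Section Sp1Charts.
Context {R : realType}.
Local Notation H := (quat R).
Implicit Types u g : Sp1 R.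

Lemma qnorm2_sp1 u : qnorm2 (u : H) = 1.
Proof. by case: u => u /=; rewrite qabs_eq1 => /eqP. Qed.

Lemma sp1_mulV u : (u : H) * qconj u = 1.
Proof. by rewrite qmul_conj qnorm2_sp1. Qed.

Lemma sp1_Vmul u : qconj u * (u : H) = 1.
Proof. by rewrite qconj_mul qnorm2_sp1. Qed.

Lemma qconj_norm (q : H) : qnorm2 (qconj q) = qnorm2 q.
Proof. by rewrite /qnorm2 /= !sqrrN. Qed.

Definition cayley_norm (v : 'rV[R]_3) : R :=
  v ord0 (@Ordinal 3 0 isT) ^+ 2 + v ord0 (@Ordinal 3 1 isT) ^+ 2
  + v ord0 (@Ordinal 3 2 isT) ^+ 2.

(** The inverse of the stereographic projection from the point -1 of the
    sphere, onto the space of imaginary quaternions. *)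
Definition cayley (v : 'rV[R]_3) : H :=
  let d := 1 + cayley_norm v in
  Quat ((1 - cayley_norm v) / d) (2 * v ord0 (@Ordinal 3 0 isT) / d)
    (2 * v ord0 (@Ordinal 3 1 isT) / d) (2 * v ord0 (@Ordinal 3 2 isT) / d).

Definition cayley_inv (q : H) : 'rV[R]_3 :=
  \row_(i < 3) [:: qi q / (1 + qre q); qj q / (1 + qre q); qk q / (1 + qre q)]`_i.

Lemma cayley_den v : 0 < 1 + cayley_norm v.
Proof. by rewrite ltr_wpDr// /cayley_norm !addr_ge0 ?sqr_ge0. Qed.

Fact cayley_unit v : qabs (cayley v) == 1.
Proof.
rewrite qabs_eq1 /qnorm2 /=; have := lt0r_neq0 (cayley_den v).
rewrite /cayley_norm => d0; apply/eqP; field.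
exact: d0.
Qed.

Lemma cayley_re v : 1 + qre (cayley v) = 2 / (1 + cayley_norm v).
Proof. have := lt0r_neq0 (cayley_den v) => d0 /=; field; exact: d0. Qed.

Lemma cayleyK : cancel cayley cayley_inv.
Proof.
move=> v; have d0 := lt0r_neq0 (cayley_den v).
apply/rowP => -[j lj]; rewrite mxE /= -[1 + (1 - _) / _]/(1 + qre (cayley v)) cayley_re.
have E (x : R) : 2 * x / (1 + cayley_norm v) / (2 / (1 + cayley_norm v)) = x.
  by field; rewrite d0.
case: j lj => [|[|[|//]]] lj; rewrite /= E; congr (v _ _); exact: val_inj.
Qed.

Lemma cayley_invK q : qnorm2 q = 1 -> 1 + qre q != 0 -> cayley (cayley_inv q) = q.
Proof.
case: q => r x y z; rewrite /qnorm2 /= => q1 r0.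
rewrite /cayley /cayley_norm !mxE /=.
have E : (x / (1 + r)) ^+ 2 + (y / (1 + r)) ^+ 2 + (z / (1 + r)) ^+ 2 =
  (1 - r) / (1 + r).
  have -> : (x / (1 + r)) ^+ 2 + (y / (1 + r)) ^+ 2 + (z / (1 + r)) ^+ 2 =
    (x ^+ 2 + y ^+ 2 + z ^+ 2) / (1 + r) ^+ 2 by field.
  have -> : x ^+ 2 + y ^+ 2 + z ^+ 2 = 1 - r ^+ 2 by rewrite -q1; ring.
  by field.
rewrite E.
have r2 : 1 + r + (1 - r) != 0.
  by rewrite (_ : _ + _ = 2) ?pnatr_eq0//; ring.
by congr Quat; field; rewrite r0 r2.
Qed.

Definition cayley_sp1 v : Sp1 R := MkSp1 (cayley_unit v).

(** The stereographic projection translated by g: it is defined at all points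
    but -g and its image is the whole of R^3, whose openness is clear. *)
Definition sp1_chart g : chart R 3 (Sp1 R) :=
  Chart [set u : Sp1 R | 1 + qre (qconj g * u) != 0]
    (fun u => cayley_inv (qconj g * u)) (fun v => sp1_mul g (cayley_sp1 v)).

Lemma CkV_cayley_inv m k (D : set 'rV[R]_m) (f : 'rV[R]_m -> H) : open D ->
  (forall x, D x -> 1 + qre (f x) != 0) -> CkQ k D f ->
  CkV k D (fun x => cayley_inv (f x)).
Proof.
move=> oD d0 [f0 f1 f2 f3]; apply/CkV_coord => // -[j lj].
have cV : CkV k D (fun x => (1 + qre (f x))^-1).
  by apply: CkV_V => //; apply: CkV_D => //; exact: CkV_cst.
case: j lj => [|[|[|//]]] lj;
  [have h := CkV_M oD f1 cV|have h := CkV_M oD f2 cV|have h := CkV_M oD f3 cV];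
  by apply: (CkV_eq oD _ h) => x _; rewrite mxE.
Qed.

Lemma CkQ_cayley k (D : set 'rV[R]_3) : open D -> CkQ k D cayley.
Proof.
move=> oD; have cn : CkV k D (fun v => cayley_norm v).
  by do ![apply: CkV_D => // | apply: CkV_M => // | exact: CkV_coordE].
have cV : CkV k D (fun v => (1 + cayley_norm v)^-1).
  apply: CkV_V => // [v _|]; first exact/lt0r_neq0/cayley_den.
  by apply: CkV_D => //; exact: CkV_cst.
split; apply: CkV_M => //.
- by apply: CkV_B => //; exact: CkV_cst.
- by apply: CkV_M; [|exact: CkV_cst|exact: CkV_coordE].
- by apply: CkV_M; [|exact: CkV_cst|exact: CkV_coordE].
- by apply: CkV_M; [|exact: CkV_cst|exact: CkV_coordE].
Qed.

Lemma sp1_chart_sub g : sp1_atlas R (sp1_chart g).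
Proof.
have dK u : 1 + qre (qconj g * u) != 0 ->
    sp1_mul g (cayley_sp1 (cayley_inv (qconj g * u))) = u.
  move=> d0; apply: val_inj => /=; rewrite cayley_invK//.
    by rewrite mulrA sp1_mulV mul1r.
  by rewrite qnorm2M qconj_norm !qnorm2_sp1 mulr1.
have gK v : qconj g * (sp1_mul g (cayley_sp1 v) : H) = cayley v.
  by rewrite mulrA sp1_Vmul mul1r.
have imT : cto (sp1_chart g) @` cdom (sp1_chart g) = setT.
  apply/seteqP; split=> // v _; exists (sp1_mul g (cayley_sp1 v)).
    rewrite /cdom /sp1_chart /mkset gK cayley_re mulf_neq0// ?invr_neq0//.
    exact/lt0r_neq0/cayley_den.
  by rewrite /cto /sp1_chart gK cayleyK.
have Cq k (D : set 'rV[R]_4) : open D -> CkQ k D (fun x => qconj g * vecq x).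
  move=> oD; apply: CkQ_M => //; first exact: CkQ_cst.
  by apply: CkQ_vecq => //; exact: CkV_id.
pose Q : set 'rV[R]_4 := [set x | 1 + qre (qconj g * vecq x) != 0].
have oQ : open Q.
  have cr : continuous (fun x : 'rV[R]_4 => 1 + qre (qconj g * vecq x)).
    have [cq _ _ _] := Cq 0 setT openT.
    have c1 : CkV 0 setT (fun x : 'rV[R]_4 => 1 + qre (qconj g * vecq x)).
      by apply: CkV_D => //; [exact: openT|exact: CkV_cst].
    by move=> x; exact: c1.
  rewrite (_ : Q = (fun x : 'rV[R]_4 => 1 + qre (qconj g * vecq x)) @^-1`
    [set a | a != 0])//.
  by have /continuousP := cr; apply; exact: open_neq.
have QE : cdom (sp1_chart g) = @sp1_vec R @^-1` Q.
  have QvE u : Q (sp1_vec u) = (1 + qre (qconj g * u) != 0) :> Prop.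
    by rewrite /Q /mkset /sp1_vec qvecK.
  by apply/seteqP; split=> u; rewrite /preimage /mkset QvE.
split.
- by split=> [|u]; [rewrite imT; exact: openT|exact: dK].
- by exists Q.
- rewrite imT => k; apply/Ck_CkV; apply: CkV_qvec; first exact: openT.
  apply: CkQ_M; [exact: openT|exact: CkQ_cst|].
  by apply: CkQ_cayley; exact: openT.
- move=> u du; exists Q, (fun x => cayley_inv (qconj g * vecq x)); split => //.
  + by move: du; rewrite QE.
  + by move=> k; apply/Ck_CkV/CkV_cayley_inv => //; exact: Cq.
  + by move=> w _ _; rewrite /sp1_vec qvecK.
Qed.

Lemma sp1_embedded : embedded (sp1_atlas R) (@sp1_vec R).
Proof.
split=> // [|u]; first exact: inj_comp (can_inj qvecK) val_inj.
exists (sp1_chart u); first exact: sp1_chart_sub.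
rewrite /cdom /sp1_chart /mkset sp1_Vmul /= (_ : 1 + 1 = 2%:R) ?pnatr_eq0//.
Qed.

Lemma sp1_lie : lie_group (sp1_atlas R).
Proof.
split; first exact: embedded_manifold sp1_embedded.
- apply: (ext_smooth_map (embedded_prod sp1_embedded sp1_embedded) sp1_embedded).
  apply: (ext_smooth_global (F :=
    fun x => qvec (vecq (lsubmx x) * vecq (rsubmx x)))) => [k|[u v]].
    by smooth.
  by rewrite /prod_emb /sp1_vec /= row_mxKl row_mxKr !qvecK.
- apply: (ext_smooth_map sp1_embedded sp1_embedded).
  apply: (ext_smooth_global (F := fun x => qvec (qconj (vecq x)))) => [k|u].
    by smooth.
  by rewrite /sp1_vec /= qvecK.
Qed.

End Sp1Charts.

(** * Sp(1,1) as (H x Sp(1)) x Sp(1) *)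
Section Slice.
Context {R : realType}.
Local Notation H := (quat R).
Implicit Types (A : Sp11 R) (u w : Sp1 R) (b : H).

Lemma qrealC (a : R) (q : H) : qreal a * q = q * qreal a.
Proof. by congr Quat => /=; ring. Qed.

Lemma qrealM (a b : R) : qreal a * qreal b = qreal (a * b) :> H.
Proof. by congr Quat => /=; ring. Qed.

Lemma qconj_real (a : R) : qconj (qreal a) = qreal a.
Proof. by congr Quat => /=; rewrite oppr0. Qed.

Lemma qnorm2_real (a : R) : qnorm2 (qreal a) = a ^+ 2.
Proof. by rewrite /qnorm2 /= expr0n /= !addr0. Qed.

Lemma nrmK b (q : H) : qreal (nrm b) * (qreal (nrm b)^-1 * q) = q.
Proof. by rewrite mulrA qrealM mulfV ?mul1r//; exact/lt0r_neq0/nrm_gt0. Qed.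

Lemma nrmVK b (q : H) : qreal (nrm b)^-1 * (qreal (nrm b) * q) = q.
Proof. by rewrite mulrA qrealM mulVf ?mul1r//; exact/lt0r_neq0/nrm_gt0. Qed.

Definition mx22 (a c b d : H) : 'M[H]_2 :=
  \matrix_(i, j) (if i == 0 then if j == 0 then a else c
                  else if j == 0 then b else d).

Fact slice_subproof b w :
  qadj (mx22 (qreal (nrm b)) (qconj b * w) b (qreal (nrm b) * w)) *m I11 R *m
  mx22 (qreal (nrm b)) (qconj b * w) b (qreal (nrm b) * w) == I11 R.
Proof.
apply/eqP/qmx2P; rewrite adjI11E !I11E !mxE /=.
- rewrite qconj_real qrealM qconj_mul -expr2 sqr_nrm.
  by congr Quat => /=; ring.
- by rewrite qconj_real (mulrA _ (qconj b)) (qrealC _ (qconj b)) -mulrA subrr.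
- by rewrite !qconjM qconj_real qconjK -!mulrA [_ * b]qrealC subrr.
- rewrite !qconjM qconj_real qconjK -!mulrA (mulrA b) qmul_conj (mulrA (qreal _)).
  rewrite qrealM -expr2 sqr_nrm -!/(qreal _) !mulrA -!(qrealC _ (qconj w)) -!mulrA.
  rewrite sp1_Vmul !mulr1; congr Quat => /=; ring.
Qed.

(** The elements of Sp(1,1) whose upper left entry is a positive real. *)
Definition slice b w : Sp11 R := MkSp11 (slice_subproof b w).

Lemma qnorm2_sp11_00 A : qnorm2 (sp11_val A 0 0) = 1 + qnorm2 (sp11_val A 1 0).
Proof.
case: A => A /= /eqP hA; have : (qadj A *m I11 R *m A) 0 0 = I11 R 0 0 by rewrite hA.
rewrite adjI11E !I11E !qconj_mul => /(congr1 (@qre _)) /= h; lra.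
Qed.

Lemma qnorm2_sp11_11 A : qnorm2 (sp11_val A 1 1) = 1 + qnorm2 (sp11_val A 1 0).
Proof.
case: A => A /= /eqP/sp11_adj hA.
have : (A *m I11 R *m qadj A) 1 1 = I11 R 1 1 by rewrite hA.
rewrite -{1}[A]qadjK adjI11E !I11E !qadjE !qconjK !qmul_conj.
move=> /(congr1 (@qre _)) /= h; lra.
Qed.

Lemma sp11_orthogonal A : qconj (sp11_val A 0 0) * sp11_val A 0 1 =
  qconj (sp11_val A 1 0) * sp11_val A 1 1.
Proof.
case: A => A /= /eqP hA; have : (qadj A *m I11 R *m A) 0 1 = I11 R 0 1 by rewrite hA.
by rewrite adjI11E !I11E => /subr0_eq.
Qed.

Lemma qnorm2_qabs1 (q : H) : qnorm2 q = 1 -> qabs q == 1.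
Proof. by rewrite qabs_eq1 => ->. Qed.

Fact phase_subproof A :
  qabs (qreal (nrm (sp11_val A 1 0))^-1 * sp11_val A 0 0) == 1.
Proof.
apply: qnorm2_qabs1; rewrite qnorm2M qnorm2_real qnorm2_sp11_00 -sqr_nrm exprVn mulVf//.
exact/expf_neq0/lt0r_neq0/nrm_gt0.
Qed.

Definition phase A : Sp1 R := MkSp1 (phase_subproof A).

Definition bcoord A : H := sp11_val A 1 0 * qconj (phase A).

Fact wcoord_subproof A :
  qabs (qreal (nrm (sp11_val A 1 0))^-1 * (sp11_val A 1 1 * qconj (phase A))) == 1.
Proof.
apply: qnorm2_qabs1; rewrite !qnorm2M qnorm2_real qnorm2_sp11_11 -sqr_nrm exprVn.
rewrite qconj_norm qnorm2_sp1 mulr1 mulVf//.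
exact/expf_neq0/lt0r_neq0/nrm_gt0.
Qed.

Definition wcoord A : Sp1 R := MkSp1 (wcoord_subproof A).

Lemma sp1_mulE u w : ((u * w)%g : H) = (u : H) * w. Proof. by []. Qed.

Lemma phaseE A : (phase A : H) = qreal (nrm (sp11_val A 1 0))^-1 * sp11_val A 0 0.
Proof. by []. Qed.

Lemma wcoordE A : (wcoord A : H) =
  qreal (nrm (sp11_val A 1 0))^-1 * (sp11_val A 1 1 * qconj (phase A)).
Proof. by []. Qed.

Lemma sliceE b w : [/\ sp11_val (slice b w) 0 0 = qreal (nrm b),
  sp11_val (slice b w) 0 1 = qconj b * w, sp11_val (slice b w) 1 0 = b
  & sp11_val (slice b w) 1 1 = qreal (nrm b) * w].
Proof. by rewrite /slice /mx22; split; rewrite [LHS]mxE. Qed.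

Lemma sp11_actE A u i j : sp11_val (sp11_act A u) i j = sp11_val A i j * u.
Proof. by rewrite /= -diag_const_mx mul_mx_diag !mxE. Qed.

Lemma sp11_act1 A : sp11_act A 1%g = A.
Proof. by apply: val_inj; apply/matrixP => i j; rewrite sp11_actE mulr1. Qed.

Lemma sp11_actM A u w : sp11_act A (u * w)%g = sp11_act (sp11_act A u) w.
Proof. by apply: val_inj; apply/matrixP => i j; rewrite !sp11_actE mulrA. Qed.

Lemma nrmM b u : nrm (b * u) = nrm b.
Proof. by rewrite /nrm qnorm2M qnorm2_sp1 mulr1. Qed.

Lemma phase_act A u : phase (sp11_act A u) = (phase A * u)%g.
Proof. by apply: val_inj; rewrite [LHS]phaseE !sp11_actE nrmM mulrA. Qed.

Lemma bcoord_act A u : bcoord (sp11_act A u) = bcoord A.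
Proof.
rewrite /bcoord phase_act sp11_actE sp1_mulE qconjM mulrA.
by rewrite -(mulrA _ (u : H)) sp1_mulV mulr1.
Qed.

Lemma wcoord_act A u : wcoord (sp11_act A u) = wcoord A.
Proof.
apply: val_inj; rewrite [LHS]wcoordE [RHS]wcoordE phase_act !sp11_actE nrmM.
rewrite sp1_mulE qconjM (mulrA _ (qconj u)).
by rewrite -(mulrA _ (u : H)) sp1_mulV mulr1.
Qed.

Lemma phase_slice b w : phase (slice b w) = 1%g.
Proof.
apply: val_inj; rewrite [LHS]phaseE; have [-> _ -> _] := sliceE b w.
by rewrite qrealM mulVf//; exact/lt0r_neq0/nrm_gt0.
Qed.

Lemma bcoord_slice b w : bcoord (slice b w) = b.
Proof.
by rewrite /bcoord phase_slice; have [_ _ -> _] := sliceE b w; rewrite qconj1 mulr1.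
Qed.

Lemma wcoord_slice b w : wcoord (slice b w) = w.
Proof.
apply: val_inj; rewrite [LHS]wcoordE phase_slice; have [_ _ -> ->] := sliceE b w.
by rewrite qconj1 mulr1 nrmVK.
Qed.

(** Three entries are recovered from the definitions of the coordinates; the
    upper right one is then forced by the orthogonality of the columns. *)
Lemma slice_decomp A : sp11_act (slice (bcoord A) (wcoord A)) (phase A) = A.
Proof.
have nb : nrm (bcoord A) = nrm (sp11_val A 1 0).
  by rewrite /nrm /bcoord qnorm2M qconj_norm qnorm2_sp1 mulr1.
have pV (q : H) : q * qconj (phase A) * phase A = q.
  by rewrite -mulrA sp1_Vmul mulr1.
have hb : bcoord A * phase A = sp11_val A 1 0 by rewrite /bcoord pV.
have ha : qreal (nrm (sp11_val A 1 0)) * phase A = sp11_val A 0 0.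
  by rewrite phaseE nrmK.
have hd : qreal (nrm (sp11_val A 1 0)) * wcoord A * phase A = sp11_val A 1 1.
  by rewrite wcoordE nrmK pV.
have [s00 s01 s10 s11] := sliceE (bcoord A) (wcoord A).
apply: val_inj; apply: qmx2P; rewrite sp11_actE ?s00 ?s01 ?s10 ?s11 ?nb//.
have n0 := lt0r_neq0 (nrm_gt0 (sp11_val A 1 0)).
move: (nrm (sp11_val A 1 0)) n0 ha hd => n n0 ha hd.
move: (sp11_orthogonal A) (sp1_mulV (phase A)); rewrite -ha -hb -hd.
move: (sp1_val (phase A)) (sp1_val (wcoord A)) (bcoord A) => p w b.
rewrite !qconjM qconj_real => + pp.
move=> /(congr1 (fun q : H => qreal n^-1 * (p * q))).
rewrite !mulrA -!(mulrA _ p (qconj p)) pp !mulr1 qrealM mulVf// mul1r => ->.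
by rewrite -(mulrA _ (qconj b)) -(qrealC n) mulrA qrealM mulVf// mul1r.
Qed.

End Slice.

Section Trivialization.
Context {R : realType}.
Local Notation H := (quat R).

Definition flat_atlas n : atlas R n 'rV[R]_n := [set Chart setT id id].

Lemma flat_embedded n : embedded (@flat_atlas n) id.
Proof.
split=> // [_ ->|x]; last by exists (Chart setT id id).
have imT : id @` [set: 'rV[R]_n] = setT by rewrite image_id.
split.
- by split=> //=; rewrite imT; exact: openT.
- by exists setT; [exact: openT|].
- exact: Cinfty_id.
- move=> x _; exists setT, id; split=> //; [exact: openT|exact: Cinfty_id].
Qed.

Definition base_model : choiceType := ('rV[R]_4 * Sp1 R)%type.
Definition model_atlas : atlas R (4 + 3) base_model :=
  prod_atlas (@flat_atlas 4) (sp1_atlas R).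
Definition model_vec : base_model -> 'rV[R]_(4 + 4) := prod_emb id (@sp1_vec R).

Lemma model_embedded : embedded model_atlas model_vec.
Proof. exact: embedded_prod (flat_embedded 4) sp1_embedded. Qed.

Definition base_slice (t : base_model) : Sp11 R := slice (vecq t.1) t.2.
Definition frame (z : base_model * Sp1 R) : Sp11 R := sp11_act (base_slice z.1) z.2.
Definition coords (A : Sp11 R) : base_model := (qvec (bcoord A), wcoord A).

Lemma vecqK : cancel (@vecq R) (@qvec R).
Proof.
move=> v; apply/rowP => -[j lj]; rewrite mxE.
by case: j lj => [|[|[|[|//]]]] lj /=; congr (v _ _); exact: val_inj.
Qed.

Lemma coords_slice t : coords (base_slice t) = t.
Proof. by case: t => v w; rewrite /coords bcoord_slice wcoord_slice vecqK. Qed.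

Lemma coords_act A u : coords (sp11_act A u) = coords A.
Proof. by rewrite /coords bcoord_act wcoord_act. Qed.

Lemma frame_coords A : frame (coords A, phase A) = A.
Proof. by rewrite /frame /base_slice /= qvecK slice_decomp. Qed.

Lemma coords_frame z : coords (frame z) = z.1.
Proof. by rewrite /frame coords_act coords_slice. Qed.

Lemma phase_frame z : phase (frame z) = z.2.
Proof. by rewrite /frame phase_act phase_slice mul1g. Qed.

Lemma frame_smooth :
  ext_smooth (prod_emb model_vec (@sp1_vec R)) setT (@sp11_vec R \o frame).
Proof.
pose b (x : 'rV[R]_(4 + 4 + 4)) := vecq (lsubmx (lsubmx x)).
pose w (x : 'rV[R]_(4 + 4 + 4)) := vecq (rsubmx (lsubmx x)).
pose u (x : 'rV[R]_(4 + 4 + 4)) := vecq (rsubmx x).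
apply: (ext_smooth_global (F := fun x =>
  row_mx (row_mx (qvec (qreal (nrm (b x)) * u x)) (qvec (qconj (b x) * w x * u x)))
  (row_mx (qvec (b x * u x)) (qvec (qreal (nrm (b x)) * w x * u x))))) => [k|].
  by rewrite /b /w /u; smooth.
move=> [[v q] p]; set x := prod_emb _ _ _.
have -> : b x = vecq v.
  by rewrite /b /x /prod_emb row_mxKl /model_vec /prod_emb row_mxKl.
have -> : w x = q.
  by rewrite /w /x /prod_emb row_mxKl /model_vec /prod_emb row_mxKr /sp1_vec qvecK.
have -> : u x = p by rewrite /u /x /prod_emb row_mxKr /sp1_vec qvecK.
rewrite [RHS]/(sp11_vec (sp11_act _ _)) /sp11_vec !sp11_actE.
by have [-> -> -> ->] := sliceE (vecq v) q.
Qed.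

Let a00 (x : 'rV[R]_(4 + 4 + (4 + 4))) := vecq (lsubmx (lsubmx x)).
Let a10 (x : 'rV[R]_(4 + 4 + (4 + 4))) := vecq (lsubmx (rsubmx x)).
Let a11 (x : 'rV[R]_(4 + 4 + (4 + 4))) := vecq (rsubmx (rsubmx x)).
Let a01 (x : 'rV[R]_(4 + 4 + (4 + 4))) := vecq (rsubmx (lsubmx x)).
Let phi x := qreal (nrm (a10 x))^-1 * a00 x.

Let entries A : [/\ a00 (sp11_vec A) = sp11_val A 0 0,
  a01 (sp11_vec A) = sp11_val A 0 1, a10 (sp11_vec A) = sp11_val A 1 0 &
  a11 (sp11_vec A) = sp11_val A 1 1].
Proof.
by rewrite /a00 /a01 /a10 /a11 /sp11_vec !(row_mxKl, row_mxKr) !qvecK.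
Qed.

Lemma phase_smooth : ext_smooth (@sp11_vec R) setT (@sp1_vec R \o phase).
Proof.
apply: (ext_smooth_global (F := fun x => qvec (phi x))) => [k|A].
  by rewrite /phi /a10 /a00; smooth.
by rewrite /phi; have [-> _ -> _] := entries A.
Qed.

Lemma coords_smooth : ext_smooth (@sp11_vec R) setT (model_vec \o coords).
Proof.
apply: (ext_smooth_global (F := fun x => row_mx (qvec (a10 x * qconj (phi x)))
  (qvec (qreal (nrm (a10 x))^-1 * (a11 x * qconj (phi x)))))) => [k|A].
  by rewrite /phi /a11 /a10 /a00; smooth.
by rewrite /phi; have [-> _ -> ->] := entries A.
Qed.

Lemma act_smooth : ext_smooth (prod_emb (@sp11_vec R) (@sp1_vec R)) setT
  (@sp11_vec R \o (fun z => sp11_act z.1 z.2)).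
Proof.
pose u (x : 'rV[R]_(4 + 4 + (4 + 4) + 4)) := vecq (rsubmx x).
apply: (ext_smooth_global (F := fun x =>
  row_mx (row_mx (qvec (a00 (lsubmx x) * u x)) (qvec (a01 (lsubmx x) * u x)))
  (row_mx (qvec (a10 (lsubmx x) * u x)) (qvec (a11 (lsubmx x) * u x))))) => [k|].
  by rewrite /u /a00 /a10 /a11 /a01; smooth.
move=> [A q]; rewrite /u /prod_emb /= !(row_mxKl, row_mxKr).
have [-> -> -> ->] := entries A.
by rewrite [RHS]/sp11_vec !sp11_actE /sp1_vec qvecK.
Qed.

Lemma sp11_vec_inj : injective (@sp11_vec R).
Proof.
move=> A B AB; have [a0 a1 a2 a3] := entries A; have [b0 b1 b2 b3] := entries B.
by apply: val_inj; apply: qmx2P; [rewrite -a0 -b0|rewrite -a1 -b1|rewrite -a2 -b2|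
  rewrite -a3 -b3]; rewrite AB.
Qed.

(** The inclusion in R^16 and the global coordinates (b, w, phase) are smooth
    functions of each other. *)
Lemma sp11_embedded : embedded (sp11_atlas R) (@sp11_vec R).
Proof.
apply: (ext_transport (embedded_prod model_embedded sp1_embedded) sp11_vec_inj
  frame_smooth (g := fun A => (coords A, phase A))).
- exact: ext_smooth_row coords_smooth phase_smooth.
- by move=> z; rewrite coords_frame phase_frame; case: z.
- exact: frame_coords.
Qed.

End Trivialization.

(** * Power series of slice regular Moebius transformations *)
Section RealSeries.
Context {R : realType}.

Lemma geometric_sum_le (t : R) N : 0 <= t <= 2^-1 ->
  \sum_(j < N) t ^+ j.+1 <= 2 * t.
Proof.
move=> /andP[t0 t1].
have H : \sum_(j < N) t ^+ j.+1 <= 2 * t - 2 * t ^+ N.+1.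
  elim: N => [|N IH]; first by rewrite big_ord0 expr1; lra.
  rewrite big_ord_recr /= (le_trans (lerD IH (lexx _)))// [_ ^+ N.+2]exprS.
  have : 0 <= t ^+ N.+1 by exact: exprn_ge0.
  nra.
by rewrite (le_trans H)// gerBl mulr_ge0 ?exprn_ge0.
Qed.

(** Convergence at t = 1/2 bounds c_k by M 2^k. If the coefficients before c_n
    vanish, then the sum of the series is t^n c_n up to an error O(t^(n+1)), and
    it is 0: letting t tend to 0 gives c_n = 0. *)
Lemma power_series_eq0 (c : nat -> R) :
  (forall t, 0 <= t < 1 -> (fun n => \sum_(k < n) t ^+ k * c k) @ \oo --> 0) ->
  forall n, c n = 0.
Proof.
move=> H.
have [M M0 cM] : exists2 M, 0 <= M & forall k, `|c k| <= M * 2 ^+ k.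
  have h2 : 0 <= (2^-1 : R) < 1 by rewrite invr_ge0 ler0n /= invf_lt1// ltr1n.
  have c2 := H _ h2.
  have t2 : (fun n => 2^-1 ^+ n * c n) @ \oo --> (0 : R).
    have -> : (fun n => 2^-1 ^+ n * c n) =
       (fun n => \sum_(k < n.+1) 2^-1 ^+ k * c k - \sum_(k < n) 2^-1 ^+ k * c k).
      by apply/funext => n; rewrite big_ord_recr /= addrAC subrr add0r.
    rewrite -[X in _ --> X](subrr 0); apply: cvgB => //.
    by have := c2; rewrite -(cvg_shiftS (fun n => \sum_(k < n) 2^-1 ^+ k * c k)).
  have /cvg_seq_bounded[M [_ /(_ (M + 1))]] : cvgn (fun n => 2^-1 ^+ n * c n : R^o).
    by apply/cvg_ex; exists 0.
  rewrite ltrDl ltr01 => /(_ isT) MB; exists (M + 1).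
    by apply: le_trans (MB 0%N I); exact: normr_ge0.
  move=> k; have := MB k I; rewrite /= normrM normrX normfV (@ger0_norm _ 2)// exprVn.
  by rewrite ler_pdivrMl ?exprn_gt0// mulrC.
elim/ltn_ind => n IH.
apply/eqP; rewrite -normr_le0; apply/ler_addgt0Pl => e e0; rewrite addr0.
(* For t <= 1/4 the tail after t^n c_n is at most t^n t (4 M 2^n), and the
   partial sum will be taken within t^n t of its limit 0. *)
pose t := Num.min 4^-1 (e / (1 + 4 * (M * 2 ^+ n))).
have K0 : 0 < 1 + 4 * (M * 2 ^+ n).
  by rewrite ltr_wpDr// !mulr_ge0 ?exprn_ge0.
have t0 : 0 < t by rewrite lt_min invr_gt0 ltr0n divr_gt0.
have t4 : t <= 4^-1 by rewrite ge_min lexx.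
have te : t * (1 + 4 * (M * 2 ^+ n)) <= e.
  by rewrite -ler_pdivlMr// ge_min lexx orbT.
have ct : (fun m => \sum_(k < m) t ^+ k * c k) @ \oo --> 0.
  by apply: H; rewrite ltW//=; lra.
have tX k : 0 <= t ^+ k by rewrite exprn_ge0// ltW.
have ctn : 0 < t ^+ n * t by rewrite mulr_gt0// exprn_gt0.
move/cvgrPdist_lt : ct => /(_ _ ctn)[N _ NH].
have := NH (n + N.+1)%N; rewrite /= => /(_ _).
have -> : (N <= n + N.+1)%N by rewrite (leq_trans (leqnSn N))// leq_addl.
move=> /(_ isT); rewrite sub0r normrN big_split_ord /= big1 ?add0r; last first.
  by move=> i _; rewrite IH ?mulr0.
rewrite big_ord_recl /= addn0 => SN.
have tail : `|\sum_(i < N) t ^+ (n + bump 0 i) * c (n + bump 0 i)%N| <=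
   t ^+ n * (t * (4 * (M * 2 ^+ n))).
  apply: (le_trans (ler_norm_sum _ _ _)).
  apply: (@le_trans _ _ (\sum_(i < N) t ^+ n * (M * 2 ^+ n) * (2 * t) ^+ i.+1)).
    apply: ler_sum => i _; rewrite /bump leq0n add1n normrM ger0_norm//.
    rewrite (le_trans (ler_wpM2l (tX _) (cM _)))//.
    by rewrite !exprD exprMn le_eqVlt; apply/orP; left; apply/eqP; ring.
  rewrite -mulr_sumr -mulrA ler_pM2l ?exprn_gt0//.
  have := @geometric_sum_le (2 * t) N; have -> : 0 <= 2 * t <= 2^-1.
    by apply/andP; split; lra.
  move=> /(_ isT) h; have Mn : 0 <= M * 2 ^+ n by rewrite mulr_ge0 ?exprn_ge0.
  rewrite (le_trans (ler_wpM2l Mn h))//; lra.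
have : t ^+ n * `|c n| <= t ^+ n * t + t ^+ n * (t * (4 * (M * 2 ^+ n))).
  have -> : t ^+ n * `|c n| = `|t ^+ n * c n|.
    by rewrite normrM ger0_norm// exprn_ge0// ltW.
  rewrite -[X in `|X|](addrK (\sum_(i < N) t ^+ (n + bump 0 i) * c (n + bump 0 i)%N)).
  by rewrite (le_trans (ler_normB _ _))// lerD// ltW.
rewrite -mulrDr ler_pM2l ?exprn_gt0// => /le_trans; apply.
rewrite (le_trans _ te)//; lra.
Qed.

End RealSeries.

Section QuatLimits.
Context {R : realType}.
Local Notation H := (quat R).
Implicit Types (u : nat -> H) (l c : H).

Definition qcvg u l : Prop := (fun n => qvec (u n)) @ \oo --> qvec l.

Lemma qcvgP u l : qcvg u l <-> [/\ (fun n => qre (u n)) @ \oo --> qre l,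
  (fun n => qi (u n)) @ \oo --> qi l, (fun n => qj (u n)) @ \oo --> qj l &
  (fun n => qk (u n)) @ \oo --> qk l].
Proof.
split=> [ul|[u0 u1 u2 u3]].
  have H j : (fun n => qvec (u n) ord0 j) @ \oo --> qvec l ord0 j.
    by apply: (cvg_comp _ (fun v : 'rV[R]_4 => v ord0 j) ul); exact: coord_continuous.
  split.
  - by have := H (@Ordinal 4 0 isT); rewrite mxE /=; under eq_fun do rewrite mxE /=.
  - by have := H (@Ordinal 4 1 isT); rewrite mxE /=; under eq_fun do rewrite mxE /=.
  - by have := H (@Ordinal 4 2 isT); rewrite mxE /=; under eq_fun do rewrite mxE /=.
  - by have := H (@Ordinal 4 3 isT); rewrite mxE /=; under eq_fun do rewrite mxE /=.
apply/cvgrPdist_lt => e e0; near=> n.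
rewrite [ltLHS]/Num.Def.normr/= mx_normrE; apply/bigmax_ltP; split=> // -[i [j lj]] _.
rewrite !mxE /=; case: j lj => [|[|[|[|//]]]] lj /=.
- by near: n; move/cvgrPdist_lt : u0; exact.
- by near: n; move/cvgrPdist_lt : u1; exact.
- by near: n; move/cvgrPdist_lt : u2; exact.
- by near: n; move/cvgrPdist_lt : u3; exact.
Unshelve. all: by end_near. Qed.

Lemma qcvg_unique u l l' : qcvg u l -> qcvg u l' -> l = l'.
Proof.
move=> h h'; apply: (can_inj qvecK).
exact: (cvg_unique (@norm_hausdorff _ _) h h').
Qed.

Lemma qcvgD u v l l' : qcvg u l -> qcvg v l' -> qcvg (fun n => u n + v n) (l + l').
Proof.
move=> /qcvgP[u0 u1 u2 u3] /qcvgP[v0 v1 v2 v3]; apply/qcvgP.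
by split; apply: cvgD.
Qed.

Lemma qcvgMl c u l : qcvg u l -> qcvg (fun n => c * u n) (c * l).
Proof.
move=> ul; have cF : CkV 0 setT (fun x : 'rV[R]_4 => qvec (c * vecq x)) by smooth.
have := cvg_comp _ _ ul (cF (qvec l) I); rewrite /= qvecK.
by apply: cvg_trans; apply: near_eq_cvg; apply: nearW => n /=; rewrite qvecK.
Qed.

Lemma qcvgMr c u l : qcvg u l -> qcvg (fun n => u n * c) (l * c).
Proof.
move=> ul; have cF : CkV 0 setT (fun x : 'rV[R]_4 => qvec (vecq x * c)) by smooth.
have := cvg_comp _ _ ul (cF (qvec l) I); rewrite /= qvecK.
by apply: cvg_trans; apply: near_eq_cvg; apply: nearW => n /=; rewrite qvecK.
Qed.

Lemma qcvg_cst l : qcvg (fun=> l) l.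
Proof. exact: cvg_cst. Qed.

Lemma qcvg_near u v l : (\forall n \near \oo, u n = v n) -> qcvg u l -> qcvg v l.
Proof.
move=> uv; apply: cvg_trans; apply: near_eq_cvg.
by apply: filterS uv => n /= ->.
Qed.

Lemma qcvgS u l : qcvg (fun n => u n.+1) l <-> qcvg u l.
Proof. by rewrite /qcvg (cvg_shiftS (fun n => qvec (u n))). Qed.

Lemma qabsM p q : qabs (p * q) = qabs p * qabs q :> R.
Proof. by rewrite /qabs qnorm2M sqrtrM// qnorm2_ge0. Qed.

Lemma qabs_ge0 (q : H) : 0 <= qabs q. Proof. exact: sqrtr_ge0. Qed.

Lemma qabsX (q : H) n : qabs (q ^+ n) = qabs q ^+ n.
Proof.
elim: n => [|n IH]; last by rewrite !exprS qabsM IH.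
by rewrite !expr0; apply/eqP; rewrite qabs_eq1 /qnorm2 /= expr1n expr0n /= !addr0.
Qed.

Lemma qcvg_squeeze0 u (v : nat -> R) : (forall n, qabs (u n) <= v n) -> v @ \oo --> 0 ->
  qcvg u 0.
Proof.
move=> uv v0; have H (f : H -> R) : (forall q, f q ^+ 2 <= qnorm2 q) ->
    (fun n => f (u n)) @ \oo --> 0.
  move=> fq; apply/cvgrPdist_lt => e e0; move/cvgrPdist_lt : v0 => /(_ e e0).
  apply: filterS => n; rewrite !sub0r !normrN => ve.
  apply: le_lt_trans ve; rewrite (le_trans _ (ler_norm _))// (le_trans _ (uv n))//.
  by rewrite -sqrtr_sqr ler_wsqrtr.
have s := @sqr_ge0 R.
by apply/qcvgP; split; apply: H => q; rewrite /qnorm2;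
  have := s (qre q); have := s (qi q); have := s (qj q); have := s (qk q); lra.
Qed.

End QuatLimits.
Arguments qcvg_cst {R} l.
Arguments qcvgMl {R} c {u l}.
Arguments qcvgMr {R} c {u l}.

Section Expansions.
Context {R : realType}.
Local Notation H := (quat R).
Local Notation B := (Bq R).
Implicit Types (f : B -> H) (a b : nat -> H).

Lemma qpartial_sumS a (q : H) n :
  qpartial_sum a q n.+1 = qpartial_sum a q n + q ^+ n * a n.
Proof. exact: big_ord_recr. Qed.

Fact real_point_subproof (t : R) : 0 <= t < 1 -> qabs (qreal t) < 1.
Proof. by move=> /andP[t0 t1]; rewrite /qabs qnorm2_real sqrtr_sqr ger0_norm. Qed.

Lemma qrealX (t : R) n : qreal t ^+ n = qreal (t ^+ n) :> H.
Proof. by elim: n => [|n IH]//; rewrite !exprS IH qrealM. Qed.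

(** At a real point t the expansion splits into four real power series in t,
    one for each coordinate. *)
Lemma has_expansion_unique f a b : has_expansion f a -> has_expansion f b -> a = b.
Proof.
move=> fa fb.
(* The four coordinates are the functions g to which this applies. *)
have comp (g : H -> R) (gD : {morph g : x y / x + y}) (gN : {morph g : x / - x})
    (gr : forall t q, g (qreal t * q) = t * g q)
    (gc : forall u l, qcvg u l -> (fun n => g (u n)) @ \oo --> g l) k :
    g (a k) = g (b k).
  apply/eqP; rewrite -subr_eq0; apply/eqP; move: k.
  apply: power_series_eq0 => t t01.
  pose q : B := exist _ (qreal t) (real_point_subproof t01).
  have ga := gc _ _ (fa q); have gb := gc _ _ (fb q).
  have g0 : g 0 = 0 by have := gD 0 0; rewrite addr0 => /eqP; rewrite -subr_eq subrr eq_sym => /eqP.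
  have E : (fun n => \sum_(k < n) t ^+ k * (g (a k) - g (b k))) =
      (fun n => g (qpartial_sum a (val q) n) - g (qpartial_sum b (val q) n)).
    apply/funext => n; elim: n => [|n IH].
      by rewrite /qpartial_sum !big_ord0 subrr.
    rewrite big_ord_recr /= IH !qpartial_sumS !gD /= !qrealX !gr; ring.
  by rewrite E -[X in _ --> X](subrr (g (f q))); exact: cvgB.
apply/funext => k.
have e0 : qre (a k) = qre (b k).
  apply: comp => // [t q|u l /qcvgP[]//]; rewrite /= ; ring.
have e1 : qi (a k) = qi (b k).
  apply: comp => // [t q|u l /qcvgP[]//]; rewrite /= ; ring.
have e2 : qj (a k) = qj (b k).
  apply: comp => // [t q|u l /qcvgP[]//]; rewrite /= ; ring.
have e3 : qk (a k) = qk (b k).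
  apply: comp => // [t q|u l /qcvgP[]//]; rewrite /= ; ring.
by move: (a k) (b k) e0 e1 e2 e3 => [? ? ? ?] [? ? ? ?] /= -> -> -> ->.
Qed.

Lemma coefsE f a : has_expansion f a -> coefs f = a.
Proof.
move=> fa; rewrite /coefs; case: xgetP => [b _ fb|/(_ a)//].
exact: has_expansion_unique fb fa.
Qed.

Lemma qpower_seriesE f a : has_expansion f a -> qpower_series a = f.
Proof.
move=> fa; apply/funext => q; rewrite /qpower_series.
have -> : limn (fun n => qvec (qpartial_sum a (val q) n)) = qvec (f q).
  by apply: cvg_lim (fa q); exact: norm_hausdorff.
exact: qvecK.
Qed.

Lemma has_expansion_eventually f a N :
  (forall q n, (N <= n)%N -> qpartial_sum a (val q) n = f q) -> has_expansion f a.
Proof.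
move=> H q; apply: (@qcvg_near _ (fun=> f q)); last exact: qcvg_cst.
by exists N => // n /= Nn; rewrite H.
Qed.

Lemma qconj_mulE (q : H) : qconj q * q = qreal (qnorm2 q).
Proof. exact: qconj_mul. Qed.

Lemma qabsN (q : H) : qabs (- q) = qabs q.
Proof. by rewrite /qabs /qnorm2 /= !sqrrN. Qed.

Lemma qabs_conj (q : H) : qabs (qconj q) = qabs q.
Proof. by rewrite /qabs qconj_norm. Qed.

Definition lin_coefs (c d : H) (n : nat) : H :=
  match n with 0%N => d | 1%N => c | _ => 0 end.

Lemma lin_expansion c d : has_expansion (lin c d) (lin_coefs c d).
Proof.
apply: (@has_expansion_eventually _ _ 2) => q n.
case: n => [|[|n]]// _; elim: n => [|n IH].
  by rewrite !qpartial_sumS /qpartial_sum big_ord0 expr0 expr1 mul1r add0r addrC.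
by rewrite qpartial_sumS IH /= mulr0 addr0.
Qed.

Arguments lin_expansion : clear implicits.

Lemma regular_conj_lin c d : regular_conj (lin c d) = lin (qconj c) (qconj d) :> (B -> H).
Proof.
apply: qpower_seriesE; rewrite (coefsE (lin_expansion c d)).
have -> : (fun n => qconj (lin_coefs c d n)) = lin_coefs (qconj c) (qconj d).
  by apply/funext => -[|[|n]]//=; rewrite qconj0.
exact: lin_expansion.
Qed.

(** The symmetrization of q c + d: a polynomial with the real coefficients
    |d|^2, 2 Re (d qconj c) and |c|^2, so that its values commute with q. *)
Definition sym_lin (c d q : H) : H :=
  d * qconj d + q * (d * qconj c + c * qconj d) + q ^+ 2 * (c * qconj c).

Lemma symmetrization_lin c d (q : B) :
  symmetrization (lin c d) q = sym_lin c d (val q).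
Proof.
rewrite /symmetrization /star regular_conj_lin (coefsE (lin_expansion c d)).
rewrite (coefsE (lin_expansion _ _)).
suff h : has_expansion (fun q : B => sym_lin c d (val q))
    (fun n => \sum_(k < n.+1) lin_coefs c d k * lin_coefs (qconj c) (qconj d) (n - k)).
  by rewrite (qpower_seriesE h).
apply: (@has_expansion_eventually _ _ 3) => {}q n.
case: n => [|[|[|n]]]// _; elim: n => [|n IH].
  rewrite !qpartial_sumS /qpartial_sum big_ord0 !big_ord_recl !big_ord0 /=.
  by rewrite /sym_lin !expr0 !expr1 mul1r !add0r !addr0 mulr0 mul0r !add0r !addr0.
rewrite qpartial_sumS IH big1 ?mulr0 ?addr0// => -[k lk] _ /=.
case: k lk => [|[|k]] lk /=; rewrite ?mul0r//.
  by rewrite mulr0.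
by rewrite mulr0.
Qed.

Lemma qmulVf (x : H) : x != 0 -> x^-1 * x = 1.
Proof. by move=> x0; apply: mulVr. Qed.

Lemma qmulfV (x : H) : x != 0 -> x * x^-1 = 1.
Proof. by move=> x0; apply: mulrV. Qed.

(** The solution of d g_0 = 1 and d g_(n+1) + c g_n = 0, which says that the
    *-product of q c + d with the series of coefficients g is 1. *)
Definition recip_coefs (c d : H) (n : nat) : H := (- (d^-1 * c)) ^+ n * d^-1.

Lemma recip_coefsS c d n : d != 0 ->
  d * recip_coefs c d n.+1 = - (c * recip_coefs c d n).
Proof.
move=> d0; rewrite /recip_coefs exprS -!mulrA mulNr mulrN; congr (- _).
by rewrite -!mulrA (mulrA d) qmulfV// mul1r.
Qed.

Lemma sym_lin_comm c d (q : H) n : sym_lin c d q * q ^+ n = q ^+ n * sym_lin c d q.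
Proof.
have comm1 : GRing.comm (sym_lin c d q) q.
  have T : d * qconj c + c * qconj d = qreal (qre (d * qconj c + c * qconj d)).
    by congr Quat => /=; ring.
  rewrite /GRing.comm /sym_lin T !qmul_conj -!/(qreal _) !mulrDl !mulrDr.
  congr (_ + _ + _); first exact: qrealC.
    by rewrite -!mulrA qrealC.
  by rewrite -mulrA qrealC mulrA -exprSr exprS mulrA.
exact: commrX.
Qed.

(** With T = 2 Re (d qconj c), the coefficients satisfy
    |d|^2 g_(k+2) + T g_(k+1) + |c|^2 g_k = 0, so the product telescopes to the
    regular conjugate q c^* + d^* and two boundary terms. *)
Lemma recip_partial_sum c d (q : H) n : d != 0 ->
  sym_lin c d q * qpartial_sum (recip_coefs c d) q n.+1 =
  q * qconj c + qconj d -
  (q ^+ n.+1 * (qreal (qnorm2 d) * recip_coefs c d n.+1)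
   - q ^+ n.+2 * (qreal (qnorm2 c) * recip_coefs c d n)).
Proof.
move=> d0; pose g := recip_coefs c d.
pose T := qconj d * c + qconj c * d.
have sE : sym_lin c d q = qreal (qnorm2 d) + q * T + q ^+ 2 * qreal (qnorm2 c).
  rewrite /sym_lin !qmul_conj; congr (_ + _ * _ + _).
  by congr Quat => /=; ring.
have step k : sym_lin c d q * (q ^+ k * g k) =
    q ^+ k * (qreal (qnorm2 d) * g k) + q ^+ k.+1 * (T * g k)
    + q ^+ k.+2 * (qreal (qnorm2 c) * g k).
  rewrite mulrA sym_lin_comm sE -mulrA; move: (T) (g k) => T' gk.
  rewrite !mulrDl !mulrDr; congr (_ + _ + _).
    by rewrite !mulrA -exprSr.
  by rewrite -(addn2 k) exprD !mulrA.
have gS k : d * g k.+1 = - (c * g k) by exact: recip_coefsS.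
have h1 k : qreal (qnorm2 d) * g k.+1 = - (qconj d * c * g k).
  by rewrite -qconj_mulE -mulrA gS mulrN mulrA.
have h2 k : qconj c * d * g k.+1 = - (qreal (qnorm2 c) * g k).
  by rewrite -mulrA gS mulrN mulrA qconj_mulE.
have hT k : T * g k.+1 = - (qreal (qnorm2 d) * g k.+2) - qreal (qnorm2 c) * g k.
  by rewrite mulrDl h2 h1 opprK.
have g0 : qreal (qnorm2 d) * g 0%N = qconj d.
  by rewrite /g /recip_coefs expr0 mul1r -qconj_mulE -mulrA qmulfV// mulr1.
have hT0 : T * g 0%N = qconj c - qreal (qnorm2 d) * g 1%N.
  rewrite mulrDl h1 opprK addrC; congr (_ + _).
  by rewrite /g /recip_coefs expr0 mul1r -mulrA qmulfV// mulr1.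
elim: n => [|n IH].
  rewrite qpartial_sumS [qpartial_sum _ _ 0]big_ord0 add0r step expr0 mul1r expr1 g0.
  rewrite hT0 mulrBr.
  move: (q * qconj c) (q * (_ * g 1%N)) (_ ^+ 2 * _) (qconj d) => x1 x2 x3 x4.
  by congr Quat => /=; ring.
rewrite qpartial_sumS mulrDr IH step hT mulrBr mulrN.
move: (q ^+ n.+1 * _) (q ^+ n.+2 * _) (q ^+ n.+2 * _) (q ^+ n.+3 * _) => x1 x2 x3 x4.
by congr Quat => /=; ring.
Qed.

Section Reciprocal.
Variables (c d : H) (cd : qnorm2 c < qnorm2 d).

Let d0 : d != 0.
Proof. by rewrite -qnorm2_eq0; apply/lt0r_neq0/(le_lt_trans (qnorm2_ge0 c)). Qed.

Let dabs : qabs d^-1 * qabs d = 1.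
Proof.
by rewrite -qabsM qmulVf//; apply/eqP; rewrite qabs_eq1 /qnorm2 /= expr1n expr0n /= !addr0.
Qed.

Let cd' : qabs c < qabs d.
Proof. by rewrite ltr_sqrt// (le_lt_trans (qnorm2_ge0 c)). Qed.

Lemma recip_coefs_bound n : qabs (recip_coefs c d n) <= qabs d^-1.
Proof.
rewrite qabsM qabsX ler_piMl ?qabs_ge0// exprn_ile1 ?qabs_ge0//.
by rewrite qabsN qabsM -dabs ler_wpM2l ?qabs_ge0// ltW.
Qed.

Lemma remainder_cvg0 (q x : H) m : qabs q < 1 ->
  qcvg (fun n => q ^+ (n + m) * (x * recip_coefs c d n)) 0.
Proof.
move=> q1; apply: (@qcvg_squeeze0 _ _ (fun n => qabs q ^+ m * (qabs x * qabs d^-1) * qabs q ^+ n)).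
  move=> n; rewrite qabsM (qabsM x) qabsX exprD [leRHS]mulrC [leRHS]mulrA ler_wpM2l//.
    by rewrite mulr_ge0// exprn_ge0// qabs_ge0.
  by rewrite ler_wpM2l ?qabs_ge0//; exact: recip_coefs_bound.
rewrite -(mulr0 (qabs q ^+ m * (qabs x * qabs d^-1))).
apply: cvgM; first exact: cvg_cst.
by apply: cvg_expr; rewrite ger0_norm ?qabs_ge0.
Qed.

Lemma recip_cvg (q : H) : qabs q < 1 ->
  qcvg (fun n => sym_lin c d q * qpartial_sum (recip_coefs c d) q n)
    (q * qconj c + qconj d).
Proof.
move=> q1; apply/qcvgS.
have h1 : qcvg (fun n => q ^+ n.+1 * (qreal (qnorm2 d) * recip_coefs c d n.+1)) 0.
  apply/(qcvgS (fun n => q ^+ n * (qreal (qnorm2 d) * recip_coefs c d n))).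
  have := @remainder_cvg0 q (qreal (qnorm2 d)) 0 q1.
  by apply: qcvg_near; apply: nearW => n; rewrite addn0.
have h2 : qcvg (fun n => q ^+ n.+2 * (qreal (qnorm2 c) * recip_coefs c d n)) 0.
  have := @remainder_cvg0 q (qreal (qnorm2 c)) 2 q1.
  by apply: qcvg_near; apply: nearW => n; rewrite addn2.
have := qcvgD (qcvg_cst (q * qconj c + qconj d)) (qcvgD (qcvgMl (-1) h1) h2).
rewrite mulr0 !addr0; apply: qcvg_near; apply: nearW => n.
by rewrite recip_partial_sum// opprB mulN1r [- _ + _]addrC.
Qed.

(** If the symmetrization vanished at q, then so would the limit
    q c^* + d^* of its products with the partial sums, although |q c| < |d|. *)
Lemma sym_lin_neq0 (q : H) : qabs q < 1 -> sym_lin c d q != 0.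
Proof.
move=> q1; apply/eqP => s0; have := recip_cvg q1; rewrite s0.
have E : (fun n => 0 * qpartial_sum (recip_coefs c d) q n) = fun=> 0.
  by apply/funext => n; rewrite mul0r.
rewrite E => /qcvg_unique/(_ (qcvg_cst 0)) h.
have := congr1 (@qabs R) (addr0_eq h).
rewrite qabsN qabsM !qabs_conj => h'.
have : qabs q * qabs c <= qabs c by rewrite ler_piMl ?qabs_ge0// ltW.
by rewrite h' leNgt cd'.
Qed.

Lemma star_recip_expansion :
  has_expansion (star_recip (lin c d)) (recip_coefs c d).
Proof.
move=> q; have q1 := valP q; rewrite /star_recip symmetrization_lin regular_conj_lin.
have := qcvgMl (sym_lin c d (val q))^-1 (recip_cvg q1).
apply: qcvg_near; apply: nearW => n.
by rewrite mulrA qmulVf ?mul1r//; exact: sym_lin_neq0.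
Qed.

Definition quot_coefs (a b : H) (n : nat) : H :=
  recip_coefs c d n * b + (if n is m.+1 then recip_coefs c d m * a else 0).

(** Multiplying a series g by q a + b on the right in the *-sense gives
    g(q) b + q g(q) a, because q is on the left of the coefficients. *)
Lemma star_expansion (a b : H) :
  has_expansion (star (star_recip (lin c d)) (lin a b)) (quot_coefs a b).
Proof.
have E : (fun n => \sum_(k < n.+1) recip_coefs c d k * lin_coefs a b (n - k)) =
    quot_coefs a b.
  apply/funext => n; rewrite big_ord_recr /= subnn /quot_coefs addrC; congr (_ + _).
  case: n => [|n]; first by rewrite big_ord0.
  rewrite big_ord_recr /= subSnn big1 ?add0r// => -[k lk] _ /=.
  by rewrite subSn; [case: (n - k)%N (subn_gt0 k n) => [|m] /=; rewrite ?lk ?mulr0|exact: ltnW].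
suff h : has_expansion (fun q : B => star_recip (lin c d) q * b +
    val q * (star_recip (lin c d) q * a)) (quot_coefs a b).
  rewrite /star (coefsE star_recip_expansion) (coefsE (lin_expansion a b)) E.
  by rewrite (qpower_seriesE h).
move=> q; have L := @star_recip_expansion q.
apply/qcvgS; have := qcvgD (qcvgMr b (proj2 (qcvgS _ _) L)) (qcvgMl (val q) (qcvgMr a L)).
apply: qcvg_near; apply: nearW => n; elim: n => [|n IH].
  rewrite !qpartial_sumS /qpartial_sum !big_ord0 !add0r /quot_coefs.
  by rewrite mul0r mulr0 !addr0 !expr0 !mul1r.
rewrite [RHS]qpartial_sumS -IH (qpartial_sumS _ _ n.+1).
rewrite [X in _ + val q * (X * a)]qpartial_sumS /quot_coefs.
by rewrite !mulrDl !mulrDr !mulrA -exprS addrACA.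
Qed.

End Reciprocal.

Lemma qnorm2_sp11_01_lt (A : Sp11 R) : qnorm2 (sp11_val A 0 1) < qnorm2 (sp11_val A 1 1).
Proof.
have h := qnorm2_sp11_11 A; have h0 := qnorm2_sp11_00 A.
have := congr1 (@qnorm2 R) (sp11_orthogonal A); rewrite !qnorm2M !qconj_norm.
move: (qnorm2_ge0 (sp11_val A 1 0)) (qnorm2_ge0 (sp11_val A 0 1)) h h0.
move: (qnorm2 _) (qnorm2 _) (qnorm2 _) (qnorm2 _) => x y z t; nra.
Qed.

Lemma moebius_expansion (A : Sp11 R) : has_expansion (moebius A)
  (quot_coefs (sp11_val A 0 1) (sp11_val A 1 1) (sp11_val A 0 0) (sp11_val A 1 0)).
Proof. exact/star_expansion/qnorm2_sp11_01_lt. Qed.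

Lemma qnorm2_neq0 (q : H) : (qnorm2 q != 0) = (q != 0).
Proof. by rewrite qnorm2_eq0. Qed.

Lemma sp1_neq0 (u : Sp1 R) : (u : H) != 0.
Proof. by rewrite -qnorm2_neq0 qnorm2_sp1 oner_neq0. Qed.

Lemma sp11_11_neq0 (A : Sp11 R) : sp11_val A 1 1 != 0.
Proof.
rewrite -qnorm2_neq0 qnorm2_sp11_11; apply: lt0r_neq0.
by rewrite ltr_wpDr// qnorm2_ge0.
Qed.

Lemma qnorm2V (q : H) : q != 0 -> qnorm2 q^-1 * qnorm2 q = 1.
Proof.
by move=> q0; rewrite -qnorm2M qmulVf// /qnorm2 /= expr1n expr0n /= !addr0.
Qed.

Lemma qinvM (u x : H) : u != 0 -> x != 0 -> (u * x)^-1 = x^-1 * u^-1.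
Proof. by move=> u0 x0; rewrite invrM. Qed.

Lemma recip_coefsM (u c d : H) n : u != 0 -> d != 0 ->
  recip_coefs (u * c) (u * d) n = recip_coefs c d n * u^-1.
Proof.
move=> u0 d0; rewrite /recip_coefs qinvM// -mulrA (mulrA u^-1) qmulVf// mul1r.
by rewrite mulrA.
Qed.

Lemma quot_coefsM (u c d a b : H) n : u != 0 -> d != 0 ->
  quot_coefs (u * c) (u * d) (u * a) (u * b) n = quot_coefs c d a b n.
Proof.
move=> u0 d0; have E k (x : H) : recip_coefs (u * c) (u * d) k * (u * x) =
    recip_coefs c d k * x.
  by rewrite recip_coefsM// -mulrA (mulrA u^-1) qmulVf// mul1r.
by rewrite /quot_coefs E; case: n => // n; rewrite E.
Qed.

Lemma sp1_scalarE (u : Sp1 R) (A : Sp11 R) i j :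
  sp11_val (sp1_scalar u * A)%g i j = (u : H) * sp11_val A i j.
Proof. by rewrite /= mul_scalar_mx mxE. Qed.

Lemma moebius_scalar (A : Sp11 R) (u : Sp1 R) : moebius (sp1_scalar u * A)%g = moebius A.
Proof.
have h := @moebius_expansion (sp1_scalar u * A)%g.
rewrite !sp1_scalarE in h; have h' := @moebius_expansion A.
have E : quot_coefs (sp11_val A 0 1) (sp11_val A 1 1) (sp11_val A 0 0) (sp11_val A 1 0) =
    quot_coefs ((u : H) * sp11_val A 0 1) ((u : H) * sp11_val A 1 1)
      ((u : H) * sp11_val A 0 0) ((u : H) * sp11_val A 1 0).
  apply/funext => n; rewrite quot_coefsM//; [exact: sp1_neq0|exact: sp11_11_neq0].
by rewrite -(qpower_seriesE h) -E (qpower_seriesE h').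
Qed.

Lemma quot_coefs0 (c d a b : H) : quot_coefs c d a b 0 = d^-1 * b.
Proof. by rewrite /quot_coefs /recip_coefs expr0 mul1r addr0. Qed.

Lemma quot_coefs1 (c d a b : H) :
  quot_coefs c d a b 1 = d^-1 * a - d^-1 * c * (d^-1 * b).
Proof.
by rewrite /quot_coefs /recip_coefs expr1 expr0 mul1r addrC !mulNr -!mulrA.
Qed.

Lemma quot_coefs2 (c d a b : H) :
  quot_coefs c d a b 2 = - (d^-1 * c) * quot_coefs c d a b 1.
Proof. by rewrite /quot_coefs /recip_coefs mulrDr !exprS expr0 !mulr1 mul1r !mulrA. Qed.

Lemma quot_coefs1_neq0 (c d a b : H) : d != 0 -> qnorm2 c < qnorm2 d ->
  qnorm2 b < qnorm2 a -> quot_coefs c d a b 1 != 0.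
Proof.
move=> d0 cd ba; rewrite quot_coefs1; apply/eqP => /subr0_eq.
move=> /(congr1 (fun x => d * x)).
rewrite -(mulrA d^-1) !(mulrA d) qmulfV// !mul1r => /(congr1 (@qnorm2 R)).
rewrite !qnorm2M => h; have dd := qnorm2V d0.
have cd1 : qnorm2 c * qnorm2 d^-1 <= 1.
  by rewrite -dd mulrC ler_wpM2l ?qnorm2_ge0// ltW.
move: ba; rewrite h mulrA ltNge ler_piMl// qnorm2_ge0//.
Qed.

(** The coefficients p_0 = d^-1 b, p_1 = d^-1 a - d^-1 c p_0 and
    p_2 = - d^-1 c p_1 determine in turn d^-1 b, then d^-1 c because p_1 is not
    0, then d^-1 a. *)
Lemma quot_coefs_inj (c d a b c' d' a' b' : H) : d != 0 -> d' != 0 ->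
  quot_coefs c d a b 1 != 0 -> quot_coefs c d a b = quot_coefs c' d' a' b' ->
  [/\ a' = d' * d^-1 * a, b' = d' * d^-1 * b & c' = d' * d^-1 * c].
Proof.
move=> d0 d0' p10 hE.
have p0 := congr1 (fun p => p 0%N) hE; have p1 := congr1 (fun p => p 1%N) hE.
have p2 := congr1 (fun p => p 2%N) hE.
rewrite !quot_coefs0 in p0; rewrite !quot_coefs2 -p1 in p2.
have hc : d^-1 * c = d'^-1 * c'.
  by apply: oppr_inj; apply: (mulIr (x := quot_coefs c d a b 1)); [exact: p10|exact: p2].
have ha : d^-1 * a = d'^-1 * a'.
  by move: p1; rewrite !quot_coefs1 p0 hc; exact: addIr.
by split; rewrite -mulrA ?ha ?p0 ?hc mulrA qmulfV// mul1r.
Qed.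

Lemma qdivK (x d : H) : d != 0 -> x * d^-1 * d = x.
Proof. by move=> d0; rewrite -mulrA qmulVf// mulr1. Qed.

Lemma moebius_inj (A A' : Sp11 R) : moebius A = moebius A' ->
  exists u : Sp1 R, A' = (sp1_scalar u * A)%g.
Proof.
move=> AA'; have hA := @moebius_expansion A; have hA' := @moebius_expansion A'.
rewrite -AA' in hA'; have hE := has_expansion_unique hA hA'.
have p10 : quot_coefs (sp11_val A 0 1) (sp11_val A 1 1) (sp11_val A 0 0) (sp11_val A 1 0) 1 != 0.
  apply: quot_coefs1_neq0; [exact: sp11_11_neq0|exact: qnorm2_sp11_01_lt|].
  by rewrite qnorm2_sp11_00 ltrDr ltr01.
have [ha hb hc] := quot_coefs_inj (sp11_11_neq0 A) (sp11_11_neq0 A') p10 hE.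
(* For u = d' d^-1, both |d'|^2 = |u|^2 |d|^2 and |d'|^2 - 1 = |u|^2 (|d|^2 - 1)
   hold, the second because b' = u b. *)
have uU : qabs (sp11_val A' 1 1 * (sp11_val A 1 1)^-1) == 1.
  rewrite qabs_eq1; have := congr1 (@qnorm2 R) hb; rewrite qnorm2M => hb'.
  have := qnorm2V (sp11_11_neq0 A); have := qnorm2_sp11_11 A; have := qnorm2_sp11_11 A'.
  move: hb'; rewrite qnorm2M.
  move: (qnorm2 _) (qnorm2 _) (qnorm2 _) (qnorm2 _) (qnorm2 _) => x1 x2 x3 x4 x5.
  move=> h1 h2 h3 h4; apply/eqP/(@addIr _ x5); rewrite -[RHS]h2 {1}h1.
  by rewrite -[X in X + _]mulr1 -mulrDr -h3 -mulrA h4 mulr1.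
have E := sp1_scalarE (MkSp1 uU) A.
exists (MkSp1 uU); apply: val_inj; apply: qmx2P.
- exact: etrans ha (esym (E 0 0)).
- exact: etrans hc (esym (E 0 1)).
- exact: etrans hb (esym (E 1 0)).
- exact: etrans (esym (qdivK _ (sp11_11_neq0 A))) (esym (E 1 1)).
Qed.

Lemma sp1_scalarM (u w : Sp1 R) : sp1_scalar (u * w)%g = (sp1_scalar u * sp1_scalar w)%g.
Proof. by apply: val_inj; rewrite /= -scalar_mxM. Qed.

Lemma sp1_scalar1 : sp1_scalar 1%g = 1%g :> Sp11 R.
Proof. exact: val_inj. Qed.

Lemma moebius_inv_fiber (A A' : Sp11 R) :
  moebius_inv A = moebius_inv A' <-> exists u, A' = sp11_act A u.
Proof.
split=> [/(congr1 (fun z => sval z)) /= /moebius_inj[u uE]|[u ->]].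
  exists u^-1%g; rewrite /sp11_act -[LHS]invgK uE invgM invgK; congr (_ * _)%g.
  apply: (mulIg (sp1_scalar u)); rewrite mulVg -sp1_scalarM mulVg.
  by rewrite sp1_scalar1.
apply: eq_exist; rewrite /sp11_act invgM.
have -> : (sp1_scalar u)^-1%g = sp1_scalar u^-1%g :> Sp11 R.
  by apply: (mulIg (sp1_scalar u)); rewrite mulVg -sp1_scalarM mulVg sp1_scalar1.
by rewrite moebius_scalar.
Qed.

End Expansions.

(** * Smooth bijections *)
Section Composition.
Context {R : realType} {N n N' n' p : nat} {T U V : choiceType}.
Variables (A : atlas R n T) (e : T -> 'rV[R]_N).
Variables (B : atlas R n' U) (e' : U -> 'rV[R]_N') (C : atlas R p V).
Hypotheses (eA : embedded A e) (eB : embedded B e') (sC : smooth_atlas C).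

Lemma smooth_map_comp (f : T -> U) (g : U -> V) :
  ext_smooth e setT (e' \o f) -> smooth_map B C g -> smooth_map A C (g \o f).
Proof.
move=> sf sg; have [_ As _] := eA; split=> [x _|c d Ac Cd].
  have cf := ext_smooth_continuous eA eB sf.
  have [cg _] := sg.
  by apply: (@continuous_comp (mfd A) (mfd B) (mfd C)); [exact: cf|exact: cg].
have og := smooth_map_open eB sC sg Cd; rewrite setIT.
exact: (proj2 (chart_ext_smooth (As _ Ac) (ext_smooth_preimage sf og)
  (ext_smooth_pullback sf (smooth_map_ext eB sC sg Cd)))).
Qed.

(** By the chain rule applied to f = g o r, the image of the differential of
    g contains the image of the one of f. *)
Lemma surj_differential_factor (r : T -> U) (g : U -> V) (f : T -> V) x :
  ext_smooth e setT (e' \o r) -> smooth_map B C g -> f = g \o r ->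
  surj_differential A C f x -> surj_differential B C g (r x).
Proof.
move=> sr [_ sg] -> fsurj c d Bc Cd cx dx w.
have [_ As Acov] := eA; have [_ Bs _] := eB.
have [b Ab bx] := Acov x; have bs := As _ Ab; have [[_ bK] _ _ _] := bs.
have [v vw] := fsurj b d Ab Cd bx dx w.
have [[_ cK] [P oP PE] _ _] := Bs _ Bc.
have oc : ext_open e (r @^-1` cdom c).
  by apply: (ext_smooth_preimage sr); exists P.
have [oW _] := chart_ext_smooth bs oc (@ext_smooth_id _ _ _ e _).
have [_ /(_ b c Ab Bc)] := ext_smooth_map eA eB sr; rewrite setIT => Cr.
have := sg c d Bc Cd; rewrite setIT => Cg.
set W := cto b @` _ in oW Cr.
set F := cto d \o g \o cfrom c in Cg *.
set G : 'rV[R]_n -> 'rV[R]_n' := cto c \o r \o cfrom b in Cr.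
set h := _ \o cfrom b in vw.
have Wx : W (cto b x) by exists x.
have Gx : G (cto b x) = cto c (r x) by rewrite /G /= bK.
have dG := Cinfty_differentiable Cr Wx.
have dF : differentiable F (G (cto b x)).
  by rewrite Gx; apply: (Cinfty_differentiable Cg); exists (r x).
have E : {in W, F \o G =1 h}.
  by move=> z; rewrite inE => -[y [dy gy] <-]; rewrite /F /G /h /= bK// cK.
have dFG := differentiable_comp dG dF.
exists ('d G (cto b x) v); rewrite -vw -Gx.
have := diff_comp dG dF => /(congr1 (fun h => h v)) /= <-.
exact: near_eq_diff (open_eq_near oW E Wx) dFG.
Qed.

End Composition.

Section InverseMap.
Context {R : realType} {N n : nat} {T U : choiceType}.
Variables (A : atlas R n T) (e : T -> 'rV[R]_N) (B : atlas R n U).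

(** The inverse function theorem in charts, for manifolds of the same
    dimension n. *)
Lemma smooth_map_inverse (f : T -> U) (g : U -> T) :
  embedded A e -> smooth_atlas B -> smooth_map A B f ->
  (forall x, surj_differential A B f x) -> cancel f g -> cancel g f ->
  smooth_map B A g.
Proof.
move=> eA sB sf dsf fK gK; have [_ As Ac] := eA; have [Bc Bcov BC] := sB.
have [cf Cf] := sf.
(* The parameter S gives the openness of the images as well, that is the
   continuity of g. *)
have key c d (S : set T) : A c -> B d -> ext_open e S ->
    open (cto d @` (cdom d `&` g @^-1` (cdom c `&` S))) /\
    Cinfty (cto d @` (cdom d `&` g @^-1` (cdom c `&` S))) (cto c \o g \o cfrom d).
  move=> Ac' Bd oS; have cs := As _ Ac'; have [[_ cK] _ _ _] := cs.
  have [_ dK] := Bc d Bd.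
  have oW := ext_openI (smooth_map_open eA sB sf Bd) oS.
  have [oD _] := chart_ext_smooth cs oW (@ext_smooth_id _ _ _ e _).
  have := Cf c d Ac' Bd; rewrite setIT => Cfd.
  pose F : 'rV[R]_n -> 'rV[R]_n := cto d \o f \o cfrom c.
  have imE : F @` (cto c @` (cdom c `&` (f @^-1` cdom d `&` S))) =
      cto d @` (cdom d `&` g @^-1` (cdom c `&` S)).
    apply/seteqP; split=> [_ [_ [x [cx [dx Sx]] <-] <-]|_ [y [dy [cy Sy]] <-]].
      by exists (f x); [rewrite /= fK|rewrite /F /= cK].
    exists (cto c (g y)); last by rewrite /F /= cK// gK.
    by exists (g y) => //; split=> //; split=> //=; rewrite gK.
  rewrite -imE; apply: inverse_Cinfty => //.
  - by apply: Cinfty_sub Cfd => _ [x [cx [dx _]] <-]; exists x.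
  - by move=> _ [x [cx [dx _]] <-] w; exact: dsf.
  - by move=> _ [x [cx [dx _]] <-]; rewrite /F /= cK// dK// fK.
split=> [y _|d c Bd Ac']; last first.
  have [_] := key c d setT Ac' Bd (ext_openT e).
  by rewrite !setIT.
suff : continuous (g : mfd B -> mfd A) by exact.
apply/continuousP => S /(embedded_open eA) oS; rewrite openE => z Sz.
have [d Bd dz] := Bcov z; have [c Ac' cz] := Ac (g z).
have [oV _] := key c d S Ac' Bd oS; have [_ dK] := Bc d Bd.
set V := cto d @` _ in oV.
have oB : @open (mfd B) (cdom d `&` cto d @^-1` V).
  by apply: chart_open_open; exists d, V.
have : @nbhs _ (mfd B) z (cdom d `&` cto d @^-1` V).
  by apply: open_nbhs_nbhs; split=> //; split=> //; exists z.
apply: filterS => u [du [u' [du' [_ Su']] uu']].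
by rewrite /= -(dK u du) -uu' dK.
Qed.

End InverseMap.

Section ProductMaps.
Context {R : realType} {N N' : nat} {T U : Type}.
Variables (e : T -> 'rV[R]_N) (e' : U -> 'rV[R]_N').

Lemma ext_smooth_fst p (h : T -> 'rV[R]_p) : ext_smooth e setT h ->
  ext_smooth (fun z : T * U => row_mx (e z.1) (e' z.2)) setT (fun z => h z.1).
Proof.
have sf : ext_smooth (fun z : T * U => row_mx (e z.1) (e' z.2)) setT (e \o fst).
  apply: (ext_smooth_global (F := lsubmx)) => [k|z]; first exact: CkV_lsubmx.
  by rewrite row_mxKl.
exact: (ext_smooth_pullback sf).
Qed.

Lemma ext_smooth_snd p (h : U -> 'rV[R]_p) : ext_smooth e' setT h ->
  ext_smooth (fun z : T * U => row_mx (e z.1) (e' z.2)) setT (fun z => h z.2).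
Proof.
have sf : ext_smooth (fun z : T * U => row_mx (e z.1) (e' z.2)) setT (e' \o snd).
  apply: (ext_smooth_global (F := rsubmx)) => [k|z]; first exact: CkV_rsubmx.
  by rewrite row_mxKr.
exact: (ext_smooth_pullback sf).
Qed.

End ProductMaps.

(** * Fibrations of Sp(1,1) whose fibers are the orbits *)

(** The coset projection and the map A |-> F_{A^-1} are treated at once: both
    are surjections pi whose fibers are the orbits of Sp(1). *)
Section Fibration.
Context {R : realType} {U : choiceType}.
Variable pi : Sp11 R -> U.
Hypotheses (pi_surj : forall y, exists A, pi A = y)
  (pi_fiber : forall A A', pi A = pi A' <-> exists u, A' = sp11_act A u).

Definition base_coords (y : U) : base_model := coords (sval (cid (pi_surj y))).

Lemma base_coords_pi A : base_coords (pi A) = coords A.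
Proof.
rewrite /base_coords; case: cid => A' /= /esym/pi_fiber[u ->].
exact: coords_act.
Qed.

Lemma pi_act A u : pi (sp11_act A u) = pi A.
Proof. by apply/esym/pi_fiber; exists u. Qed.

Lemma pi_slice_coords A : pi (base_slice (coords A)) = pi A.
Proof. by rewrite -[in RHS](frame_coords A) /frame pi_act. Qed.

Lemma base_coordsK : cancel base_coords (pi \o @base_slice R).
Proof. by move=> y; have [A <-] := pi_surj y; rewrite base_coords_pi /= pi_slice_coords. Qed.

Lemma pi_sliceK : cancel (pi \o @base_slice R) base_coords.
Proof. by move=> t; rewrite /= base_coords_pi coords_slice. Qed.

Definition base_vec : U -> 'rV[R]_(4 + 4) := @model_vec R \o base_coords.

Lemma base_vec_inj : injective base_vec.
Proof.
by apply: inj_comp; [have [] := @model_embedded R|exact: can_inj base_coordsK].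
Qed.

Lemma base_vec_pi : base_vec \o pi = @model_vec R \o @coords R.
Proof. by apply/funext => A; rewrite /base_vec /= base_coords_pi. Qed.

Lemma base_embedded :
  embedded (submanifold_atlas base_vec : atlas R 7 U) base_vec.
Proof.
apply: (ext_transport (@model_embedded R) base_vec_inj (g := base_coords)
  (f := pi \o @base_slice R)).
- have -> : base_vec \o (pi \o @base_slice R) = @model_vec R.
    by apply/funext => t; rewrite /base_vec -[LHS]/(model_vec (base_coords _)) pi_sliceK.
  exact: ext_smooth_id.
- exact: ext_smooth_id.
- exact: pi_sliceK.
- exact: base_coordsK.
Qed.

Section Base.
Variables (B : atlas R 7 U).

(** The inverse [base_coords] of t |-> pi (base_slice t) is smooth for B:
    this bijection is smooth, its differentials are surjective because pi
    factors through it, and both sides have dimension 7. *)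
Lemma fibration_embedded : smooth_atlas B -> submersion (sp11_atlas R) B pi ->
  embedded B base_vec.
Proof.
move=> sB [spi _ dpi].
have s7 : ext_smooth (@model_vec R) setT (@sp11_vec R \o @base_slice R).
  have sf : ext_smooth (@model_vec R) setT
      (prod_emb (@model_vec R) (@sp1_vec R) \o (fun t => (t, 1%g))).
    apply: ext_smooth_row; first exact: ext_smooth_id.
    apply: (ext_smooth_global (F := fun=> sp1_vec 1%g)) => // k.
    exact: CkV_cst.
  have := ext_smooth_pullback sf (@frame_smooth R).
  apply: ext_smooth_eq => t _; congr sp11_vec.
  exact: sp11_act1.
have sphi : smooth_map (@model_atlas R) B (pi \o @base_slice R).
  exact: (smooth_map_comp (@model_embedded R) (@sp11_embedded R) sB s7 spi).
have dphi t : surj_differential (@model_atlas R) B (pi \o @base_slice R) t.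
  have := @surj_differential_factor _ _ _ _ _ _ _ _ _ _ _ _ _ _
    (@sp11_embedded R) (@model_embedded R) (@coords R) _ pi (base_slice t)
    (@coords_smooth R) sphi.
  rewrite coords_slice; apply; last exact: dpi.
  by apply/funext => A; rewrite /= pi_slice_coords.
have sinv := smooth_map_inverse (@model_embedded R) sB sphi dphi pi_sliceK base_coordsK.
exact: (embedded_transport (@model_embedded R) sB sphi sinv pi_sliceK base_coordsK).
Qed.

Hypothesis eB : embedded B base_vec.

Lemma triv_smooth : ext_smooth (prod_emb base_vec (@sp1_vec R)) setT
  (@sp11_vec R \o (fun z : U * Sp1 R => frame (base_coords z.1, z.2))).
Proof.
have sf : ext_smooth (prod_emb base_vec (@sp1_vec R)) setT
    (prod_emb (@model_vec R) (@sp1_vec R) \o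
      (fun z : U * Sp1 R => (base_coords z.1, z.2))).
  exact: ext_smooth_id.
exact: (ext_smooth_pullback sf (@frame_smooth R)).
Qed.

Lemma pi_ext_smooth : ext_smooth (@sp11_vec R) setT (base_vec \o pi).
Proof. rewrite base_vec_pi; exact: coords_smooth. Qed.

(** Through any A passes the global smooth section with constant phase. *)
Lemma pi_submersion : submersion (sp11_atlas R) B pi.
Proof.
split; [exact: ext_smooth_map (@sp11_embedded R) eB pi_ext_smooth|exact: pi_surj|].
move=> A; pose s y := frame (base_coords y, phase A).
apply: (@section_surj_differential _ _ _ _ _ _ _ _ _ _ _ _ s) (@sp11_embedded R) eB _ _ _ _.
- exact: ext_smooth_map (@sp11_embedded R) eB pi_ext_smooth.
- apply: (ext_smooth_map eB (@sp11_embedded R)).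
  have sf : ext_smooth base_vec setT
      (prod_emb base_vec (@sp1_vec R) \o (fun y => (y, phase A))).
    apply: ext_smooth_row; first exact: ext_smooth_id.
    apply: (ext_smooth_global (F := fun=> sp1_vec (phase A))) => // k.
    exact: CkV_cst.
  exact: (ext_smooth_pullback sf triv_smooth).
- move=> y; rewrite /s /frame pi_act; exact: base_coordsK.
- by rewrite /s base_coords_pi frame_coords.
Qed.

(** The map (A, u) |-> (A, A u) is proper because it has the continuous left
    inverse (A, B) |-> (A, (phase A)^-1 (phase B)), and the trivialization is
    defined over the whole base. *)
Lemma pi_bundle : principal_bundle (sp11_atlas R) B (sp1_atlas R) (@sp11_act R) pi.
Proof.
have eP := @sp11_embedded R; have eG := @sp1_embedded R.
have ePG := embedded_prod eP eG; have ePP := embedded_prod eP eP.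
have eBG := embedded_prod eB eG.
split.
- exact: embedded_manifold eP.
- exact: embedded_manifold eB.
- exact: sp1_lie.
- exact: pi_submersion.
- exact: sp11_act1.
- exact: sp11_actM.
- exact: ext_smooth_map ePG eP (@act_smooth R).
- move=> A u /(congr1 (@phase R)); rewrite phase_act => h.
  by apply: (mulgI (phase A)); rewrite h mulg1.
- apply: (@proper_left_inverse (mfd (prod_atlas (sp11_atlas R) (sp1_atlas R)))
    (mfd (prod_atlas (sp11_atlas R) (sp11_atlas R))) _
    (fun z : Sp11 R * Sp11 R => (z.1, ((phase z.1)^-1 * phase z.2)%g))).
  + exact: embedded_hausdorff ePP.
  + apply: (ext_smooth_continuous ePG ePP); apply: ext_smooth_row.
      exact: (ext_smooth_fst (@sp1_vec R) (@ext_smooth_id _ _ _ (@sp11_vec R) setT)).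
    exact: act_smooth.
  + apply: (ext_smooth_continuous ePP ePG); apply: ext_smooth_row.
      exact: (ext_smooth_fst (@sp11_vec R) (@ext_smooth_id _ _ _ (@sp11_vec R) _)).
    have sf : ext_smooth (prod_emb (@sp11_vec R) (@sp11_vec R)) setT
        (prod_emb (@sp1_vec R) (@sp1_vec R) \o
         (fun z : Sp11 R * Sp11 R => (phase z.1, phase z.2))).
      apply: ext_smooth_row.
        exact: (ext_smooth_fst (@sp11_vec R) (@phase_smooth R)).
      exact: (ext_smooth_snd (@sp11_vec R) (@phase_smooth R)).
    have sd : ext_smooth (prod_emb (@sp1_vec R) (@sp1_vec R)) setT
        (@sp1_vec R \o (fun z : Sp1 R * Sp1 R => (z.1^-1 * z.2)%g)).
      apply: (ext_smooth_global
        (F := fun x => qvec (qconj (vecq (lsubmx x)) * vecq (rsubmx x)))) => [k|[u v]].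
        by smooth.
      by rewrite /prod_emb /sp1_vec /= row_mxKl row_mxKr !qvecK.
    exact: (ext_smooth_pullback sf sd).
  + by move=> [A u] /=; rewrite phase_act mulgA mulVg mul1g.
- move=> A; apply/seteqP; split=> [_ [u _ <-]|A' /= /esym/pi_fiber[u ->]].
    exact: pi_act.
  by exists u.
- move=> y; exists setT, (fun z => frame (base_coords z.1, z.2)); split => //.
  + exact: openT.
  + rewrite setXTT preimage_setT.
    exists (fun A => (pi A, phase A)); split.
    * move=> [z u] _; split=> //=; rewrite phase_frame /= /frame pi_act.
      by congr (_, _); exact: base_coordsK.
    * by move=> A _; split=> //=; rewrite base_coords_pi frame_coords.
    * exact: ext_smooth_map eBG eP triv_smooth.
    * apply: (ext_smooth_map eP eBG).
      exact: ext_smooth_row pi_ext_smooth (@phase_smooth R).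
  + by move=> z h k _; rewrite /frame /= sp11_actM.
  + by move=> z h _; rewrite /frame pi_act; exact: base_coordsK.
Qed.

End Base.
End Fibration.

(** * The coset space and the Moebius transformations *)
Section Fibers.
Context {R : realType}.

Lemma quot_map_surj (q : Sp11_quot R) : exists A, quot_map A = q.
Proof.
case: q => S hS; have [A _ AE] := set_mem hS.
by exists A; exact: eq_exist.
Qed.

Lemma lcoset_act (A : Sp11 R) u : lcoset_Sp1I2 (sp11_act A u) = lcoset_Sp1I2 A.
Proof.
apply/seteqP; split=> _ [_ [w _ <-] <-].
  by exists (sp1_scalar (u * w)%g); [exists (u * w)%g|rewrite sp1_scalarM mulgA].
exists (sp1_scalar (u^-1 * w)%g); first by exists (u^-1 * w)%g.
by rewrite -mulgA -sp1_scalarM mulgA mulgV mul1g.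
Qed.

Lemma quot_map_fiber (A A' : Sp11 R) :
  quot_map A = quot_map A' <-> exists u, A' = sp11_act A u.
Proof.
split=> [/(congr1 (fun z => sval z)) /= E|[u ->]]; last first.
  by apply: eq_exist; rewrite lcoset_act.
have : lcoset_Sp1I2 A' A'.
  by exists 1%g; [exists 1%g; rewrite ?sp1_scalar1|rewrite mulg1].
by rewrite -E => -[_ [u _ <-] <-]; exists u.
Qed.

Lemma moebius_inv_surj (m : MB R) : exists A, moebius_inv A = m.
Proof.
case: m => f hf; have [A _ AE] := set_mem hf.
by exists A^-1%g; apply: eq_exist; rewrite invgK.
Qed.

End Fibers.

Theorem corollary4p1p2 (R : realType) :
  (exists (AQ : atlas R 7 (Sp11_quot R)) (AM : atlas R 7 (MB R)),
     moebius_structure AQ AM) /\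
  (forall (AQ : atlas R 7 (Sp11_quot R)) (AM : atlas R 7 (MB R)),
     moebius_structure AQ AM ->
     principal_bundle (sp11_atlas R) AM (sp1_atlas R)
       (@sp11_act R) (@moebius_inv R)).
Proof.
pose vQ := base_vec (@quot_map_surj R); pose vM := base_vec (@moebius_inv_surj R).
have fQ := @quot_map_fiber R; have fM := @moebius_inv_fiber R.
have eQ := base_embedded (@quot_map_surj R) fQ.
have eM := base_embedded (@moebius_inv_surj R) fM.
split.
  exists (submanifold_atlas vQ), (submanifold_atlas vM); split.
  - exact: embedded_manifold eQ.
  - exact: pi_submersion eQ.
  - exact: embedded_manifold eM.
  - (* In the coordinates (b, w), the bijection between cosets and Moebius
     transformations is the identity. *)
    have E1 t : base_coords (@moebius_inv_surj R) (moebius_inv (base_slice t)) = t.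
      exact: pi_sliceK.
    have E2 t : base_coords (@quot_map_surj R) (quot_map (base_slice t)) = t.
      exact: pi_sliceK.
    exists (fun q => moebius_inv (base_slice (base_coords (@quot_map_surj R) q))).
    split; first by move=> A; rewrite (base_coords_pi _ fQ) (pi_slice_coords fM).
    exists (fun m => quot_map (base_slice (base_coords (@moebius_inv_surj R) m))).
    split.
    + by move=> q _; split=> //; rewrite E1; exact: (base_coordsK (@quot_map_surj R) fQ).
    + by move=> q _; split=> //; rewrite E2; exact: (base_coordsK (@moebius_inv_surj R) fM).
    + apply: (ext_smooth_map eQ eM).
      apply: (@ext_smooth_eq _ _ _ _ _ _ vQ); last exact: ext_smooth_id.
      by move=> q _; rewrite /vQ /vM /base_vec /= E1.
    + apply: (ext_smooth_map eM eQ).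
      apply: (@ext_smooth_eq _ _ _ _ _ _ vM); last exact: ext_smooth_id.
      by move=> q _; rewrite /vQ /vM /base_vec /= E2.
move=> AQ AM [mQ sQ mM [Phi [PhiE [g [Phig gPhi sPhi sg]]]]].
have aQ : smooth_atlas AQ by case: mQ.
have aM : smooth_atlas AM by case: mM.
have eAQ := fibration_embedded (@quot_map_surj R) fQ aQ sQ.
have K1 : cancel Phi g by move=> q; have [] := Phig q I.
have K2 : cancel g Phi by move=> m; have [] := gPhi m I.
have := embedded_transport eAQ aM sPhi sg K1 K2.
(* Both read the coordinates (b, w) of A, on its coset and on F_{A^-1}. *)
have -> : base_vec (@quot_map_surj R) \o g = vM.
  apply/funext => m; have [A <-] := moebius_inv_surj m.
  by rewrite /vM /base_vec /= (base_coords_pi _ fM) -PhiE K1 (base_coords_pi _ fQ).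
exact: pi_bundle.
Qed.
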